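(* Let $S\subset\mathbf{P}^3$ be a general quartic surface over $\mathbf{C}$. Then for every smooth hyperplane section $C\in|\mathcal{O}_S(1)|$ one has $\mathrm{H}^0(C,T_S|_C)=0$. Consequently, the moduli map $\mu\colon|\mathcal{O}_S(1)|_{\mathrm{sm}}\to\mathscr{M}_3$ is unramified.
   Context: ''General'' means: corresponding to a point of a suitable nonempty Zariski open subset of the projective space of quartic forms in four variables. $|\mathcal{O}_S(1)|_{\mathrm{sm}}$ is the open locus of smooth hyperplane sections, $\mathscr{M}_3$ is the moduli space of smooth curves of genus $3$, and $\mu$ sends a curve to its isomorphism class. The differential of $\mu$ at $[C]$ is understood as the Kodaira–Spencer map $d\mu_{[C]}\colon \mathrm{H}^0(C,N_{C/S})\to\mathrm{H}^1(C,T_C)$, the connecting map of $0\to T_C\to T_S|_C\to N_{C/S}\to0$, and $\mu$ is unramified if $d\mu_{[C]}$ is injective for every $[C]\in|\mathcal{O}_S(1)|_{\mathrm{sm}}$. *)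

(* Defs.v *)
From HB Require Import structures.
From mathcomp Require Import all_boot all_order all_algebra.
From mathcomp Require Import complex reals mpoly.

Set Implicit Arguments.
Unset Strict Implicit.
Unset Printing Implicit Defensive.

Import GRing.Theory.
Local Open Scope ring_scope.

(* Zariski topology on the projective space P(V) of lines of a
   finite-dimensional vector space V.  A subset of P(V) is given by a predicate
   on the nonzero vectors of V. *)
Section Genericity.
Variables (K : fieldType) (V : vectType K).

Definition zariski_open (U : V -> Prop) : Prop :=
  exists E : {mpoly K[\dim {:V}]} -> Prop,
    (forall G, E G -> exists d : nat, G \is d.-homog) /\
    (forall v : V, v != 0 ->
       (U v <-> exists2 G, E G & G.@[fun i => coord (vbasis {:V}) i v] != 0)).

Definition general (Q : V -> Prop) : Prop :=
  exists U : V -> Prop,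
    [/\ zariski_open U, (exists2 v, v != 0 & U v)
      & forall v, v != 0 -> U v -> Q v].

End Genericity.

(* Closed subschemes of P^(n-1) are given by a sequence X of homogeneous
   equations in n variables: X stands for Proj (K[x]/(X)).  The ring
   O_X(D_+(h)) = (K[x]/(X))_(h) is presented as the ring [reg h] of degree-0
   fractions p / h^m, taken in K(x), modulo the ideal [van X h].  Sections of
   the sheaves below are therefore functions on representatives, and equality
   of sections is congruence modulo [van X h]. *)
Section ProjectiveSchemes.
Variables (K : fieldType) (n : nat).

Local Notation poly := {mpoly K[n]}.
Local Notation ratf := {fraction {mpoly K[n]}}.
Implicit Types (X Z : seq poly) (f h g : poly).

Definition in_ideal X (p : poly) : Prop :=
  exists c : 'I_(size X) -> poly, p = \sum_(i < size X) c i * X`_i.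

Definition frac0 (I : poly -> Prop) h (a : ratf) : Prop :=
  exists d m p, [/\ h \is d.-homog, p \is (m * d).-homog, I p
                  & a = tofrac p / tofrac h ^+ m].

Definition reg h : ratf -> Prop := frac0 (fun=> True) h.
Definition van X h : ratf -> Prop := frac0 (in_ideal X) h.

(* The basic opens D_+(h) contained in D_+(f) may be indexed by the multiples h
   of f, since D_+(h) = D_+(f h) whenever D_+(h) is contained in D_+(f).
   For f = 1 these are all the basic opens. *)
Definition basic f h : Prop :=
  [/\ h != 0, exists d, h \is d.+1.-homog & exists e, h = f * e].

Definition presection := poly -> ratf -> ratf.

(* For Z contained in X, with inclusion i : Z -> X, this is a section over
   D_+(f) of the sheaf of K-derivations Der_K(O_X, i_* O_Z): a family of
   derivations O_X(D_+(h)) -> O_Z(D_+(h)) compatible with restriction.  By the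
   universal property of differentials this sheaf is
   Hom(Omega_X, i_* O_Z) = i_* Hom(i^* Omega_X, O_Z), hence it is T_X|_Z when X
   is smooth along Z, and T_Z when X = Z.  Moreover T_Z is the subsheaf of
   T_X|_Z formed by the derivations that kill the ideal of Z. *)
Record der_section X Z f (D : presection) : Prop := DerSection {
  der_reg : forall h a, basic f h -> reg h a -> reg h (D h a);
  der_const : forall h (c : K), basic f h -> van Z h (D h (tofrac c%:MP));
  der_add : forall h a b, basic f h -> reg h a -> reg h b ->
    van Z h (D h (a + b) - (D h a + D h b));
  der_mul : forall h a b, basic f h -> reg h a -> reg h b ->
    van Z h (D h (a * b) - (a * D h b + b * D h a));
  der_van : forall h a, basic f h -> van X h a -> van Z h (D h a);
  der_res : forall h g a, basic f h -> basic h g -> reg h a ->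
    van Z g (D g a - D h a)
}.

Definition sec_eq Z f (D D' : presection) : Prop :=
  forall h a, basic f h -> reg h a -> van Z h (D h a - D' h a).

Definition sec0 : presection := fun _ _ => 0.
Definition sec_add (D D' : presection) : presection :=
  fun h a => D h a + D' h a.
Definition sec_sub (D D' : presection) : presection :=
  fun h a => D h a - D' h a.

Definition H0_tangent_restr_eq0 X Z : Prop :=
  forall D, der_section X Z 1 D -> sec_eq Z 1 D sec0.

(* H^0(Z, N_{Z/X}) for N_{Z/X} the cokernel of T_Z -> T_X|_Z.  The opens
   D_+(x_i) are affine, so that a section of the cokernel lifts to a section of
   T_X|_Z over each of them, uniquely up to a section of T_Z: a global section
   is a family t of lifts whose differences on overlaps lie in T_Z. *)
Definition normal_section X Z (t : 'I_n -> presection) : Prop :=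
  (forall i, der_section X Z 'X_i (t i)) /\
  (forall i j, der_section Z Z ('X_i * 'X_j) (sec_sub (t j) (t i))).

Definition normal_eq Z (t t' : 'I_n -> presection) : Prop :=
  forall i, der_section Z Z 'X_i (sec_sub (t i) (t' i)).

(* H^1(Z, T_Z) as the Cech cohomology of the affine cover (D_+(x_i))_i. *)
Definition H1_cocycle Z (c : 'I_n -> 'I_n -> presection) : Prop :=
  (forall i j, der_section Z Z ('X_i * 'X_j) (c i j)) /\
  (forall i j k, sec_eq Z ('X_i * 'X_j * 'X_k)
                        (sec_add (c i j) (c j k)) (c i k)).

Definition H1_eq Z (c c' : 'I_n -> 'I_n -> presection) : Prop :=
  exists2 u : 'I_n -> presection,
    (forall i, der_section Z Z 'X_i (u i)) &
    (forall i j, sec_eq Z ('X_i * 'X_j) (sec_sub (c i j) (c' i j))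
                        (sec_sub (u j) (u i))).

(* Kodaira-Spencer map: the connecting map H^0(Z, N_{Z/X}) -> H^1(Z, T_Z). *)
Definition kodaira_spencer (t : 'I_n -> presection) (i j : 'I_n) : presection :=
  sec_sub (t j) (t i).

Definition kodaira_spencer_injective X Z : Prop :=
  forall t t', normal_section X Z t -> normal_section X Z t' ->
    H1_eq Z (kodaira_spencer t) (kodaira_spencer t') -> normal_eq Z t t'.

Lemma van0 Z f h : basic f h -> van Z h 0.
Proof.
case=> _ [d hd] _; exists d.+1, 0%N, 0; split=> //.
- by rewrite mul0n; exact: dhomog0.
- by exists (fun=> 0); rewrite big1 // => i _; rewrite mul0r.
- by rewrite rmorph0 mul0r.
Qed.

Lemma kodaira_spencer_cocycle X Z t :
  normal_section X Z t -> H1_cocycle Z (kodaira_spencer t).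
Proof.
move=> [_ tN]; split=> // i j k h a hh _.
rewrite /sec_add /kodaira_spencer /sec_sub.
by rewrite [t j h a - _ + _]addrC subrKA subrr; exact: van0 hh.
Qed.

Lemma kodaira_spencer_wd X Z t t' :
  normal_section X Z t -> normal_section X Z t' -> normal_eq Z t t' ->
  H1_eq Z (kodaira_spencer t) (kodaira_spencer t').
Proof.
move=> _ _ tt'; exists (fun i => sec_sub (t i) (t' i)) => // i j h a hh _.
rewrite /kodaira_spencer /sec_sub [X in van _ _ X](_ : _ = 0).
  exact: van0 hh.
apply/eqP; rewrite subr_eq0; apply/eqP.
by rewrite !opprD !opprK addrACA [- t i h a + _]addrC.
Qed.

(* Jacobian criterion, for algebraically closed K: Z is smooth of codimension
   [size Z] at all its points. *)
Definition smooth_complete_intersection Z : Prop :=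
  forall v : 'I_n -> K, (exists i, v i != 0) ->
    (forall i : 'I_(size Z), (Z`_i).@[v] = 0) ->
    \rank (\matrix_(i < size Z, j < n) ((Z`_i)^`M(j)).@[v]) = size Z.

End ProjectiveSchemes.

Section HyperplaneSections.
Variables (K : fieldType) (n d : nat).
Implicit Types (F : dhomog n.+1 K d) (l : dhomog n.+1 K 1).

Definition surface F : seq {mpoly K[n.+1]} := [:: mpoly_of_dhomog F].
Definition plane_section F l : seq {mpoly K[n.+1]} :=
  [:: mpoly_of_dhomog F; mpoly_of_dhomog l].

(* |O_S(1)|_sm, as an open subset of |O_S(1)| = P(linear forms).  Smoothness of
   the section forces dF <> 0 along it, hence S to be smooth along it, so that
   [der_section] does describe the restriction of T_S. *)
Definition smooth_section F l : Prop :=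
  l != 0 /\ smooth_complete_intersection (plane_section F l).

(* The moduli map is unramified: its differential, the Kodaira-Spencer map, is
   injective at every point of |O_S(1)|_sm. *)
Definition moduli_map_unramified F : Prop :=
  forall l, smooth_section F l ->
    kodaira_spencer_injective (surface F) (plane_section F l).

End HyperplaneSections.

(* Main.v *)
(* Let Z be the section of S = {F = 0} by a plane {l = 0}.  A section of T_S|_Z
   is given on D_+(x_i) by the images Y_b of the coordinates x_b / x_i, and the
   bivectors x_i (x_a Y_b - x_b Y_a) glue to quadrics modulo (F, l); by exactness
   of the Koszul complex and deg F > 3 they are of the form x_a L_b - x_b L_a for
   linear forms L_a (the Euler sequence).  Tangency to S means that the linear
   vector field M = (L_a) satisfies M F = w l, up to a multiple of F.  If the
   plane is invariant under M, then M induces a linear vector field killing the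
   equation of a smooth plane quartic; such a field vanishes, and so does the
   section.  The kernel of the Kodaira-Spencer map lifts to global sections of
   T_S|_Z, hence vanishes as well.

   If the plane is not invariant, then in coordinates adapted to the flag
   l, l M, ... the relation M F = w l determines one cubic coefficient of F and
   leaves one equation for a binary quartic and a binary cubic.  Together with
   the 6 parameters of the flag, such quartics form finitely many families
   depending on 9 + 19 + 6 = 34 parameters, fewer than the 35 coefficients of a
   quartic: they lie in a proper closed subset. *)

Require Import Defs.
From HB Require Import structures.
From mathcomp Require Import all_boot all_order all_algebra.
From mathcomp Require Import fingroup perm ring.
From mathcomp Require Import complex reals mpoly.

Set Implicit Arguments.
Unset Strict Implicit.
Unset Printing Implicit Defensive.

Import Order.TTheory GRing.Theory Num.Theory.
Local Open Scope ring_scope.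

(** * Polynomials *)

Section MPolyGeneral.
Variables (n : nat).

(** The parameter count becomes effective without dimension theory: 35 polynomials in 34 variables
    are algebraically dependent, and a relation is a nonzero equation for the image of a family. For
    this, each family must be the polynomial image of one affine space. The obstacle is the equation
    D0 a + mu t b = 0 between the binary quartic a and the binary cubic b, where D0 is a linear
    field in s, t. If mu is nonzero, it determines b and leaves a single quadratic equation, solved
    in two charts. If mu = 0, it leaves b free and restricts a only. But then the span of l and l M
    is invariant, so the third step of the flag is free; chosen by an eigenvector of M on the
    quotient, it makes D0 triangular, and a becomes a monomial in explicit eigenforms of D0.
    Rescaling M saves one further parameter, so nine suffice in every case. On the cohomological
    side, vanishing of a fraction on a chart bounds its numerator only up to a power of the
    denominator. Hence the Euler sequence has to wait for two facts: (F, l) is saturated, and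
    sections of O_Z(e) come from forms of degree e. *)

Lemma mpoly_ring_ind (R : comNzRingType) (P : {mpoly R[n]} -> Prop) :
  (forall c, P c%:MP) -> (forall i, P 'X_i) ->
  (forall p q, P p -> P q -> P (p + q)) ->
  (forall p q, P p -> P q -> P (p * q)) -> forall p, P p.
Proof.
move=> PC PX PD PM p; rewrite (mpolyE p).
apply: (big_ind P) => [|//|m _]; first by rewrite -mpolyC0.
rewrite -mul_mpolyC; apply: (PM _ _ (PC _)); rewrite mpolyXE_id.
apply: (big_ind P) => [|//|i _]; first by rewrite -mpolyC1.
by elim: (m i) => [|k IH]; rewrite ?expr0 ?exprS -?mpolyC1 //; apply: PM.
Qed.

Lemma pihomogM (R : comNzRingType) (p q : {mpoly R[n]}) d e :
  q \is e.-homog -> pihomog mdeg (d + e) (p * q) = pihomog mdeg d p * q.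
Proof.
move=> hq; have [k lek] := ubnPleq (maxn (msize p) d.+1).
rewrite {1}(@pihomog_partitionE _ _ mdeg k p) ?(leq_trans (leq_maxl _ _) lek) //.
rewrite mulr_suml raddf_sum /=.
have dk : (d < k)%N by rewrite (leq_trans (leq_maxr _ _) lek).
rewrite (bigD1 (Ordinal dk)) //= big1 ?addr0 => [|i ni].
  by rewrite pihomog_dE // dhomogM // pihomogP.
rewrite (@pihomog_ne0 _ _ mdeg (i + e)%N) ?eqn_add2r //.
by rewrite dhomogM // pihomogP.
Qed.

Lemma pihomogM_lt (R : comNzRingType) (p q : {mpoly R[n]}) d e :
  (d < e)%N -> q \is e.-homog -> pihomog mdeg d (p * q) = 0.
Proof.
move=> de hq; rewrite {1}(@pihomog_partitionE _ _ mdeg _ p (leqnn _)).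
rewrite mulr_suml raddf_sum /= big1 // => i _.
apply: (@pihomog_ne0 _ _ mdeg (i + e)%N); last by rewrite dhomogM // pihomogP.
by rewrite neq_ltn ltn_addl ?orbT.
Qed.

Lemma dhomog_factor (R : idomainType) (p q : {mpoly R[n]}) d e :
  p != 0 -> p \is d.-homog -> p * q \is (d + e).-homog -> q \is e.-homog.
Proof.
move=> p0 hp hpq; have := pihomogM q e hp.
rewrite addnC mulrC (pihomog_dE hpq) => /eqP; rewrite [_ * p]mulrC.
by rewrite (inj_eq (mulfI p0)) eq_sym -homog_piE.
Qed.

Lemma mderivXU (R : comNzRingType) (i j : 'I_n) :
  ('X_j : {mpoly R[n]})^`M(i) = (i == j)%:R.
Proof.
rewrite mderivX mnm1E eq_sym; case: eqP => [->|_]; last by rewrite scale0r.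
rewrite scale1r -mpolyX0; congr 'X_[_].
by apply/mnmP => k; rewrite mnmBE mnm0E subnn.
Qed.

(** Additivity and the Leibniz rule hold only modulo [J], since sections are functions on
    representatives; [J] will be the ideal [van Z h]. *)
Lemma chain_rule (R : comNzRingType) (A : comNzRingType)
    (phi : {rmorphism {mpoly R[n]} -> A}) (J : A -> Prop)
    (d : {mpoly R[n]} -> A) :
  J 0 -> (forall a b, J a -> J b -> J (a + b)) ->
  (forall p a, J a -> J (phi p * a)) ->
  (forall c, J (d c%:MP)) ->
  (forall p q, J (d (p + q) - (d p + d q))) ->
  (forall p q, J (d (p * q) - (phi p * d q + phi q * d p))) ->
  forall p, J (d p - \sum_i phi p^`M(i) * d 'X_i).
Proof.
move=> J0 JD JM dC dD dM; elim/mpoly_ring_ind => [c|i|p q Jp Jq|p q Jp Jq].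
- rewrite big1 ?subr0 // => i _; by rewrite mderivC rmorph0 mul0r.
- rewrite (bigD1 i) //= big1 => [|j ji].
    by rewrite mderivXU eqxx rmorph1 mul1r addr0 subrr.
  by rewrite mderivXU (negPf ji) rmorph0 mul0r.
- suff -> : d (p + q) - \sum_i phi (p + q)^`M(i) * d 'X_i =
    (d (p + q) - (d p + d q)) + ((d p - \sum_i phi p^`M(i) * d 'X_i) +
     (d q - \sum_i phi q^`M(i) * d 'X_i)) by apply: (JD _ _ (dD _ _)); apply: JD.
  under eq_bigr do rewrite mderivD rmorphD mulrDl; rewrite big_split /=; ring.
- suff -> : d (p * q) - \sum_i phi (p * q)^`M(i) * d 'X_i =
    (d (p * q) - (phi p * d q + phi q * d p)) +
     (phi q * (d p - \sum_i phi p^`M(i) * d 'X_i) +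
     phi p * (d q - \sum_i phi q^`M(i) * d 'X_i)).
    by apply: (JD _ _ (dM _ _)); apply: JD; apply: JM.
  have -> : \sum_i phi (p * q)^`M(i) * d 'X_i =
    phi q * (\sum_i phi p^`M(i) * d 'X_i) + phi p * (\sum_i phi q^`M(i) * d 'X_i).
    rewrite !mulr_sumr -big_split /=; apply: eq_bigr => i _.
    by rewrite mderivM rmorphD !rmorphM; ring.
  ring.
Qed.

Lemma euler (R : comNzRingType) (p : {mpoly R[n]}) d :
  p \is d.-homog -> \sum_i 'X_i * p^`M(i) = p *+ d.
Proof.
move=> hp; rewrite [in RHS](mpolyE p) -sumrMnl.
under eq_bigr => i _ do rewrite [p in p^`M(_)]mpolyE raddf_sum /= mulr_sumr.
rewrite exchange_big /= big_seq [RHS]big_seq; apply: eq_bigr => m mp.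
have -> : d = (\sum_i m i)%N by rewrite -mdegE; exact/esym/(dhomog_mf hp mp).
rewrite -sumrMnr; apply: eq_bigr => i _.
rewrite mderivZ mderivX scalerA -scalerAr -scaler_nat scalerA.
case: (posnP (m i)) => [->|mi]; first by rewrite mulr0 mul0r !scale0r.
by rewrite -mpolyXD addmC submK ?lep1mP -?lt0n // mulrC.
Qed.

End MPolyGeneral.

Lemma mderiv_homog (n : nat) (R : comNzRingType) (p : {mpoly R[n]}) d i :
  p \is d.+1.-homog -> p^`M(i) \is d.-homog.
Proof.
move=> hp; apply/dhomogP => m; rewrite mcoeff_msupp mcoeff_deriv => pm /=.
have : (m + U_(i))%MM \in msupp p.
  by rewrite mcoeff_msupp; apply: contraNneq pm => ->; rewrite mul0rn.
by move/(dhomog_mf hp); rewrite /= mdegD mdeg1 addn1 => -[].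
Qed.

(** * Powers of the variables as regular sequences *)

Section MonomialIdeals.
Variables (n : nat) (K : fieldType).
Implicit Types (p q a b c : {mpoly K[n]}) (i j k : 'I_n).

Lemma mcoeffMXn_lt q i m (mu : 'X_{1..n}) :
  (mu i < m)%N -> (q * 'X_i ^+ m)@_mu = 0.
Proof.
move=> lt; apply/eqP; rewrite mcoeff_eq0 mpolyXn.
rewrite (perm_mem (msuppMX _ _)); apply/mapP => -[nu _ e].
by move: lt; rewrite e mnmDE mulmnE mnm1E eqxx mul1n ltnNge leq_addr.
Qed.

Lemma mcoeffMXn_add q i m (mu : 'X_{1..n}) :
  (q * 'X_i ^+ m)@_(U_(i) *+ m + mu) = q@_mu.
Proof. by rewrite mpolyXn mcoeffMX. Qed.

Lemma mpolyXn_dvd p i m :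
  (forall mu : 'X_{1..n}, (mu i < m)%N -> p@_mu = 0) -> exists r, p = r * 'X_i ^+ m.
Proof.
move=> h; exists (\sum_(mu <- msupp p) p@_mu *: 'X_[mu - U_(i) *+ m]).
rewrite {1}(mpolyE p) mulr_suml; apply: eq_big_seq => mu; rewrite mcoeff_msupp => mp.
rewrite -scalerAl mpolyXn -mpolyXD submK //; apply/mnm_lepP => j.
rewrite mulmnE mnm1E; case: eqP => [<-|_]; last by rewrite mul0n.
by rewrite mul1n leqNgt; apply: contra mp => /h ->.
Qed.

Lemma mpolyXn_split p i m :
  exists r, forall mu : 'X_{1..n}, (p - r * 'X_i ^+ m)@_mu = if (mu i < m)%N then p@_mu else 0.
Proof.
pose q : {mpoly K[n]} := \sum_(mu <- msupp p | (mu i < m)%N) p@_mu *: 'X_[mu].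
have qE mu : q@_mu = if (mu i < m)%N then p@_mu else 0.
  rewrite raddf_sum /=; case: ifP => mi; last first.
    rewrite big1 // => nu ni; rewrite mcoeffZ mcoeffX; case: eqP => [e|_].
      by move: ni; rewrite e mi.
    by rewrite mulr0.
  rewrite [in RHS](mpolyE p) raddf_sum /= big_mkcond; apply: eq_bigr => nu _.
  rewrite mcoeffZ mcoeffX; case: ifP => // ni; case: eqP => [e|_].
    by move: ni; rewrite e mi.
  by rewrite mulr0.
have [mu mi|r e] := @mpolyXn_dvd (p - q) i m.
  by rewrite mcoeffB qE mi subrr.
by exists r => mu; rewrite -e subKr qE.
Qed.

Lemma mpolyXn_regular2 p q i j (m e : nat) : i != j ->
  p * 'X_j ^+ e = q * 'X_i ^+ m -> exists r, p = r * 'X_i ^+ m.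
Proof.
move=> ij eq_pq; apply: mpolyXn_dvd => mu mi.
rewrite -(mcoeffMXn_add p j e) eq_pq mcoeffMXn_lt //.
by rewrite mnmDE mulmnE mnm1E eq_sym (negPf ij).
Qed.

(** Remove from c the monomials divisible by ['X_i ^+ m]. A remaining monomial with exponent below m
    at j too would survive multiplication by ['X_k ^+ m], whereas it cannot occur on the right-hand
    side. *)
Lemma mpolyXn_regular3 a b c i j k m : k != i -> k != j ->
  c * 'X_k ^+ m = a * 'X_i ^+ m + b * 'X_j ^+ m ->
  exists a' b', c = a' * 'X_i ^+ m + b' * 'X_j ^+ m.
Proof.
move=> ki kj e; have [a' ha] := mpolyXn_split c i m.
have [mu mj|b' hb] := @mpolyXn_dvd (c - a' * 'X_i ^+ m) j m; last first.
  by exists a', b'; rewrite -hb; ring.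
rewrite ha; case: ifP => // mi.
rewrite -(mcoeffMXn_add c k m) e mcoeffD !mcoeffMXn_lt ?addr0 //.
  by rewrite mnmDE mulmnE mnm1E (negPf kj).
by rewrite mnmDE mulmnE mnm1E (negPf ki).
Qed.

(** Exactness of the Koszul complex of three powers at the bivectors. It serves twice: for the
    ambiguity of Cech cocycles modulo F, and with m = 1 for the Euler sequence. *)
Lemma koszul_exact (i0 i1 i2 : 'I_n) m (c01 c02 c12 : {mpoly K[n]}) :
  i0 != i1 -> i0 != i2 -> i1 != i2 ->
  c12 * 'X_i0 ^+ m - c02 * 'X_i1 ^+ m + c01 * 'X_i2 ^+ m = 0 ->
  exists c0 c1 c2, [/\ c01 = c1 * 'X_i0 ^+ m - c0 * 'X_i1 ^+ m,
    c02 = c2 * 'X_i0 ^+ m - c0 * 'X_i2 ^+ m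
    & c12 = c2 * 'X_i1 ^+ m - c1 * 'X_i2 ^+ m].
Proof.
move=> n01 n02 n12 e.
have [||| a [b cE]] := @mpolyXn_regular3 (- c12) c02 c01 i0 i1 i2 m.
- by rewrite eq_sym.
- by rewrite eq_sym.
- by apply/eqP; rewrite -subr_eq0 -e; apply/eqP; ring.
have e1 : (c02 - b * 'X_i2 ^+ m) * 'X_i1 ^+ m = (c12 + a * 'X_i2 ^+ m) * 'X_i0 ^+ m.
  apply/eqP; rewrite -subr_eq0 -oppr0 -e cE; apply/eqP; ring.
have [r rE] := mpolyXn_regular2 n01 e1.
have X0 : 'X_i0 ^+ m != 0 :> {mpoly K[n]}.
  by rewrite expf_neq0 // -msize_poly_eq0 msizeX.
exists (- b), a, r; split.
- by rewrite cE; ring.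
- by apply/eqP; rewrite -subr_eq0 -(subr0 0) -{1}(subrr (r * 'X_i0 ^+ m)) -{1}rE; apply/eqP; ring.
- have : c12 + a * 'X_i2 ^+ m = r * 'X_i1 ^+ m.
    by apply: (mulIf X0); rewrite -e1 rE; ring.
  by move=> <-; ring.
Qed.

End MonomialIdeals.

Section Ideal.
Variables (n : nat) (K : fieldType).
Implicit Types (X : seq {mpoly K[n]}) (p q F l : {mpoly K[n]}).

Lemma in_ideal0 X : in_ideal X 0.
Proof. by exists (fun=> 0); rewrite big1 // => i _; rewrite mul0r. Qed.

Lemma in_idealD X p q : in_ideal X p -> in_ideal X q -> in_ideal X (p + q).
Proof.
move=> [c ->] [d ->]; exists (fun i => c i + d i); rewrite -big_split /=.
by apply: eq_bigr => i _; rewrite mulrDl.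
Qed.

Lemma in_idealM X p q : in_ideal X q -> in_ideal X (p * q).
Proof.
move=> [c ->]; exists (fun i => p * c i); rewrite mulr_sumr.
by apply: eq_bigr => i _; rewrite mulrA.
Qed.

Lemma in_idealN X p : in_ideal X p -> in_ideal X (- p).
Proof. by rewrite -mulN1r; apply: in_idealM. Qed.

Lemma in_idealB X p q : in_ideal X p -> in_ideal X q -> in_ideal X (p - q).
Proof. by move=> hp hq; apply: in_idealD => //; apply: in_idealN. Qed.

Lemma in_ideal_sum X (I : Type) (r : seq I) (P : pred I) (G : I -> {mpoly K[n]}) :
  (forall i, P i -> in_ideal X (G i)) -> in_ideal X (\sum_(i <- r | P i) G i).
Proof. by move=> h; apply: big_ind => //; [apply: in_ideal0 | apply: in_idealD]. Qed.

Lemma in_ideal1P l p : in_ideal [:: l] p <-> exists w, p = w * l.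
Proof.
split=> [[c ->]|[w ->]]; first by exists (c ord0); rewrite big_ord1.
by exists (fun=> w); rewrite big_ord1.
Qed.

Lemma in_ideal2P F l p : in_ideal [:: F; l] p <-> exists c w, p = c * F + w * l.
Proof.
split=> [[c ->]|[c [w ->]]].
  by exists (c ord0), (c (lift ord0 ord0)); rewrite big_ord_recl big_ord1.
exists (fun i => if i == ord0 then c else w).
by rewrite big_ord_recl big_ord1.
Qed.

End Ideal.

(** * Cech cohomology of the plane section *)

Section Cech.
Variables (K : fieldType).
Local Notation S := {mpoly K[4]}.
Variables (F l : S) (k : 'I_4).
Hypotheses (hl : l \is 1.-homog) (lk : l@_U_(k) != 0).

Lemma linear_formE (n : nat) (R : comNzRingType) (p : {mpoly R[n]}) :
  p \is 1.-homog -> p = \sum_i p@_U_(i) *: 'X_i.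
Proof.
move=> hp; apply/mpolyP => m; rewrite raddf_sum /=.
case: (mdeg1P m) => [[i /eqP ->]|hm].
  rewrite (bigD1 i) //= big1 => [|j ji]; rewrite mcoeffZ mcoeffXU ?eqxx ?mulr1 ?addr0 //.
  by rewrite (negPf ji) mulr0.
rewrite (dhomog_nemf_coeff hp) => [|/=]; last by apply/negP => /mdeg1P.
rewrite big1 // => i _; rewrite mcoeffZ mcoeffX; case: eqP => [e|_]; last by rewrite mulr0.
by case: hm; exists i; rewrite e.
Qed.

(** Solves l = 0 for the variable ['X_k]. Modulo l this leaves polynomials in three variables, where
    the ideal (F, l) becomes principal and divisibility replaces membership. *)
Definition elim_var (p : S) : S :=
  p \mPo [tuple if a == k then 'X_k - (l@_U_(k))^-1 *: l else 'X_a | a < 4].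
Local Notation pi := elim_var.

HB.instance Definition _ := GRing.RMorphism.copy elim_var
  (comp_mpoly [tuple if a == k then 'X_k - (l@_U_(k))^-1 *: l else 'X_a | a < 4]).

Lemma elim_varX a : pi 'X_a = if a == k then 'X_k - (l@_U_(k))^-1 *: l else 'X_a.
Proof. by rewrite /elim_var comp_mpolyXU -tnth_nth tnth_mktuple. Qed.

Lemma elim_var_cong p : exists w, p - pi p = w * l.
Proof.
elim/mpoly_ring_ind: p => [c|a|p q [u hu] [v hv]|p q [u hu] [v hv]].
- by exists 0; rewrite /elim_var comp_mpolyC subrr mul0r.
- rewrite elim_varX; case: eqP => [->|_].
    by exists ((l@_U_(k))^-1)%:MP; rewrite subKr mul_mpolyC.
  by exists 0; rewrite subrr mul0r.
- by exists (u + v); rewrite rmorphD mulrDl -hu -hv; ring.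
- exists (u * q + pi p * v); rewrite rmorphM mulrDl -mulrA -[_ * v * l]mulrA -hv.
  by rewrite [q * l]mulrC mulrA -hu; ring.
Qed.

Lemma elim_var_l : pi l = 0.
Proof.
have piZ c p : pi (c *: p) = c *: pi p by rewrite /elim_var comp_mpolyZ.
have piX a : pi 'X_a = 'X_a - (a == k)%:R * ((l@_U_(k))^-1 *: l).
  by rewrite elim_varX; case: eqP => [->|_]; rewrite ?mul1r // mul0r subr0.
rewrite [in LHS](linear_formE hl) raddf_sum /=.
under eq_bigr => a _ do rewrite piZ piX scalerBr.
rewrite sumrB -linear_formE // (bigD1 k) //= big1 => [|a ak].
  by rewrite eqxx mul1r scalerA divff // scale1r addr0 subrr.
by rewrite (negPf ak) mul0r scaler0.
Qed.

Lemma elim_var_idem p : pi (pi p) = pi p.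
Proof.
have [w e] := elim_var_cong p; apply/eqP; rewrite eq_sym -subr_eq0 -rmorphB e.
by rewrite rmorphM /= elim_var_l mulr0.
Qed.

Lemma in_ideal_elim p : in_ideal [:: F; l] p <-> exists c, pi p = c * pi F.
Proof.
rewrite in_ideal2P; split=> [[c [w ->]]|[c e]].
  by exists (pi c); rewrite rmorphD !rmorphM /= elim_var_l mulr0 addr0.
have [u eu] := elim_var_cong p; have [v ev] := elim_var_cong F.
exists c, (u - c * v); rewrite mulrBl -mulrA -ev -eu e; ring.
Qed.

Hypothesis F_notin : forall w, F != w * l.

Lemma elim_var_neq0 : pi F != 0.
Proof.
have [u eu] := elim_var_cong F; apply: contra (F_notin u) => /eqP e.
by rewrite -eu e subr0.
Qed.

(** After elimination and cancellation of the image of F, the two cofactors satisfy c x_j^m = d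
    x_i^m, so x_i^m divides c. *)
Lemma in_ideal_sat2 i j p m : i != k -> j != k -> i != j ->
  in_ideal [:: F; l] (p * 'X_i ^+ m) -> in_ideal [:: F; l] (p * 'X_j ^+ m) ->
  in_ideal [:: F; l] p.
Proof.
move=> ik jk ij /in_ideal_elim[c ec] /in_ideal_elim[d ed]; apply/in_ideal_elim.
move: ec ed; rewrite !rmorphM !rmorphXn /= !elim_varX (negPf ik) (negPf jk) => ec ed.
have [r er] : exists r, c = r * 'X_i ^+ m.
  apply: (@mpolyXn_regular2 _ _ c d i j m m ij); apply: (mulIf elim_var_neq0).
  by rewrite mulrAC -ec [RHS]mulrAC -ed mulrAC.
exists r; apply: (@mulIf _ ('X_i ^+ m)); last by rewrite ec er mulrAC.
by rewrite expf_neq0 // -msize_poly_eq0 msizeX.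
Qed.

Lemma in_ideal_sat p m :
  (forall i, in_ideal [:: F; l] (p * 'X_i ^+ m)) -> in_ideal [:: F; l] p.
Proof.
move=> h; have n01 : lift k (0 : 'I_3) != lift k 1 by rewrite (inj_eq (@lift_inj _ k)).
by apply: (in_ideal_sat2 _ _ n01 (h _) (h _)); rewrite eq_sym neq_lift.
Qed.

(** The fractions p_i / x_i^m agree on overlaps up to multiples c_ij of F. These c_ij form a Koszul
    cycle, so correcting the p_i by multiples of F makes the agreement exact, and regularity of two
    powers gives the common quotient r. *)
Lemma cech0 (p : 'I_4 -> S) m :
  (forall i j, in_ideal [:: F; l] (p j * 'X_i ^+ m - p i * 'X_j ^+ m)) ->
  exists r, forall i, in_ideal [:: F; l] (r * 'X_i ^+ m - p i).
Proof.
move=> h; set x : 'I_3 -> 'I_4 := lift k.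
have xk a : (x a == k) = false by apply/negbTE; rewrite eq_sym neq_lift.
have [a01 [a02 a12]] : [/\ x 0 != x 1, x 0 != x 2%R & x 1 != x 2%R].
  by rewrite !(inj_eq (@lift_inj _ k)).
have hc a b : exists c, pi (p (x b)) * 'X_(x a) ^+ m - pi (p (x a)) * 'X_(x b) ^+ m
    = c * pi F.
  have /in_ideal_elim[c] := h (x a) (x b).
  by rewrite rmorphB !rmorphM !rmorphXn /= !elim_varX !xk; exists c.
have [c01 e01] := hc 0 1; have [c02 e02] := hc 0 2%R; have [c12 e12] := hc 1 2%R.
have f0 := elim_var_neq0.
have [|c0 [c1 [c2 [E01 E02 E12]]]] := @koszul_exact _ _ _ _ _ m c01 c02 c12 a01 a02 a12.
  apply: (mulIf f0); rewrite mul0r.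
  have -> : (c12 * 'X_(x 0) ^+ m - c02 * 'X_(x 1) ^+ m + c01 * 'X_(x 2%R) ^+ m) * pi F =
    (c12 * pi F) * 'X_(x 0) ^+ m - (c02 * pi F) * 'X_(x 1) ^+ m
    + (c01 * pi F) * 'X_(x 2%R) ^+ m by ring.
  by rewrite -e01 -e02 -e12; ring.
have F1 : (pi (p (x 0)) - c0 * pi F) * 'X_(x 1) ^+ m =
    (pi (p (x 1)) - c1 * pi F) * 'X_(x 0) ^+ m.
  apply/eqP; rewrite eq_sym -subr_eq0 -[X in _ == X](subrr (c01 * pi F)) -{1}e01 {1}E01.
  by apply/eqP; ring.
have F2 : (pi (p (x 0)) - c0 * pi F) * 'X_(x 2%R) ^+ m =
    (pi (p (x 2%R)) - c2 * pi F) * 'X_(x 0) ^+ m.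
  apply/eqP; rewrite eq_sym -subr_eq0 -[X in _ == X](subrr (c02 * pi F)) -{1}e02 {1}E02.
  by apply/eqP; ring.
have [r r0] := mpolyXn_regular2 a01 F1.
have X0 : 'X_(x 0) ^+ m != 0 :> S.
  by rewrite expf_neq0 // -msize_poly_eq0 msizeX.
have r1 : pi (p (x 1)) - c1 * pi F = r * 'X_(x 1) ^+ m.
  by apply: (mulIf X0); rewrite -F1 r0 mulrAC.
have r2 : pi (p (x 2%R)) - c2 * pi F = r * 'X_(x 2%R) ^+ m.
  by apply: (mulIf X0); rewrite -F2 r0 mulrAC.
have main a c : pi (p (x a)) - c * pi F = r * 'X_(x a) ^+ m ->
    in_ideal [:: F; l] (r * 'X_(x a) ^+ m - p (x a)).
  move=> e; apply/in_ideal_elim; exists (- pi c).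
  have := congr1 pi e; rewrite rmorphB !rmorphM rmorphXn /= elim_varX xk !elim_var_idem.
  by rewrite rmorphB rmorphM rmorphXn /= elim_varX xk => <-; ring.
have all_x a : in_ideal [:: F; l] (r * 'X_(x a) ^+ m - p (x a)).
  have [->|->|->] : [\/ a = 0, a = 1 | a = 2%R].
    by case: a => [[|[|[|]]]] //= ha; [apply: Or31|apply: Or32|apply: Or33]; apply: val_inj.
  - exact: main r0.
  - exact: main r1.
  - exact: main r2.
exists r => i; case: (unliftP k i) => [a -> //|->].
(* The eliminated variable took no part in the Koszul argument; its chart follows from the others by
   saturation. *)
have sat a : in_ideal [:: F; l] ((r * 'X_k ^+ m - p k) * 'X_(x a) ^+ m).
  have -> : (r * 'X_k ^+ m - p k) * 'X_(x a) ^+ m =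
    'X_k ^+ m * (r * 'X_(x a) ^+ m - p (x a)) - (p k * 'X_(x a) ^+ m - p (x a) * 'X_k ^+ m).
    ring.
  by apply: in_idealB => //; apply: in_idealM.
by apply: (in_ideal_sat2 _ _ a01 (sat 0) (sat 1)); rewrite xk.
Qed.

End Cech.

Lemma uniform_bound (T : finType) (P : T -> nat -> Prop) :
  (forall i m k, (m <= k)%N -> P i m -> P i k) -> (forall i, exists m, P i m) ->
  exists m, forall i, P i m.
Proof.
move=> mono /fin_all_exists[m hm]; exists (\max_i m i) => i.
by apply: mono (hm i); apply: leq_bigmax.
Qed.

(** * Sections over basic opens *)

Section Localization.
Variables (K : fieldType) (n : nat).
Local Notation S := {mpoly K[n]}.
Implicit Types (p q h f : S) (X Z : seq S).

Lemma mpolyX_neq0 (m : 'X_{1..n}) : 'X_[m] != 0 :> S.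
Proof. by rewrite -msize_poly_eq0 msizeX. Qed.

Lemma dhomogXU (i : 'I_n) : ('X_i : S) \is 1.-homog.
Proof. by rewrite dhomogX /= mdeg1. Qed.

Lemma dhomogXn p d k : p \is d.-homog -> p ^+ k \is (k * d).-homog.
Proof. by rewrite mulnC; apply: dhomogMn. Qed.

Lemma dhomog_divisor f e d0 d : f * e != 0 -> f \is d0.-homog -> f * e \is d.-homog ->
  exists2 d1, d = (d0 + d1)%N & e \is d1.-homog.
Proof.
move=> fe0 hf hfe; have [f0 e0] : f != 0 /\ e != 0.
  by move: fe0; rewrite mulf_eq0 negb_or => /andP[].
have dE : d = (d0 + mdeg (mlead e))%N.
  rewrite -(dhomog_mf hfe (mlead_supp fe0)) -(dhomog_mf hf (mlead_supp f0)) /=.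
  by rewrite mleadM // mdegD.
by exists (mdeg (mlead e)) => //; apply: (dhomog_factor f0 hf); rewrite -dE.
Qed.

Section Fixed.
Variables (h : S) (d : nat).
Hypotheses (h0 : h != 0) (hd : h \is d.-homog).
Local Notation hF := (tofrac h).

Lemma hF_neq0 : hF != 0. Proof. by rewrite tofrac_eq0. Qed.

Lemma frac0P (I : S -> Prop) a : frac0 I h a <->
  exists m p, [/\ p \is (m * d).-homog, I p & a = tofrac p / hF ^+ m].
Proof.
split=> [[d' [m [p [hd' hp Ip ->]]]]|[m [p [hp Ip ->]]]]; last by exists d, m, p.
by exists m, p; rewrite (dhomog_uniq h0 hd hd').
Qed.

Lemma frac0_raise (I : S -> Prop) a : (forall p q, I q -> I (p * q)) -> frac0 I h a ->
  exists m0, forall m, (m0 <= m)%N ->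
    exists p, [/\ p \is (m * d).-homog, I p & a = tofrac p / hF ^+ m].
Proof.
move=> IM /frac0P[m0 [p [hp Ip ->]]]; exists m0 => m /subnK em.
exists (h ^+ (m - m0) * p); split.
- by rewrite -{2}em mulnDl dhomogM // dhomogXn.
- exact: IM.
- rewrite rmorphM rmorphXn -{2}em exprD -mulf_div divff ?mul1r //.
  by rewrite expf_neq0 // hF_neq0.
Qed.

Lemma frac0D (I : S -> Prop) a b : (forall p q, I q -> I (p * q)) ->
  (forall p q, I p -> I q -> I (p + q)) -> frac0 I h a -> frac0 I h b -> frac0 I h (a + b).
Proof.
move=> IM ID /(frac0_raise IM)[m hm] /(frac0_raise IM)[k hk].
have [p [hp Ip ->]] := hm _ (leq_maxl m k); have [q [hq Iq ->]] := hk _ (leq_maxr m k).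
apply/frac0P; exists (maxn m k), (p + q); split; last by rewrite rmorphD mulrDl.
  exact: rpredD.
exact: ID.
Qed.

Lemma frac0M (I : S -> Prop) a b : (forall p q, I q -> I (p * q)) ->
  reg h a -> frac0 I h b -> frac0 I h (a * b).
Proof.
move=> IM /frac0P[m [p [hp _ ->]]] /frac0P[k [q [hq Iq ->]]].
apply/frac0P; exists (m + k)%N, (p * q); split.
- by rewrite mulnDl dhomogM.
- exact: IM.
- by rewrite exprD rmorphM mulf_div.
Qed.

Lemma regD a b : reg h a -> reg h b -> reg h (a + b).
Proof. by apply: frac0D. Qed.

Lemma regM a b : reg h a -> reg h b -> reg h (a * b).
Proof. by apply: frac0M. Qed.

Lemma regC c : reg h (tofrac c%:MP).
Proof.
apply/frac0P; exists 0%N, c%:MP; split=> //; last by rewrite expr0 divr1.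
by rewrite mul0n -[c%:MP]mul1r mulrC mul_mpolyC rpredZ // dhomog1.
Qed.

Lemma regN a : reg h a -> reg h (- a).
Proof.
move=> ha; rewrite -mulN1r; apply: regM ha.
by have := regC (-1); rewrite mpolyCN mpolyC1 rmorphN rmorph1.
Qed.

Lemma regB a b : reg h a -> reg h b -> reg h (a - b).
Proof. by move=> ha hb; apply: regD => //; apply: regN. Qed.

Lemma reg1 : reg h 1.
Proof. by have := regC 1; rewrite mpolyC1 rmorph1. Qed.

Variable Z : seq S.

Lemma vanD a b : van Z h a -> van Z h b -> van Z h (a + b).
Proof. by apply: frac0D; [apply: in_idealM|apply: in_idealD]. Qed.

Lemma vanM a b : reg h a -> van Z h b -> van Z h (a * b).
Proof. by apply: frac0M; apply: in_idealM. Qed.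

Lemma vanN a : van Z h a -> van Z h (- a).
Proof. by move=> ha; rewrite -mulN1r; apply: vanM ha; apply: regN; apply: reg1. Qed.

Lemma vanB a b : van Z h a -> van Z h b -> van Z h (a - b).
Proof. by move=> ha hb; apply: vanD => //; apply: vanN. Qed.

Lemma van_0 : van Z h 0.
Proof.
apply/frac0P; exists 0%N, 0; split; last by rewrite rmorph0 mul0r.
  by rewrite rpred0.
exact: in_ideal0.
Qed.

Lemma van_sum (I : Type) (r : seq I) (P : pred I) (G : I -> _) :
  (forall i, P i -> van Z h (G i)) -> van Z h (\sum_(i <- r | P i) G i).
Proof. by move=> hG; apply: big_ind => //; [apply: van_0 | apply: vanD]. Qed.

Lemma van_eq a b : van Z h (a - b) -> van Z h b -> van Z h a.
Proof. by move=> hab hb; rewrite -(subrK b a); apply: vanD. Qed.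

Lemma van_reg a : van Z h a -> reg h a.
Proof. by move=> /frac0P[m [p [hp _ ->]]]; apply/frac0P; exists m, p. Qed.

(** A fraction may be rewritten over a higher power of h, so its vanishing on Z only puts some p h^N
    into the ideal. Getting rid of h^N is the task of the saturation lemmas. *)
Lemma van_sat p k : p \is (k * d).-homog ->
  van Z h (tofrac p / hF ^+ k) <-> exists N, in_ideal Z (p * h ^+ N).
Proof.
move=> hp; split=> [/frac0P[m [q [hq Iq e]]]|[N IN]].
  exists m; suff -> : p * h ^+ m = h ^+ k * q by apply: in_idealM.
  have hn j : hF ^+ j != 0 by rewrite expf_neq0 // hF_neq0.
  apply/eqP; rewrite -tofrac_eq; apply/eqP; rewrite !rmorphM !rmorphXn.
  by move/eqP: e; rewrite eqr_div // => /eqP ->; rewrite mulrC.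
apply/frac0P; exists (k + N)%N, (p * h ^+ N); split=> //.
  by rewrite mulnDl dhomogM // dhomogXn.
rewrite exprD rmorphM rmorphXn -mulf_div divff ?mulr1 //.
by rewrite expf_neq0 // hF_neq0.
Qed.

End Fixed.

Lemma frac0_localize (I : S -> Prop) f e d0 d a : (forall p q, I q -> I (p * q)) ->
  f * e != 0 -> f \is d0.-homog -> f * e \is d.-homog -> frac0 I f a -> frac0 I (f * e) a.
Proof.
move=> IM fe0 hf hfe; have [f0 e0] : f != 0 /\ e != 0.
  by move: fe0; rewrite mulf_eq0 negb_or => /andP[].
have [d1 dE he] := dhomog_divisor fe0 hf hfe; rewrite {}dE in hfe.
move=> /(frac0P f0 hf)[m [p [hp Ip ->]]].
apply/(frac0P fe0 hfe); exists m, (e ^+ m * p); split; [|exact: IM|].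
  by rewrite mulnDr addnC dhomogM // dhomogXn.
rewrite !rmorphM rmorphXn exprMn [tofrac f ^+ m * _]mulrC -mulf_div divff ?mul1r //.
by rewrite expf_neq0 // tofrac_eq0.
Qed.

End Localization.

(** * Derivations on the standard charts *)

Section Dehomogenization.
Variables (K : fieldType) (n : nat).
Local Notation S := {mpoly K[n]}.
Local Notation ratf := {fraction {mpoly K[n]}}.
Implicit Types (p q f g h : S) (i : 'I_n) (D : presection K n).
Local Notation XF i := (tofrac ('X_i : S)).

Definition dehom i : S -> ratf :=
  mmap (@tofrac S \o @mpolyC n K) (fun a => XF a / XF i).

HB.instance Definition _ i := GRing.RMorphism.copy (dehom i)
  (mmap (@tofrac S \o @mpolyC n K) (fun a => XF a / XF i)).

Lemma XF_neq0 i : XF i != 0. Proof. by rewrite tofrac_eq0 mpolyX_neq0. Qed.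

Lemma dehomX i a : dehom i 'X_a = XF a / XF i.
Proof. by rewrite /dehom mmapX mmap1U. Qed.

Lemma dehomC i c : dehom i c%:MP = tofrac c%:MP.
Proof. by rewrite /dehom mmapC. Qed.

Lemma dehom_homog i p k : p \is k.-homog -> dehom i p = tofrac p / XF i ^+ k.
Proof.
move=> hp; rewrite (mpolyE p) !raddf_sum /= mulr_suml.
apply: eq_big_seq => m mp; rewrite -mul_mpolyC !rmorphM /= dehomC -mulrA; congr (_ * _).
have -> : k = (\sum_a m a)%N by rewrite -mdegE; exact/esym/(dhomog_mf hp mp).
rewrite mpolyXE_id !rmorph_prod /= -prodrXr -prodf_div; apply: eq_bigr => a _.
by rewrite !rmorphXn /= dehomX expr_div_n.
Qed.

Lemma dehom_reg i h p : basic 'X_i h -> reg h (dehom i p).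
Proof.
case=> h0 [d hd] [e he]; elim/mpoly_ring_ind: p => [c|a|p q hp hq|p q hp hq].
- by rewrite dehomC; apply: (regC h0 hd).
- rewrite dehomX; move: h0 hd; rewrite he => h0 hd.
  apply: (frac0_localize _ h0 (dhomogXU K i) hd) => //.
  exists 1%N, 1%N, 'X_a; split=> //; first exact: dhomogXU.
  by rewrite mul1n dhomogXU.
- by rewrite rmorphD; apply: (regD h0 hd).
- by rewrite rmorphM; apply: (regM h0 hd).
Qed.

Lemma basicX i : basic ('X_i : S) 'X_i.
Proof.
split; first exact: mpolyX_neq0.
  by exists 0%N; apply: dhomogXU.
by exists 1; rewrite mulr1.
Qed.

Lemma basicXX i j : basic ('X_i * 'X_j : S) ('X_i * 'X_j).
Proof.
split; first by rewrite mulf_neq0 // mpolyX_neq0.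
  by exists 1%N; exact: (dhomogM (dhomogXU K i) (dhomogXU K j)).
by exists 1; rewrite mulr1.
Qed.

Lemma basicM f g h : basic (f * g : S) h -> basic f h.
Proof. by case=> h0 hd [e he]; split=> //; exists (g * e); rewrite he mulrA. Qed.

Lemma basicMr f g h : basic (f * g : S) h -> basic g h.
Proof. by rewrite mulrC; apply: basicM. Qed.

Lemma basic1 f h : basic (f : S) h -> basic 1 h.
Proof. by case=> h0 hd _; split=> //; exists h; rewrite mul1r. Qed.

Lemma frac0_basic (I : S -> Prop) f d0 h a : (forall p q, I q -> I (p * q)) ->
  f \is d0.-homog -> basic f h -> frac0 I f a -> frac0 I h a.
Proof. by move=> IM hf [h0 [d hd] [e he]]; subst h; apply: (frac0_localize IM h0 hf hd). Qed.

Lemma van_basicX (Z : seq S) i h a : basic 'X_i h -> van Z 'X_i a -> van Z h a.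
Proof. by move=> hh; apply: (frac0_basic _ (dhomogXU K i) hh); apply: in_idealM. Qed.

Lemma der_local (X Z : seq S) f g D : (forall h, basic g h -> basic f h) ->
  der_section X Z f D -> der_section X Z g D.
Proof.
move=> gf [h1 h2 h3 h4 h5 h6]; split.
- by move=> h a /gf; apply: h1.
- by move=> h a /gf; apply: h2.
- by move=> h a b /gf; apply: h3.
- by move=> h a b /gf; apply: h4.
- by move=> h a /gf; apply: h5.
- by move=> h k a /gf hh hk; apply: h6.
Qed.

Lemma der_chain (X Z : seq S) i D h p : der_section X Z 'X_i D -> basic 'X_i h ->
  van Z h (D h (dehom i p) - \sum_a dehom i p^`M(a) * D h (dehom i 'X_a)).
Proof.
move=> hD hh; case: (hh) => h0 [d hd] _.
have R q := dehom_reg q hh.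
apply: (@chain_rule n K _ (dehom i) (van Z h) (fun q => D h (dehom i q))).
- exact: (van_0 h0 hd).
- by move=> a b; apply: (vanD h0 hd).
- move=> q a ha; exact: (vanM h0 hd (R q) ha).
- by move=> c; rewrite dehomC; apply: (der_const hD).
- by move=> q r; rewrite rmorphD; apply: (der_add hD hh (R _) (R _)).
- by move=> q r; rewrite rmorphM; apply: (der_mul hD hh (R _) (R _)).
Qed.

(** By the chain rule D vanishes on all polynomials in the coordinates x_a / x_i. A regular function
    a on D_+(h) becomes such a polynomial after multiplication by u = h^m / x_i^e, with e the degree
    of h^m. This u is a unit there and itself such a polynomial, so the Leibniz rule yields u D(a) =
    0. *)
Lemma der_coord_eq0 (X Z : seq S) i D : der_section X Z 'X_i D ->
  (forall a, van Z 'X_i (D 'X_i (XF a / XF i))) -> sec_eq Z 'X_i D (@sec0 K n).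
Proof.
move=> hD D0 h a hh ha; rewrite /sec0 subr0; case: (hh) => h0 [d hd] [e he].
have hi := basicX i.
have Dp p : van Z h (D h (dehom i p)).
  apply: (van_eq h0 hd (der_chain p hD hh)); apply: (van_sum h0 hd) => b _.
  apply: (vanM h0 hd (dehom_reg _ hh)).
  have hb : reg 'X_i (dehom i 'X_b) := dehom_reg _ hi.
  apply: (van_eq h0 hd (der_res hD hi hh hb)).
  by apply: van_basicX hh _; rewrite dehomX.
have /(frac0P h0 hd)[m [p [hp _ ae]]] := ha.
have [u u_def] : exists u, u = dehom i (h ^+ m) by exists (dehom i (h ^+ m)).
have Xm k : XF i ^+ k != 0 by rewrite expf_neq0 // XF_neq0.
have hF : tofrac h ^+ m != 0 by rewrite expf_neq0 // tofrac_eq0.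
have uE : u = tofrac h ^+ m / XF i ^+ (m * d.+1).
  by rewrite u_def (dehom_homog _ (dhomogXn _ hd)) rmorphXn.
have u0 : u != 0 by rewrite uE; apply: (mulf_neq0 hF); rewrite invr_eq0 Xm.
have ru : reg h u^-1.
  apply/(frac0P h0 hd); exists m, ('X_i ^+ (m * d.+1)); split=> //.
    by rewrite -{2}[(m * _)%N]muln1 dhomogXn // dhomogXU.
  by rewrite uE invf_div rmorphXn.
have au : a * u = dehom i p.
  by rewrite ae uE (dehom_homog _ hp) mulrA (divfK hF).
have hu : reg h u by rewrite u_def; exact: dehom_reg.
have := der_mul hD hh ha hu; rewrite au => Dm.
have Du : van Z h (u * D h a).
  have -> : u * D h a = (D h (dehom i p) - a * D h u) -
    (D h (dehom i p) - (a * D h u + u * D h a)) by rewrite opprB [RHS]addrC addrA subrK addrAC subrr add0r.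
  apply: (vanB h0 hd) Dm; apply: (vanB h0 hd) (Dp _) _.
  by rewrite u_def; exact: (vanM h0 hd ha (Dp _)).
by rewrite -[D h a](mulKf u0); exact: (vanM h0 hd ru Du).
Qed.

End Dehomogenization.

(** * Sections of the restricted tangent sheaf as linear vector fields *)

Section Gluing.
Variables (K : fieldType).
Local Notation S := {mpoly K[4]}.
Local Notation ratf := {fraction {mpoly K[4]}}.
Local Notation XF i := (tofrac ('X_i : S)).
Variables (F l : S) (k : 'I_4) (d : nat).
Hypothesis hF : F \is d.-homog.
Hypotheses (hl : l \is 1.-homog) (lk : l@_U_(k) != 0).
Hypothesis F_notin : forall w, F != w * l.
Local Notation Z := [:: F; l].

Lemma dhomogXUn (i : 'I_4) N : ('X_i ^+ N : S) \is N.-homog.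
Proof. by have := dhomogXn N (dhomogXU K i); rewrite muln1. Qed.

Lemma in_ideal_Xn_le m N p (i : 'I_4) : (m <= N)%N ->
  in_ideal Z (p * 'X_i ^+ m) -> in_ideal Z (p * 'X_i ^+ N).
Proof.
by move=> /subnK <- h; rewrite exprD mulrCA; apply: in_idealM.
Qed.

Lemma pihomog_ideal p e : in_ideal Z p -> in_ideal Z (pihomog mdeg e p).
Proof.
have homog_mul (c q : S) d' : q \is d'.-homog -> exists b, pihomog mdeg e (c * q) = b * q.
  move=> hq; have [d'e|ed] := leqP d' e; last first.
    by exists 0; rewrite mul0r; exact: (pihomogM_lt c ed hq).
  exists (pihomog mdeg (e - d') c); rewrite -{1}(subnK d'e); exact: (pihomogM c (e - d') hq).
move/in_ideal2P => [c [w ->]]; apply/in_ideal2P; rewrite pihomogD.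
have [a ->] := homog_mul c _ _ hF; have [b ->] := homog_mul w _ _ hl.
by exists a, b.
Qed.

Lemma van_sat_all p e : p \is e.-homog ->
  (forall i, van Z 'X_i (tofrac p / XF i ^+ e)) -> in_ideal Z p.
Proof.
move=> hp h.
have [|i|N hN] := @uniform_bound _ (fun i N => in_ideal Z (p * 'X_i ^+ N)).
- by move=> i m N; apply: in_ideal_Xn_le.
- apply/(van_sat (mpolyX_neq0 K _) (dhomogXU K i)); last exact: h.
  by rewrite muln1.
- exact: (in_ideal_sat hl lk F_notin hN).
Qed.

Lemma glue_identity (L : fieldType) (x y p q : L) (m e : nat) : x != 0 -> y != 0 ->
  q / y ^+ m - (x / y) ^+ e * (p / x ^+ m) =
  (q * x ^+ (m + e) * y ^+ e - p * x ^+ (e + e) * y ^+ m) / (x * y) ^+ (m + e).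
Proof.
move=> x0 y0; have [xm ym] : x ^+ m != 0 /\ y ^+ m != 0 by rewrite !expf_neq0.
have [xe ye] : x ^+ e != 0 /\ y ^+ e != 0 by rewrite !expf_neq0.
rewrite expr_div_n exprMn !exprD; field.
by rewrite xm ym xe ye.
Qed.

(** Global sections of O_Z(e), where [W i] is the coefficient in the frame x_i^e: they are forms of
    degree e modulo (F, l). *)
Lemma glue_sections (W : 'I_4 -> ratf) e :
  (forall i, reg 'X_i (W i)) ->
  (forall i j, van Z ('X_i * 'X_j) (W j - (XF i / XF j) ^+ e * W i)) ->
  exists2 q, q \is e.-homog & forall i, van Z 'X_i (W i - tofrac q / XF i ^+ e).
Proof.
move=> hW hWW.
have X1 (i : 'I_4) := dhomogXU K i; have X0 (i : 'I_4) := mpolyX_neq0 K U_(i).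
pose P i m := exists2 p : S, p \is m.-homog & W i = tofrac p / XF i ^+ m.
have [|i|m /fin_all_exists2[p hp Wp]] := @uniform_bound _ P.
- move=> i m N /subnK <- [p hp Wp]; exists (p * 'X_i ^+ (N - m)).
    by rewrite addnC; exact: dhomogM hp (dhomogXUn _ _).
  rewrite Wp addnC exprD rmorphM rmorphXn -mulf_div divff ?mulr1 //.
  by rewrite expf_neq0 // XF_neq0.
- by have /(frac0P (X0 i) (X1 i))[m [p []]] := hW i; rewrite muln1 => hp _ Wp; exists m, p.
have hXX (i j : 'I_4) : ('X_i * 'X_j : S) \is 2.-homog := dhomogM (X1 i) (X1 j).
have XX0 (i j : 'I_4) : ('X_i * 'X_j : S) != 0 by rewrite mulf_neq0.
pose num i j := p j * 'X_i ^+ (m + e) * 'X_j ^+ e - p i * 'X_i ^+ (e + e) * 'X_j ^+ m.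
have hom_num i j : num i j \is ((m + e) * 2).-homog.
  apply: rpredB.
    have -> : ((m + e) * 2 = m + (m + e) + e)%N by rewrite muln2 -addnn; ring.
    exact: dhomogM (dhomogM (hp _) (dhomogXUn _ _)) (dhomogXUn _ _).
  have -> : ((m + e) * 2 = m + (e + e) + m)%N by rewrite muln2 -addnn; ring.
  exact: dhomogM (dhomogM (hp _) (dhomogXUn _ _)) (dhomogXUn _ _).
have [[i j]|[i j]|N hN] :=
    @uniform_bound _ (fun ij N => in_ideal Z (num ij.1 ij.2 * ('X_ij.1 * 'X_ij.2) ^+ N)).
- by move=> a b /subnK <- h; rewrite exprD mulrCA; apply: in_idealM.
- apply/(van_sat (XX0 i j) (hXX i j) _); first exact: hom_num.
  have := hWW i j; rewrite !Wp glue_identity ?XF_neq0 //.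
  by rewrite /num rmorphB !rmorphM !rmorphXn.
(* The section is p_i x_i^e / x_i^m. Numerator and denominator are multiplied by x_i^(N + e),
   because the cocycle condition on numerators holds only after multiplication by (x_i x_j)^N. *)
have [|r hr] := @cech0 K F l k hl lk F_notin
    (fun i => p i * 'X_i ^+ e * 'X_i ^+ (N + e)) (m + N + e)%N.
  move=> i j; have := hN (i, j); rewrite /num /= => /(in_idealM ('X_j ^+ e)).
  set u := (X in in_ideal _ X -> _); set v := (X in _ -> in_ideal _ X).
  suff -> : u = v by []; rewrite /u /v exprMn !exprD; ring.
(* [r] need not be homogeneous; as the ideal is, its component of degree e does as well. *)
pose q := pihomog mdeg e r.
have hq : q \is e.-homog := pihomogP _ _ _.
exists q => // i; rewrite Wp.
have Xn N' : XF i ^+ N' != 0 by rewrite expf_neq0 // XF_neq0.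
have -> : tofrac (p i) / XF i ^+ m - tofrac q / XF i ^+ e =
    tofrac (p i * 'X_i ^+ e - q * 'X_i ^+ m) / XF i ^+ (m + e).
  rewrite rmorphB !rmorphM !rmorphXn mulrBl exprD -mulf_div divff ?Xn // mulr1.
  by rewrite [XF i ^+ m * _]mulrC -mulf_div divff ?Xn // mulr1.
apply/(van_sat (X0 i) (X1 i)).
  rewrite muln1; apply: rpredB; first exact: dhomogM (hp _) (dhomogXUn _ _).
  by rewrite addnC; exact: dhomogM hq (dhomogXUn _ _).
exists (N + e)%N.
have := in_idealN (pihomog_ideal (e + (m + N + e)) (hr i)).
have eq_q : pihomog mdeg (e + (m + N + e)) (r * 'X_i ^+ (m + N + e)) =
    q * 'X_i ^+ (m + N + e) := pihomogM r e (dhomogXUn i _).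
rewrite pihomogB eq_q pihomog_dE; last first.
  have -> : (e + (m + N + e) = m + e + (N + e))%N by ring.
  exact: dhomogM (dhomogM (hp _) (dhomogXUn _ _)) (dhomogXUn _ _).
set u := (X in in_ideal _ X -> _); set v := (X in _ -> in_ideal _ X).
by suff -> : u = v by []; rewrite /u /v !exprD; ring.
Qed.

Lemma van_ideal p e i : p \is e.-homog -> in_ideal Z p -> van Z 'X_i (tofrac p / XF i ^+ e).
Proof.
move=> hp Ip; apply/(van_sat (mpolyX_neq0 K _) (dhomogXU K i)); first by rewrite muln1.
by exists 0%N; rewrite expr0 mulr1.
Qed.

Section CoverSections.
Variable s : 'I_4 -> presection K 4.
Hypothesis s_der : forall i, der_section [:: F] Z 'X_i (s i).
Hypothesis s_glue : forall i j, sec_eq Z ('X_i * 'X_j) (s i) (s j).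

Local Notation x i b := (XF b / XF i).
Local Notation Y i b := (s i 'X_i (XF b / XF i)).

Let hX0 (i : 'I_4) : 'X_i != 0 :> S := mpolyX_neq0 K U_(i).
Let hX1 (i : 'I_4) : ('X_i : S) \is 1.-homog := dhomogXU K i.
Let hXX0 (i j : 'I_4) : 'X_i * 'X_j != 0 :> S := mulf_neq0 (hX0 i) (hX0 j).
Let hXX2 (i j : 'I_4) : ('X_i * 'X_j : S) \is 2.-homog := dhomogM (hX1 i) (hX1 j).

Lemma coord_reg i b h : basic 'X_i h -> reg h (x i b).
Proof. by move=> hh; have := dehom_reg 'X_b hh; rewrite dehomX. Qed.

Lemma value_reg i b : reg 'X_i (Y i b).
Proof. exact: (der_reg (s_der i) (basicX K i) (coord_reg b (basicX K i))). Qed.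

Lemma change_chart_identity (L : comNzRingType) (y y' r xb rho dj dj' di : L) :
  y' - (r * y + xb * rho) =
  - (dj' - y') - (dj - dj') + (dj - (r * di + xb * rho)) + r * (di - y).
Proof. ring. Qed.

(** The Leibniz rule for x_b / x_j = (x_i / x_j) (x_b / x_i); rho is the derivative of the
    transition function x_i / x_j. *)
Lemma change_chart i j : exists2 rho, reg ('X_i * 'X_j : S) rho &
  forall b, van Z ('X_i * 'X_j) (Y j b - (x j i * Y i b + x i b * rho)).
Proof.
set h : S := 'X_i * 'X_j.
have bh : basic h h := basicXX K i j.
have bi : basic 'X_i h := basicM bh; have bj : basic 'X_j h := basicMr bh.
have hv := @vanD K 4 h 2 (hXX0 i j) (hXX2 i j) Z.
have hm := @vanM K 4 h 2 (hXX0 i j) (hXX2 i j) Z.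
have hn := @vanN K 4 h 2 (hXX0 i j) (hXX2 i j) Z.
exists (s i h (x j i)) => [|b].
  exact: (der_reg (s_der i) bi (coord_reg i bj)).
rewrite (change_chart_identity _ _ _ _ _ (s i h (x j b)) (s j h (x j b)) (s i h (x i b))).
have e1 := der_res (s_der j) (basicX K j) bj (coord_reg b (basicX K j)).
have e2 : van Z h (s i h (x j b) - s j h (x j b)) := s_glue bh (coord_reg b bj).
have e4 := der_res (s_der i) (basicX K i) bi (coord_reg b (basicX K i)).
have := der_mul (s_der i) bi (coord_reg i bj) (coord_reg b bi).
have -> : x j i * x i b = x j b by rewrite mulrC mulrA divfK ?XF_neq0.
move=> e3; apply: (hv _ _ (hv _ _ (hv _ _ (hn _ e1) (hn _ e2)) e3)).
exact: (hm _ _ (coord_reg i bj) e4).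
Qed.

Definition wedge i a b := x i a * Y i b - x i b * Y i a.

Lemma wedge_identity (L : comNzRingType) (r xa xb ya yb ya' yb' rho : L) :
  r * xa * yb' - r * xb * ya' - r ^+ 2 * (xa * yb - xb * ya) =
  r * xa * (yb' - (r * yb + xb * rho)) - r * xb * (ya' - (r * ya + xa * rho)).
Proof. ring. Qed.

(** The inhomogeneous term of the change of chart is rho times the position vector (x_b / x_i), so
    wedging with the position vector kills it and leaves the transition factor (x_i / x_j)^2 of
    O_Z(2). *)
Lemma wedge_glue a b : exists2 q, q \is 2.-homog &
  forall i, van Z 'X_i (wedge i a b - tofrac q / XF i ^+ 2).
Proof.
have bX := @basicX K 4; apply: (@glue_sections (fun i => wedge i a b)) => [i|i j].
  have r1 : reg 'X_i (x i a * Y i b).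
    exact: (@regM K 4 _ 1 (hX0 i) (hX1 i) _ _ (coord_reg a (bX i)) (value_reg i b)).
  have r2 : reg 'X_i (x i b * Y i a).
    exact: (@regM K 4 _ 1 (hX0 i) (hX1 i) _ _ (coord_reg b (bX i)) (value_reg i a)).
  exact: (@regB K 4 _ 1 (hX0 i) (hX1 i) _ _ r1 r2).
have [rho rho_reg e] := change_chart i j.
have bh := basicXX K i j.
have bi := basicM bh; have bj := basicMr bh.
have rM := @regM K 4 _ 2 (hXX0 i j) (hXX2 i j).
have vM := @vanM K 4 _ 2 (hXX0 i j) (hXX2 i j) Z.
have xE c : x j c = x j i * x i c by rewrite [RHS]mulrC mulrA divfK ?XF_neq0.
rewrite /wedge (xE a) (xE b) (wedge_identity _ _ _ _ _ _ _ rho) -(xE a) -(xE b).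
apply: (@vanB K 4 _ 2 (hXX0 i j) (hXX2 i j) Z).
  by have := vM _ _ (coord_reg a bj) (e b); rewrite (xE a).
by have := vM _ _ (coord_reg b bj) (e a); rewrite (xE b).
Qed.

Lemma normal_identity (L : comNzRingType) (I : finType) (c y y' xb : I -> L) (r rho : L) :
  \sum_b c b * y' b - r ^+ 1 * (\sum_b c b * y b) =
  \sum_b c b * (y' b - (r * y b + xb b * rho)) + rho * \sum_b c b * xb b.
Proof.
rewrite expr1 !mulr_sumr -sumrB -big_split /=; apply: eq_bigr => b _; ring.
Qed.

Local Notation cst c := (tofrac (mpolyC 4 c : S)).

Lemma coord_l i : \sum_b cst l@_U_(b) * x i b = tofrac l / XF i.
Proof.
have := dehom_homog i hl; rewrite expr1 => <-; rewrite [in RHS](linear_formE hl) raddf_sum /=.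
by apply: eq_bigr => b _; rewrite -mul_mpolyC rmorphM /= dehomC dehomX.
Qed.

(** The image of the section in the normal bundle O_Z(1) of the plane: here rho is multiplied by l /
    x_i, which vanishes on Z. This linear form will fix the component of the field along the
    eliminated variable. *)
Lemma normal_glue : exists2 q, q \is 1.-homog &
  forall i, van Z 'X_i (\sum_b cst l@_U_(b) * Y i b - tofrac q / XF i ^+ 1).
Proof.
apply: glue_sections => [i|i j].
  have rM := @regM K 4 _ 1 (hX0 i) (hX1 i).
  apply: (big_ind (reg 'X_i)) => [|a b|b _].
  - by have := @regC K 4 _ 1 (hX0 i) (hX1 i) 0; rewrite mpolyC0 rmorph0.
  - exact: (@regD K 4 _ 1 (hX0 i) (hX1 i)).
  - exact: (rM _ _ (@regC K 4 _ 1 (hX0 i) (hX1 i) _) (value_reg i b)).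
have [rho rho_reg e] := change_chart i j.
have bh := basicXX K i j; have bi := basicM bh.
rewrite (normal_identity _ _ _ (fun b => x i b) _ rho).
have vM := @vanM K 4 _ 2 (hXX0 i j) (hXX2 i j) Z.
apply: (@vanD K 4 _ 2 (hXX0 i j) (hXX2 i j) Z).
  apply: (@van_sum K 4 _ 2 (hXX0 i j) (hXX2 i j) Z) => b _.
  exact: (vM _ _ (@regC K 4 _ 2 (hXX0 i j) (hXX2 i j) _) (e b)).
apply: (vM _ _ rho_reg); rewrite coord_l; apply: (van_basicX bi).
have := @van_ideal l 1 i hl; rewrite expr1; apply.
by apply/in_ideal2P; exists 0, 1; rewrite mul0r mul1r add0r.
Qed.

End CoverSections.

End Gluing.

(** * The Euler sequence: from bivectors to a linear vector field *)

Section Key.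
Variables (K : fieldType).
Local Notation S := {mpoly K[4]}.
Local Notation ratf := {fraction {mpoly K[4]}}.
Local Notation XF i := (tofrac ('X_i : S)).
Variables (F l : S) (k : 'I_4) (d : nat).
Hypothesis hF : F \is d.+1.-homog.
Hypothesis d2 : (2 < d)%N.
Hypotheses (hl : l \is 1.-homog) (lk : l@_U_(k) != 0).
Hypothesis F_notin : forall w, F != w * l.
Local Notation Z := [:: F; l].

Variable s : 'I_4 -> presection K 4.
Hypothesis s_der : forall i, der_section [:: F] Z 'X_i (s i).
Hypothesis s_glue : forall i j, sec_eq Z ('X_i * 'X_j) (s i) (s j).

Local Notation x i b := (XF b / XF i).
Local Notation Y i b := (s i 'X_i (XF b / XF i)).
Local Notation cst c := (tofrac (mpolyC 4 c : S)).

Let hX0 (i : 'I_4) : 'X_i != 0 :> S := mpolyX_neq0 K U_(i).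
Let hX1 (i : 'I_4) : ('X_i : S) \is 1.-homog := dhomogXU K i.

Let vD i := @vanD K 4 _ 1 (hX0 i) (hX1 i) Z.
Let vB i := @vanB K 4 _ 1 (hX0 i) (hX1 i) Z.
Let vN i := @vanN K 4 _ 1 (hX0 i) (hX1 i) Z.
Let vM i := @vanM K 4 _ 1 (hX0 i) (hX1 i) Z.
Let rx i b : reg 'X_i (x i b) := coord_reg b (basicX K i).

Definition is_wedge_of (theta : 'I_4 -> 'I_4 -> S) := forall a b i,
  van Z 'X_i (wedge s i a b - tofrac (theta a b) / XF i ^+ 2).

Section Theta.
Variable theta : 'I_4 -> 'I_4 -> S.
Hypothesis theta2 : forall a b, theta a b \is 2.-homog.
Hypothesis thetaW : is_wedge_of theta.

Lemma koszul_identity (L : fieldType) (A B C X a b c q1 q2 q3 : L) : X != 0 ->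
  (A * q1 - B * q2 + C * q3) / X ^+ 3 =
  (- (A / X * ((B / X * c - C / X * b) - q1 / X ^+ 2)) +
  B / X * ((A / X * c - C / X * a) - q2 / X ^+ 2)) +
  - (C / X * ((A / X * b - B / X * a) - q3 / X ^+ 2)).
Proof. by move=> X0; field. Qed.

Lemma theta_koszul a b c :
  in_ideal Z ('X_a * theta b c - 'X_b * theta a c + 'X_c * theta a b).
Proof.
apply: (@van_sat_all K F l k hl lk F_notin _ 3) => [|i].
  apply: rpredD; last exact: dhomogM (hX1 _) (theta2 _ _).
  by apply: rpredB; exact: dhomogM (hX1 _) (theta2 _ _).
rewrite rmorphD rmorphB !rmorphM (@koszul_identity _ _ _ _ _ (Y i a) (Y i b) (Y i c)) ?XF_neq0 //.
apply: vD; last exact: (vN (vM (rx i c) (thetaW a b i))).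
apply: vD; first exact: (vN (vM (rx i a) (thetaW b c i))).
exact: (vM (rx i b) (thetaW a c i)).
Qed.

Lemma antisym_identity (L : fieldType) (A B X a b q1 q2 : L) :
  (q1 + q2) / X ^+ 2 = - ((A / X * b - B / X * a) - q1 / X ^+ 2) +
    - ((B / X * a - A / X * b) - q2 / X ^+ 2).
Proof. ring. Qed.

Lemma theta_antisym a b : in_ideal Z (theta a b + theta b a).
Proof.
apply: (@van_sat_all K F l k hl lk F_notin _ 2) => [|i].
  exact: rpredD (theta2 _ _) (theta2 _ _).
rewrite rmorphD (@antisym_identity _ (XF a) (XF b) _ (Y i a) (Y i b)).
exact: (vD (vN (thetaW a b i)) (vN (thetaW b a i))).
Qed.

Lemma theta_diag a : in_ideal Z (theta a a).
Proof.
apply: (@van_sat_all K F l k hl lk F_notin _ 2 (theta2 _ _)) => i.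
rewrite -[X in van _ _ X]opprK -[X in - X]add0r -[X in X - _](subrr (x i a * Y i a)).
exact: (vN (thetaW a a i)).
Qed.

Variable lambda : S.
Hypothesis lambda1 : lambda \is 1.-homog.
Hypothesis lambdaV : forall i,
  van Z 'X_i (\sum_b cst l@_U_(b) * Y i b - tofrac lambda / XF i ^+ 1).

Lemma contract_identity (L : fieldType) (I : finType) (c y xb t : I -> L) (A la X a : L) :
  X != 0 ->
  (\sum_b c b * t b - A * la) / X ^+ 2 =
  - (\sum_b c b * ((A / X * y b - xb b * a) - t b / X ^+ 2)) +
  A / X * (\sum_b c b * y b - la / X ^+ 1) + - (a * (\sum_b c b * xb b)).
Proof.
move=> X0; rewrite expr1 [A / X * (_ - _)]mulrBr !mulr_sumr mulrBl -!sumrN mulr_suml.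
rewrite !addrA -big_split /= addrAC -big_split /=; congr (_ + _); last by field.
by apply: eq_bigr => b _; ring.
Qed.

Lemma theta_contract a :
  in_ideal Z (\sum_b (l@_U_(b))%:MP * theta a b - 'X_a * lambda).
Proof.
apply: (@van_sat_all K F l k hl lk F_notin _ 2) => [|i].
  apply: rpredB; last exact: dhomogM (hX1 _) lambda1.
  by apply: rpred_sum => b _; rewrite mul_mpolyC; apply/rpredZ/theta2.
rewrite rmorphB raddf_sum /= rmorphM.
under eq_bigr do rewrite rmorphM.
rewrite (@contract_identity _ _ _ (fun b => Y i b) (fun b => x i b) _ _ _ _ (Y i a)) ?XF_neq0 //.
have rC := @regC K 4 _ 1 (hX0 i) (hX1 i).
apply: vD; last first.
  apply: vN; apply: (vM (value_reg s_der i a)); rewrite coord_l //.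
  have := @van_ideal K F l l 1 i hl; rewrite expr1; apply.
  by apply/in_ideal2P; exists 0, 1; rewrite mul0r mul1r add0r.
apply: vD; last exact: (vM (rx i a) (lambdaV i)).
apply: vN; apply: (@van_sum K 4 _ 1 (hX0 i) (hX1 i)) => b _.
exact: (vM (rC _) (thetaW a b i)).
Qed.

Lemma theta_decomp : exists2 L : 'I_4 -> S, forall a, L a \is 1.-homog &
  forall a b, in_ideal Z (theta a b - ('X_a * L b - 'X_b * L a)).
Proof.
pose v : 'I_3 -> 'I_4 := lift k.
have vk a : (v a == k) = false by apply/negbTE; rewrite eq_sym neq_lift.
have [n01 n02 n12] : [/\ v 0 != v 1, v 0 != v 2%R & v 1 != v 2%R].
  by rewrite !(inj_eq (@lift_inj _ k)).
pose t3 := 'X_(v 0) * theta (v 1) (v 2%R) - 'X_(v 1) * theta (v 0) (v 2%R)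
  + 'X_(v 2%R) * theta (v 0) (v 1).
have t3h : t3 \is 3.-homog.
  apply: rpredD; last exact: dhomogM (hX1 _) (theta2 _ _).
  by apply: rpredB; exact: dhomogM (hX1 _) (theta2 _ _).
have t30 : elim_var l k t3 = 0.
  have /in_ideal2P[c [w e]] := theta_koszul (v 0) (v 1) (v 2%R).
  have := pihomog_dE t3h; rewrite {1}/t3 e pihomogD.
  rewrite (pihomogM_lt c _ hF); last exact: d2.
  rewrite (pihomogM w 2 hl) add0r => <-.
  by rewrite rmorphM /= elim_var_l // mulr0.
have [c0 [c1 [c2 [E01 E02 E12]]]] : exists c0 c1 c2,
    [/\ elim_var l k (theta (v 0) (v 1)) = c1 * 'X_(v 0) ^+ 1 - c0 * 'X_(v 1) ^+ 1,
    elim_var l k (theta (v 0) (v 2%R)) = c2 * 'X_(v 0) ^+ 1 - c0 * 'X_(v 2%R) ^+ 1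
    & elim_var l k (theta (v 1) (v 2%R)) = c2 * 'X_(v 1) ^+ 1 - c1 * 'X_(v 2%R) ^+ 1].
  apply: koszul_exact => //; move: t30; rewrite /t3 rmorphD rmorphB !rmorphM /=.
  by rewrite !elim_varX !vk !expr1 => <-; ring.
pose c j := if j == 0 :> 'I_3 then c0 else if j == 1 then c1 else c2.
pose Lv j := pihomog mdeg 1 (c j).
have Lv1 j : Lv j \is 1.-homog := pihomogP _ _ _.
have lift_theta a b : elim_var l k (theta (v a) (v b)) = c b * 'X_(v a) ^+ 1 - c a * 'X_(v b) ^+ 1 ->
    in_ideal Z (theta (v a) (v b) - ('X_(v a) * Lv b - 'X_(v b) * Lv a)).
  have [w] := elim_var_cong l k (theta (v a) (v b)) => /[swap] -> e.
  have Ie : in_ideal Z (theta (v a) (v b) - (c b * 'X_(v a) - c a * 'X_(v b))).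
    by apply/in_ideal2P; exists 0, w; rewrite mul0r add0r -e !expr1.
  have := pihomog_ideal hF hl 2 Ie; rewrite !pihomogB (pihomog_dE (theta2 _ _)).
  rewrite (pihomogM (c b) 1 (hX1 (v a))) (pihomogM (c a) 1 (hX1 (v b))).
  by rewrite ![_ * 'X_(v _)]mulrC.
(* The Koszul complex sees only the three variables other than ['X_k]. The missing component is
   chosen so that the field sends l to [lambda], as the section does. *)
pose Lk := (l@_U_(k))^-1 *: (lambda - \sum_j (l@_U_(v j)) *: Lv j).
pose L a := if unlift k a is Some j then Lv j else Lk.
have Lv_E j : L (v j) = Lv j by rewrite /L /v liftK.
have Lk_E : L k = Lk by rewrite /L unlift_none.
have sumL : \sum_b (l@_U_(b))%:MP * L b = lambda.
  rewrite (bigD1_ord k) //= Lk_E /Lk mul_mpolyC scalerA divff // scale1r.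
  under [X in _ + X]eq_bigr do rewrite Lv_E mul_mpolyC.
  by rewrite subrK.
exists L.
  move=> a; rewrite /L; case: unliftP => [j _|_]; first exact: Lv1.
  by apply: rpredZ; apply: rpredB => //; apply: rpred_sum => j _; apply/rpredZ/Lv1.
pose T a b := theta a b - ('X_a * L b - 'X_b * L a).
have Tanti a b : in_ideal Z (T a b) -> in_ideal Z (T b a).
  move=> h; have -> : T b a = (theta a b + theta b a) - T a b by rewrite /T; ring.
  exact: in_idealB (theta_antisym a b) h.
have Tdiag a : in_ideal Z (T a a) by rewrite /T subrr subr0; apply: theta_diag.
have T01 : in_ideal Z (T (v 0) (v 1)) by rewrite /T !Lv_E; apply: lift_theta.
have T02 : in_ideal Z (T (v 0) (v 2%R)) by rewrite /T !Lv_E; apply: lift_theta.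
have T12 : in_ideal Z (T (v 1) (v 2%R)) by rewrite /T !Lv_E; apply: lift_theta.
have Tv a b : in_ideal Z (T (v a) (v b)).
  have I3 (e : 'I_3) : [\/ e = 0, e = 1 | e = 2%R].
    by case: e => [[|[|[|]]]] //= ?; [apply: Or31|apply: Or32|apply: Or33]; apply: val_inj.
  by case: (I3 a) => ->; case: (I3 b) => ->; try exact: Tdiag; try assumption; exact: Tanti.
(* The contraction of the defect [T] with l lies in the ideal, and all its terms but the one of
   index k are known to; the coefficient of ['X_k] in l is invertible. *)
have Tk a : in_ideal Z (T (v a) k).
  have -> : T (v a) k = ((l@_U_(k))^-1)%:MP *
     ((\sum_b (l@_U_(b))%:MP * T (v a) b) - \sum_j (l@_U_(v j))%:MP * T (v a) (v j)).
    rewrite (bigD1_ord k) //= addrK mulrA -mpolyCM mulVf // mpolyC1 mul1r //.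
  apply: in_idealM; apply: in_idealB; last first.
    by apply: in_ideal_sum => j _; apply: in_idealM.
  have -> : \sum_b (l@_U_(b))%:MP * T (v a) b =
     (\sum_b (l@_U_(b))%:MP * theta (v a) b - 'X_(v a) * lambda) + L (v a) * l.
    have -> : L (v a) * l = \sum_b L (v a) * ((l@_U_(b))%:MP * 'X_b).
      rewrite [X in _ * X](linear_formE hl) mulr_sumr.
      by apply: eq_bigr => b _; rewrite mul_mpolyC.
    rewrite -sumL mulr_sumr -sumrB -big_split /=.
    by apply: eq_bigr => b _; rewrite /T; ring.
  apply: in_idealD; first exact: theta_contract.
  by apply/in_ideal2P; exists 0, (L (v a)); rewrite mul0r add0r.
move=> a b; rewrite -/(T a b).
by case: (unliftP k a) => [i ->|->]; case: (unliftP k b) => [j ->|->];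
   [exact: Tv | exact: Tk | exact/Tanti/Tk | exact: Tdiag].
Qed.

End Theta.

Lemma der_one i : van Z 'X_i (Y i i).
Proof.
have := der_const (s_der i) 1 (basicX K i).
by rewrite divff ?XF_neq0 // mpolyC1 rmorph1.
Qed.

Lemma value_identity (L : fieldType) (X A la li q yi ya : L) : X != 0 ->
  ya - (X * la - A * li) / X ^+ 2 =
  ((X / X * ya - A / X * yi) - q / X ^+ 2) + (q - (X * la - A * li)) / X ^+ 2 + A / X * yi.
Proof. by move=> X0; field. Qed.

(** Take i itself as first index of the bivector: x_i / x_i = 1 has derivative 0, so the component
    (i, a) is just the value on x_a / x_i. *)
Lemma values_linear : exists2 L : 'I_4 -> S, forall a, L a \is 1.-homog &
  forall i a, van Z 'X_i (Y i a - tofrac ('X_i * L a - 'X_a * L i) / XF i ^+ 2).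
Proof.
have := @fin_all_exists2 _ _
  (fun (ab : 'I_4 * 'I_4) (q : S) => q \is 2.-homog)
  (fun (ab : 'I_4 * 'I_4) (q : S) => forall i,
     van Z 'X_i (wedge s i ab.1 ab.2 - tofrac q / XF i ^+ 2))
  (fun ab => wedge_glue hF hl lk F_notin s_der s_glue ab.1 ab.2).
case=> th th2 thW.
have [la la1 laV] := normal_glue hF hl lk F_notin s_der s_glue.
have [L L1 hL] := @theta_decomp (fun a b => th (a, b)) (fun a b => th2 (a, b))
  (fun a b i => thW (a, b) i) la la1 laV.
exists L => // i a.
rewrite rmorphB !rmorphM (@value_identity _ _ _ _ _ (tofrac (th (i, a))) (Y i i)) ?XF_neq0 //.
apply: vD; last exact: (vM (rx i a) (der_one i)).
apply: vD; first exact: (thW (i, a) i).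
have := @van_ideal K F l _ 2 i _ (hL i a).
rewrite !rmorphB !rmorphM /=; apply; apply: rpredB; first exact: th2.
by apply: rpredB; exact: dhomogM (hX1 _) (L1 _).
Qed.

Lemma tangent_identity (L : fieldType) (I : finType) (f la A : I -> L) (X li f0 : L) :
  X != 0 -> \sum_b A b * f b = f0 *+ d.+1 ->
  (\sum_b la b * f b) / X ^+ d.+1 =
  \sum_b f b / X ^+ d * ((X * la b - A b * li) / X ^+ 2) + (li * f0) / X ^+ d.+2 *+ d.+1.
Proof.
move=> X0 E; rewrite -mulrnAl -mulrnAr -E mulr_sumr !mulr_suml -big_split /=.
apply: eq_bigr => b _; rewrite !exprS; field.
by rewrite X0 expf_neq0.
Qed.

(** Stated for a family on the four charts which agrees on overlaps, since this is what the kernel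
    of the Kodaira-Spencer map produces. The hypothesis allows only multiples of the Euler field
    modulo l, and the Euler field has no effect on the degree-0 functions x_a / x_i. *)
Theorem cover_section_eq0 :
  (forall L : 'I_4 -> S, (forall a, L a \is 1.-homog) ->
     in_ideal Z (\sum_a L a * F^`M(a)) ->
     exists c : K, forall a, in_ideal [:: l] (L a - c *: 'X_a)) ->
  forall i, sec_eq Z 'X_i (s i) (@sec0 K 4).
Proof.
move=> NS i; have [L L1 hL] := values_linear.
have F1 a : F^`M(a) \is d.-homog := mderiv_homog a hF.
(* Tangency is checked chart by chart: the section kills F / x_j^(d + 1), and Euler's formula turns
   the correction by L_j into a multiple of F. *)
have [|c hc] := NS L L1.
  apply: (@van_sat_all K F l k hl lk F_notin _ d.+1) => [|j].
    by apply: rpred_sum => a _; have := dhomogM (L1 a) (F1 a); rewrite add1n.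
  rewrite raddf_sum /=; under eq_bigr do rewrite rmorphM.
  rewrite (@tangent_identity _ _ _ _ (fun a => XF a) _ (tofrac (L j)) (tofrac F)) ?XF_neq0 //; last first.
    under eq_bigr do rewrite -rmorphM; rewrite -raddf_sum (euler hF).
    by rewrite raddfMn.
  apply: vD; last first.
    rewrite -mulr_natl; apply: vM.
      have := @regC K 4 _ 1 (hX0 j) (hX1 j) (d.+1)%:R.
      by rewrite mpolyC_nat rmorph_nat.
    rewrite -rmorphM; apply: van_ideal; first exact: dhomogM (L1 j) hF.
    by apply/in_ideal2P; exists (L j), 0; rewrite mul0r addr0.
  have dh a : dehom j F^`M(a) = tofrac F^`M(a) / XF j ^+ d := dehom_homog j (F1 a).
  have ch := der_chain F (s_der j) (basicX K j).
  have sF : van Z 'X_j (s j 'X_j (dehom j F)).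
    apply: (der_van (s_der j) (basicX K j)).
    exists 1%N, d.+1, F; rewrite muln1; split=> //.
      by apply/in_ideal1P; exists 1; rewrite mul1r.
    exact: dehom_homog.
  rewrite -[X in van _ _ X]opprK; apply: vN.
  set u := (X in - X).
  have -> : - u = \sum_a tofrac F^`M(a) / XF j ^+ d *
      (Y j a - tofrac ('X_j * L a - 'X_a * L j) / XF j ^+ 2) +
      ((s j 'X_j (dehom j F) - \sum_a dehom j F^`M(a) * s j 'X_j (dehom j 'X_a))
       - s j 'X_j (dehom j F)).
    rewrite addrAC subrr add0r -sumrB /u -sumrN; apply: eq_bigr => a _.
    rewrite dh dehomX mulrBr addrAC subrr add0r.
    by rewrite rmorphB !rmorphM.
  apply: vD; last exact: (vB ch sF).
  apply: (@van_sum K 4 _ 1 (hX0 j) (hX1 j)) => a _.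
  by rewrite -dh; exact: (vM (dehom_reg _ (basicX K j)) (hL j a)).
apply: (der_coord_eq0 (s_der i)) => a.
rewrite -(subrK (tofrac ('X_i * L a - 'X_a * L i) / XF i ^+ 2) (Y i a)).
apply: vD; first exact: hL.
apply: van_ideal; first by apply: rpredB; exact: dhomogM (hX1 _) (L1 _).
have [/in_ideal1P[u eu] /in_ideal1P[w ew]] := (hc a, hc i).
apply/in_ideal2P; exists 0, ('X_i * u - 'X_a * w).
rewrite mul0r add0r mulrBl -!mulrA -eu -ew -!mul_mpolyC; ring.
Qed.

End Key.

(** * Global sections and the Kodaira-Spencer map *)

Section Moduli.
Variables (K : fieldType).
Local Notation S := {mpoly K[4]}.
Local Notation XF i := (tofrac ('X_i : S)).
Variables (F l : S) (k : 'I_4) (d : nat).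
Hypothesis hF : F \is d.+1.-homog.
Hypothesis d2 : (2 < d)%N.
Hypotheses (hl : l \is 1.-homog) (lk : l@_U_(k) != 0).
Hypothesis F_notin : forall w, F != w * l.
Local Notation Z := [:: F; l].
Hypothesis NS : forall L : 'I_4 -> S, (forall a, L a \is 1.-homog) ->
  in_ideal Z (\sum_a L a * F^`M(a)) ->
  exists c : K, forall a, in_ideal [:: l] (L a - c *: 'X_a).

(** Vanishing has to reach every D_+(h), not only the charts: the value on D_+(h) restricts to 0 on
    each D_+(h x_i), and saturation removes the powers of x_i from its numerator. *)
Lemma H0_tangent_restr : H0_tangent_restr_eq0 [:: F] Z.
Proof.
move=> D hD h a bh ha; rewrite /sec0 subr0.
have [h0 [e he] _] := bh.
have Dr : reg h (D h a) := der_reg hD bh ha.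
have sD i : der_section [:: F] Z 'X_i D by apply: der_local hD => g; apply: basic1.
have D0 : forall i, sec_eq Z 'X_i D (@sec0 K 4).
  apply: (@cover_section_eq0 K F l k d hF d2 hl lk F_notin (fun=> D) sD) => //.
  move=> i j g b bg hb; rewrite subrr; case: bg => g0 [e' he'] _.
  exact: (van_0 g0 he').
have /(frac0P h0 he)[m [p [hp _ Dp]]] := Dr.
have hX0 (i : 'I_4) : h * 'X_i != 0 by rewrite mulf_neq0 // mpolyX_neq0.
have hXd (i : 'I_4) : h * 'X_i \is (e.+1 + 1).-homog := dhomogM he (dhomogXU K i).
have hN i : exists N, in_ideal Z (p * h ^+ N * 'X_i ^+ N).
  have bhx : basic h (h * 'X_i).
    by split; [exact: hX0 | exists (e.+1); have := hXd i; rewrite addn1 | exists 'X_i].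
  have bxx : basic 'X_i (h * 'X_i).
    by split; [exact: hX0 | exists (e.+1); have := hXd i; rewrite addn1 | exists h; rewrite mulrC].
  have b1h : basic 1 (h * 'X_i) := basic1 bxx.
  have hax : reg (h * 'X_i) a := frac0_basic (fun _ _ _ => I) he bhx ha.
  have v1 : van Z (h * 'X_i) (D (h * 'X_i) a).
    by have := D0 i _ _ bxx hax; rewrite /sec0 subr0.
  have v2 := der_res hD bh bhx ha.
  have vv : van Z (h * 'X_i) (D h a).
    rewrite -[D h a](subKr (D (h * 'X_i) a)).
    exact: (vanB (hX0 i) (hXd i) v1 v2).
  have pX : p * 'X_i ^+ m \is (m * (e.+1 + 1)).-homog.
    by rewrite mulnDr muln1; exact: dhomogM hp (dhomogXUn K i m).
  have /(van_sat (hX0 i) (hXd i) _ pX)[N IN] : van Z (h * 'X_i)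
      (tofrac (p * 'X_i ^+ m) / tofrac (h * 'X_i) ^+ m).
    rewrite !rmorphM rmorphXn exprMn -mulf_div divff ?mulr1 -?Dp //.
    by rewrite expf_neq0 // XF_neq0.
  exists (N + m)%N; have := in_idealM (h ^+ m) IN.
  set u := (X in in_ideal _ X -> _); set v := (X in _ -> in_ideal _ X).
  by suff -> : u = v by []; rewrite /u /v exprMn !exprD; ring.
have [|N HN] := @uniform_bound _
    (fun i N => in_ideal Z (p * h ^+ N * 'X_i ^+ N)) _ hN.
  move=> i m' N' /subnK <- IN.
  have := in_idealM (h ^+ (N' - m') * 'X_i ^+ (N' - m')) IN.
  set u := (X in in_ideal _ X -> _); set v := (X in _ -> in_ideal _ X).
  by suff -> : u = v by []; rewrite /u /v !exprD; ring.
rewrite Dp; apply/(van_sat h0 he _ hp); exists N.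
exact: (in_ideal_sat hl lk F_notin HN).
Qed.

Lemma van_sub_ideal (Z1 Z2 : seq S) h a :
  (forall p, in_ideal Z1 p -> in_ideal Z2 p) -> van Z1 h a -> van Z2 h a.
Proof.
by move=> sub [e [m [p [he hp Ip ->]]]]; exists e, m, p; split=> //; apply: sub.
Qed.

Lemma surface_sub p : in_ideal [:: F] p -> in_ideal Z p.
Proof. by move/in_ideal1P => [w ->]; apply/in_ideal2P; exists w, 0; rewrite mul0r addr0. Qed.

Lemma der_tangent_sub f D : der_section Z Z f D -> der_section [:: F] Z f D.
Proof.
case=> h1 h2 h3 h4 h5 h6; split=> // h a bh va; apply: h5 => //.
exact: van_sub_ideal surface_sub va.
Qed.

Lemma vanB_basic f h a b : basic f h -> van Z h a -> van Z h b -> van Z h (a - b).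
Proof. by case=> h0 [e he] _; apply: (vanB h0 he). Qed.

Lemma vanD_basic f h a b : basic f h -> van Z h a -> van Z h b -> van Z h (a + b).
Proof. by case=> h0 [e he] _; apply: (vanD h0 he). Qed.

Lemma sub_add_identity (R : comNzRingType) (dab da db eab ea eb : R) :
  (dab - (da + db)) - (eab - (ea + eb)) = (dab - eab) - ((da - ea) + (db - eb)).
Proof. ring. Qed.

Lemma sub_mul_identity (R : comNzRingType) (a b dab da db eab ea eb : R) :
  (dab - (a * db + b * da)) - (eab - (a * eb + b * ea)) =
  (dab - eab) - (a * (db - eb) + b * (da - ea)).
Proof. ring. Qed.

Lemma sub_res_identity (R : comNzRingType) (dg dh eg eh : R) :
  (dg - dh) - (eg - eh) = (dg - eg) - (dh - eh).
Proof. ring. Qed.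

Lemma der_sub X f (D E : presection K 4) : der_section X Z f D -> der_section X Z f E ->
  der_section X Z f (sec_sub D E).
Proof.
case=> d1 d2' d3 d4 d5 d6 [e1 e2 e3 e4 e5 e6]; rewrite /sec_sub; split.
- move=> h a bh ha; case: (bh) => h0 [e he] _.
  exact: (regB h0 he (d1 _ _ bh ha) (e1 _ _ bh ha)).
- by move=> h c bh; apply: (vanB_basic bh); [apply: d2'|apply: e2].
- move=> h a b bh ha hb; rewrite -sub_add_identity.
  exact: (vanB_basic bh (d3 _ _ _ bh ha hb) (e3 _ _ _ bh ha hb)).
- move=> h a b bh ha hb; rewrite -sub_mul_identity.
  exact: (vanB_basic bh (d4 _ _ _ bh ha hb) (e4 _ _ _ bh ha hb)).
- by move=> h a bh ha; apply: (vanB_basic bh); [apply: d5|apply: e5].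
- move=> h g a bh bg ha; rewrite -sub_res_identity.
  exact: (vanB_basic bg (d6 _ _ _ bh bg ha) (e6 _ _ _ bh bg ha)).
Qed.

Lemma sub_glue_identity (R : comNzRingType) (ti tj ti' tj' ui uj : R) :
  (ti - ti' - ui) - (tj - tj' - uj) = 0 - ((tj - ti - (tj' - ti')) - (uj - ui)).
Proof. ring. Qed.

Lemma kodaira_spencer_inj : kodaira_spencer_injective [:: F] Z.
Proof.
move=> t t' [ht _] [ht' _] [u hu hcob] i.
have htt j := der_sub (ht j) (ht' j).
(* The coboundary [u] is exactly the correction which makes the lifts of the difference agree on
   overlaps. *)
pose s j := sec_sub (sec_sub (t j) (t' j)) (u j).
have hs j : der_section [:: F] Z 'X_j (s j) := der_sub (htt j) (der_tangent_sub (hu j)).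
have s0 : forall j, sec_eq Z 'X_j (s j) (@sec0 K 4).
  apply: (cover_section_eq0 hF d2 hl lk F_notin hs) => // a b h c bh hc.
  rewrite /s /sec_sub sub_glue_identity; case: (bh) => h0 [e he] _.
  apply: (vanB_basic bh (van_0 h0 he _)); exact: (hcob a b h c bh hc).
(* Compared with a section of T_S restricted to Z, a section of T_Z must moreover kill the ideal of
   Z; [u i] does, and the difference equals [u i] on Z. *)
have [h1 h2 h3 h4 _ h6] := htt i; split=> // h a bh va.
have ra : reg h a by case: (bh) => h0 [e he] _; exact: (van_reg h0 he va).
have e1 := s0 i h a bh ra; rewrite /sec0 subr0 in e1.
have e2 := der_van (hu i) bh va.
by have := vanD_basic bh e1 e2; rewrite /s {1}/sec_sub subrK.
Qed.

End Moduli.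

(** * Genericity by counting parameters *)

Lemma base_expansion_inj n B (a b : 'I_n -> nat) :
  (forall i, a i < B)%N -> (forall i, b i < B)%N ->
  (\sum_i a i * B ^ i = \sum_i b i * B ^ i)%N -> a =1 b.
Proof.
elim: n a b => [|n IH] a b ha hb; first by move=> _ [].
rewrite !big_ord_recl !expn0 !muln1 => e.
have B0 : (0 < B)%N by apply: leq_ltn_trans (ha ord0).
have sumE (c : 'I_n.+1 -> nat) : (\sum_(i < n) c (lift ord0 i) * B ^ lift ord0 i =
    (\sum_(i < n) c (lift ord0 i) * B ^ i) * B)%N.
  by rewrite big_distrl; apply: eq_bigr => i _; rewrite /= /bump add1n expnSr mulnA.
rewrite !sumE in e.
have e0 : a ord0 = b ord0.
  have := congr1 (fun x => x %% B)%N e.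
  by rewrite !(addnC (_ ord0)) !modnMDl !modn_small.
have e1 : (\sum_(i < n) a (lift ord0 i) * B ^ i = \sum_(i < n) b (lift ord0 i) * B ^ i)%N.
  by move/eqP: e; rewrite e0 eqn_add2l eqn_pmul2r // => /eqP.
move=> i; case: (unliftP ord0 i) => [j ->|-> //].
exact: (IH (fun i => a (lift ord0 i)) (fun i => b (lift ord0 i)) _ _ e1 j).
Qed.

Lemma poly_nonroot (K : numFieldType) (q : {poly K}) : q != 0 -> exists c, q.[c] != 0.
Proof.
move=> q0; pose rs : seq K := [seq i%:R | i <- iota 0 (size q)].
have [/allP h|/allPn[c _ hc]] := boolP (all (root q) rs); last by exists c.
have uniq_rs : uniq rs.
  by rewrite map_inj_uniq ?iota_uniq // => i j /eqP; rewrite eqr_nat => /eqP.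
by have := max_poly_roots q0 (introT allP h) uniq_rs; rewrite size_map size_iota ltnn.
Qed.

Section Dimension.
Variable K : numFieldType.

(** Kronecker substitution x_i = X^(B^i): [msize p] exceeds every exponent in p, so distinct
    monomials become distinct powers of X and the question reduces to one variable. *)
Lemma mpoly_nonroot n (p : {mpoly K[n]}) : p != 0 -> exists v, p.@[v] != 0.
Proof.
move=> p0; pose B := msize p.
pose kron : {mpoly K[n]} -> {poly K} := mmap (@polyC K) (fun i : 'I_n => 'X^(B ^ i)).
pose code (m : 'X_{1..n}) := (\sum_i m i * B ^ i)%N.
have ltB m i : m \in msupp p -> (m i < B)%N.
  move=> /msize_mdeg_lt; apply: leq_ltn_trans.
  by rewrite mdegE (bigD1 i) //= leq_addr.
have kronE : kron p = \sum_(m <- msupp p) p@_m *: 'X^(code m).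
  apply: eq_bigr => m _; rewrite mul_polyC /mmap1 /code; congr (_ *: _).
  rewrite -prodrXr; apply: eq_bigr => i _.
  by rewrite -exprM mulnC.
have kp0 : kron p != 0.
  have mp := mlead_supp p0; set m := mlead p in mp.
  apply: contraTneq mp => k0; rewrite mcoeff_msupp negbK.
  have := congr1 (fun q : {poly K} => q`_(code m)) k0.
  rewrite kronE coef_sum coef0 (bigD1_seq m) ?msupp_uniq //=; last exact: mlead_supp.
  rewrite big_seq_cond big1 => [|m' /andP[mp' ne]].
    by rewrite addr0 coefZ coefXn eqxx mulr1 => ->.
  rewrite coefZ coefXn; case: eqP => [e|_]; last by rewrite mulr0.
  case/eqP: ne; apply/esym/mnmP; apply: base_expansion_inj e => i; apply: ltB => //.
  exact: mlead_supp.
have [c hc] := poly_nonroot kp0; exists (fun i : 'I_n => c ^+ (B ^ i)).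
apply: contraNneq hc => <-; apply/eqP.
rewrite kronE horner_sum mevalE; apply: eq_bigr => m _.
rewrite hornerZ hornerXn /code -prodrXr; congr (_ * _); apply: eq_bigr => i _.
by rewrite -exprM mulnC.
Qed.

Definition deg_le n (p : {mpoly K[n]}) d := forall m, m \in msupp p -> (mdeg m <= d)%N.

Lemma deg_leM n (p q : {mpoly K[n]}) d e : deg_le p d -> deg_le q e -> deg_le (p * q) (d + e).
Proof.
move=> hp hq m /msuppM_le/allpairsP[[m1 m2] /= [h1 h2 ->]].
by rewrite mdegD leq_add ?hp ?hq.
Qed.

Lemma deg_le1 n d : deg_le (1 : {mpoly K[n]}) d.
Proof. by move=> m; rewrite msupp1 inE => /eqP ->; rewrite mdeg0. Qed.

Lemma deg_le_prod n N (P : 'I_N -> {mpoly K[n]}) (a : 'I_N -> nat) e :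
  (forall i, deg_le (P i) e) -> deg_le (\prod_i P i ^+ a i) (\sum_i a i * e)%N.
Proof.
move=> h; apply: (big_ind2 (fun p d => deg_le p d)) => [|p d q d' hp hq|i _].
- exact: deg_le1.
- exact: deg_leM.
- by elim: (a i) => [|k IH]; [apply: deg_le1 | rewrite exprS mulSn; apply: deg_leM].
Qed.

Lemma nonzero_kernel r c (M : 'M[K]_(r, c)) : (c < r)%N -> exists2 v : 'rV_r, v != 0 & v *m M = 0.
Proof.
move=> cr; have : kermx M != 0.
  by rewrite -mxrank_eq0 mxrank_ker subn_eq0 -ltnNge (leq_ltn_trans (rank_leq_col M)).
by case/rowV0Pn => v /sub_kermxP vM v0; exists v.
Qed.

(* Count the monomials with all exponents below D against the monomials which
   may occur after substitution. *)
Lemma algebraic_dependence m N (P : 'I_N -> {mpoly K[m]}) : (m < N)%N ->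
  exists2 G : {mpoly K[N]}, G != 0 & forall w, G.@[fun i => (P i).@[w]] = 0.
Proof.
move=> mN; pose e := (\max_i msize (P i))%N.
have Pe i : deg_le (P i) e.
  move=> mu /msize_mdeg_lt lt; apply: ltnW; apply: leq_trans lt _.
  exact: (leq_bigmax_cond _ (F := fun i => msize (P i))).
(* A product of N factors [P i ^+ a i] with a_i < D has degree at most D N e < D c = E. The choice D
   > c^m gives E^m = D^m c^m < D^(m + 1) <= D^N, so there are more products than monomials available
   to them. *)
pose c := (N * e).+1; pose D := (c ^ m).+1; pose E := (D * c)%N.
pose A := {ffun 'I_N -> 'I_D}; pose Bx := {ffun 'I_m -> 'I_E}.
have cardAB : (#|{: Bx}| < #|{: A}|)%N.
  rewrite !card_ffun !card_ord /E expnMn.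
  have [j ->] : exists j, N = (m + j.+1)%N by exists (N - m.+1)%N; rewrite addnS -addSn subnKC.
  rewrite expnD ltn_pmul2l ?expn_gt0 // expnS (leq_trans (ltnSn _)) //.
  by rewrite leq_pmulr // expn_gt0.
pose mon n k (a : {ffun 'I_n -> 'I_k}) : 'X_{1..n} := [multinom nat_of_ord (a i) | i < n].
pose pr (a : A) := \prod_i P i ^+ a i.
pose M := \matrix_(i < #|{: A}|, j < #|{: Bx}|) (pr (enum_val i))@_(mon _ _ (enum_val j)).
have [v v0 vM] := nonzero_kernel M cardAB.
pose G : {mpoly K[N]} := \sum_i v 0 i *: 'X_[mon _ _ (enum_val i)].
have mon_inj n k : injective (mon n k).
  move=> a b /mnmP h; apply/ffunP => i; apply: val_inj.
  by have := h i; rewrite !mnmE.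
have Gi i : G@_(mon _ _ (enum_val i)) = v 0 i.
  rewrite raddf_sum /= (bigD1 i) //= big1 => [|j ji]; rewrite mcoeffZ mcoeffX.
    by rewrite eqxx mulr1 addr0.
  case: eqP => [/mon_inj/enum_val_inj ej|_]; last by rewrite mulr0.
  by rewrite ej eqxx in ji.
exists G => [|w].
  apply: contraNneq v0 => G0; apply/eqP/rowP => i.
  by rewrite -Gi G0 mcoeff0 mxE.
have sum0 : \sum_i v 0 i *: pr (enum_val i) = 0.
  apply/mpolyP => mu; rewrite mcoeff0 raddf_sum /=.
  have [/forallP hmu|/forallPn[t ht]] := boolP [forall t, mu t < E]%N.
    pose b : Bx := [ffun t => Ordinal (hmu t)].
    have -> : mu = mon _ _ b by apply/mnmP => t; rewrite mnmE ffunE.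
    have /rowP/(_ (enum_rank b)) := vM; rewrite !mxE => vMb; rewrite -[RHS]vMb.
    by apply: eq_bigr => i _; rewrite !mxE enum_rankK mcoeffZ.
  rewrite big1 // => i _; rewrite mcoeffZ memN_msupp_eq0 ?mulr0 //.
  apply: contra ht => /(deg_le_prod (fun i => Pe i)) le.
  apply: leq_ltn_trans (_ : mu t <= mdeg mu)%N _; first by rewrite mdegE (bigD1 t) //= leq_addr.
  apply: leq_ltn_trans le _; rewrite /E /c mulnS.
  apply: leq_ltn_trans (_ : _ <= D * (N * e))%N _; last by rewrite -[ltnLHS]add0n ltn_add2r.
  have -> : (D * (N * e) = \sum_(j < N) D * e)%N by rewrite sum_nat_const card_ord mulnCA.
  apply: leq_sum => j _.
  by rewrite leq_mul2r ltnW ?orbT.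
have := congr1 (meval w) sum0; rewrite raddf0 raddf_sum /= => <-.
rewrite /G raddf_sum /=; apply: eq_bigr => i _.
rewrite !mevalZ mevalX /pr rmorph_prod /=; congr (_ * _); apply: eq_bigr => j _.
by rewrite rmorphXn mnmE.
Qed.

(** One relation for each of the finitely many families, multiplied together, gives a single H. It
    need not be homogeneous, so the open set is where some homogeneous component of H is nonzero;
    stability of Q under scaling compensates for this. *)
Lemma general_of_parametrized (V : vectType K) (Q : V -> Prop) (T : finType) m
    (Phi : T -> 'I_(\dim {:V}) -> {mpoly K[m]}) :
  (m < \dim {:V})%N ->
  (forall (c : K) v, v != 0 -> c != 0 -> Q (c *: v) -> Q v) ->
  (forall v, v != 0 -> ~ (exists t w, forall i, coord (vbasis {:V}) i v = (Phi t i).@[w]) -> Q v) ->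
  general Q.
Proof.
move=> mN Qcone QPhi; set N := \dim {:V} in Phi mN QPhi *.
have /fin_all_exists2[G G0 GPhi] t := algebraic_dependence (Phi t) mN.
have N0 : (0 < N)%N by apply: leq_ltn_trans mN.
(* The extra variable makes H vanish at the origin, so that a point where H is nonzero is a nonzero
   vector. *)
pose H : {mpoly K[N]} := 'X_(Ordinal N0) * \prod_t G t.
have H0 : H != 0.
  apply: mulf_neq0; first by rewrite -msize_poly_eq0 msizeX.
  by apply/prodf_neq0 => t _; apply: G0.
pose E G' := exists d, G' = pihomog mdeg d H.
pose cv (v : V) := fun i : 'I_N => coord (vbasis {:V}) i v.
exists (fun v => exists2 G', E G' & G'.@[cv v] != 0); split.
- exists E; split=> // G' [d ->]; exists d; exact: pihomogP.
- have [u hu] := mpoly_nonroot H0.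
  pose v : V := \sum_(i < N) u i *: (vbasis {:V})`_i.
  have cvE : cv v =1 u.
    by move=> i; rewrite /cv /v coord_sum_free // (basis_free (vbasisP _)).
  have hv : H.@[cv v] != 0 by rewrite (meval_eq _ cvE).
  exists v.
    apply: contraNneq hv => v0; rewrite rmorphM /= mevalXU /cv v0 linear0 mul0r //.
  move: hv; rewrite {1}(@pihomog_partitionE _ _ mdeg _ H (leqnn _)) raddf_sum /=.
  have [/forallP h|/forallPn[d hd]] :=
      boolP [forall d : 'I_(msize H), (pihomog mdeg d H).@[cv v] == 0].
    by rewrite big1 ?eqxx // => d _; apply/eqP/h.
  by move=> _; exists (pihomog mdeg d H) => //; exists d.
- move=> v v0 [_ [d ->] hd].
  (* along the line through v, the component of degree d is a coefficient of a
     polynomial which is not identically zero *)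
  pose q : {poly K} := \poly_(j < msize H) (pihomog mdeg j H).@[cv v].
  have dH : (d < msize H)%N.
    rewrite ltnNge; apply: contra hd => hHd.
    suff -> : pihomog mdeg d H = 0 by rewrite meval0.
    rewrite pihomogE big_seq_cond big1 // => mu /andP[mu1 /eqP mu2].
    by have := msize_mdeg_lt mu1; rewrite /= in mu2; rewrite mu2 ltnNge hHd.
  have q0 : 'X * q != 0.
    rewrite mulf_neq0 ?polyX_eq0 //; apply: contraNneq hd => q0.
    by have := congr1 (fun r : {poly K} => r`_d) q0; rewrite coef_poly dH coef0 => ->.
  have [c] := poly_nonroot q0; rewrite hornerM hornerX mulf_eq0 negb_or => /andP[c0 hc].
  have qE : q.[c] = H.@[cv (c *: v)].
    rewrite {1}(@pihomog_partitionE _ _ mdeg _ H (leqnn _)) raddf_sum /= horner_poly.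
    apply: eq_bigr => j _; rewrite -[RHS]/(meval _ _) !mevalE mulr_suml.
    apply: eq_big_seq => mu hmu; rewrite -mulrA; congr (_ * _).
    have -> : nat_of_ord j = (\sum_i mu i)%N.
      by rewrite -mdegE; apply/esym/(dhomog_mf (pihomogP mdeg j H)).
    rewrite mulrC -prodrXr -big_split /=; apply: eq_bigr => i _.
    by rewrite /cv linearZ exprMn.
  apply: (Qcone c) => //; apply: QPhi; first by rewrite scaler_eq0 negb_or c0.
  case=> t [w hw]; case/eqP: hc; rewrite qE /H rmorphM rmorph_prod /= (bigD1 t) //=.
  by rewrite (meval_eq (G t) hw) GPhi mul0r mulr0.
Qed.

End Dimension.

(** * Linear vector fields *)

Section LinearVectorFields.
Variables (R : comNzRingType) (n : nat).
Implicit Types (p q : {mpoly R[n]}) (v w z : 'rV[R]_n) (N : 'M[R]_n).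

Definition linear_form (w : 'rV[R]_n) : {mpoly R[n]} := \sum_j w 0 j *: 'X_j.

(** Convention: N sends the linear form with coefficient row w to the one with row [w *m N], and its
    vector at a point v is [v *m N^T]. *)
Definition vfield N p : {mpoly R[n]} := \sum_i linear_form (row i N) * p^`M(i).

Definition dderiv w p : {mpoly R[n]} := \sum_i w 0 i *: p^`M(i).

Definition at_pt v p : R := p.@[fun i => v 0 i].

HB.instance Definition _ v := GRing.RMorphism.copy (at_pt v) (meval (fun i => v 0 i)).

Lemma vfield_is_linear N : linear (vfield N).
Proof.
move=> c p q; rewrite /vfield scaler_sumr -big_split /=; apply: eq_bigr => i _.
by rewrite linearP mulrDr scalerAr.
Qed.

HB.instance Definition _ N :=
  GRing.isLinear.Build R {mpoly R[n]} {mpoly R[n]} _ (vfield N) (vfield_is_linear N).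

Lemma vfieldZ N c p : vfield N (c *: p) = c *: vfield N p.
Proof. by rewrite -[c *: p]addr0 vfield_is_linear raddf0 addr0. Qed.

Lemma vfieldM N p q : vfield N (p * q) = vfield N p * q + p * vfield N q.
Proof.
rewrite /vfield mulr_suml mulr_sumr -big_split /=; apply: eq_bigr => i _.
by rewrite mderivM; ring.
Qed.

Lemma vfieldX N i : vfield N 'X_i = linear_form (row i N).
Proof.
rewrite /vfield (bigD1 i) //= big1 => [|j ji].
  by rewrite mderivXU eqxx mulr1 addr0.
by rewrite mderivXU (negPf ji) mulr0.
Qed.

Lemma vfieldC N c : vfield N c%:MP = 0.
Proof. by rewrite /vfield big1 // => i _; rewrite mderivC mulr0. Qed.

Lemma dderiv_is_linear w : linear (dderiv w).
Proof.
move=> c p q; rewrite /dderiv scaler_sumr -big_split /=; apply: eq_bigr => i _.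
by rewrite linearP scalerDr !scalerA mulrC.
Qed.

HB.instance Definition _ w :=
  GRing.isLinear.Build R {mpoly R[n]} {mpoly R[n]} _ (dderiv w) (dderiv_is_linear w).

Lemma dderivDv w w' p : dderiv (w + w') p = dderiv w p + dderiv w' p.
Proof. by rewrite /dderiv -big_split /=; apply: eq_bigr => i _; rewrite mxE scalerDl. Qed.

Lemma dderivZv c w p : dderiv (c *: w) p = c *: dderiv w p.
Proof. by rewrite /dderiv scaler_sumr; apply: eq_bigr => i _; rewrite mxE scalerA. Qed.

Lemma mderiv_ord_sum i (G : 'I_n -> {mpoly R[n]}) :
  (\sum_j G j)^`M(i) = \sum_j (G j)^`M(i).
Proof. exact: raddf_sum. Qed.

Lemma dderivC w z p : dderiv w (dderiv z p) = dderiv z (dderiv w p).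
Proof.
rewrite /dderiv; under eq_bigr => i _ do rewrite mderiv_ord_sum scaler_sumr.
rewrite exchange_big /=; apply: eq_bigr => i _.
rewrite [in RHS]mderiv_ord_sum [in RHS]scaler_sumr; apply: eq_bigr => j _.
by rewrite !mderivZ !scalerA mderiv_comm mulrC.
Qed.

Lemma mderiv_linear_form w i : (linear_form w)^`M(i) = (w 0 i)%:MP.
Proof.
rewrite /linear_form mderiv_ord_sum (bigD1 i) //= big1 => [|j ji].
  by rewrite mderivZ mderivXU eqxx addr0 alg_mpolyC.
by rewrite mderivZ mderivXU eq_sym (negPf ji) scaler0.
Qed.

Lemma at_pt_linear_form v w : at_pt v (linear_form w) = (v *m w^T) 0 0.
Proof.
rewrite /at_pt /linear_form raddf_sum /= mxE; apply: eq_bigr => j _.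
by rewrite mevalZ mevalXU mxE mulrC.
Qed.

Lemma dderiv_vfield w N p :
  dderiv w (vfield N p) = vfield N (dderiv w p) + dderiv (w *m N^T) p.
Proof.
have -> : vfield N (dderiv w p) = \sum_i w 0 i *: vfield N p^`M(i).
  by rewrite {1}/dderiv (raddf_sum (vfield N)); apply: eq_bigr => i _; apply: vfieldZ.
rewrite /dderiv -big_split /= /vfield.
under eq_bigr => i _.
  rewrite mderiv_ord_sum scaler_sumr.
  under eq_bigr => j _ do rewrite mderivM mderiv_linear_form mderiv_comm mxE
    mul_mpolyC scalerDr scalerA addrC.
  rewrite big_split /= -scaler_sumr; over.
rewrite !big_split /=; congr (_ + _).
rewrite exchange_big /=; apply: eq_bigr => j _; rewrite mxE scaler_suml.
by apply: eq_bigr => i _; rewrite !mxE.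
Qed.

Lemma at_pt_vfield v N p : at_pt v (vfield N p) = at_pt v (dderiv (v *m N^T) p).
Proof.
rewrite /vfield /dderiv !raddf_sum /=; apply: eq_bigr => i _.
rewrite rmorphM /= at_pt_linear_form /at_pt mevalZ; congr (_ * _).
by rewrite !mxE; apply: eq_bigr => j _; rewrite !mxE.
Qed.

Lemma at_pt_euler v p d : p \is d.-homog -> at_pt v (dderiv v p) = at_pt v p *+ d.
Proof.
move=> hp; rewrite -raddfMn -(euler hp) /dderiv !raddf_sum /=.
by apply: eq_bigr => i _; rewrite /at_pt mevalZ rmorphM /= mevalXU.
Qed.

Lemma dderiv_homog w p d : p \is d.+1.-homog -> dderiv w p \is d.-homog.
Proof. by move=> hp; apply: rpred_sum => i _; apply/rpredZ/mderiv_homog. Qed.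

End LinearVectorFields.

(** * Linear fields killing a smooth plane quartic *)

Section SmoothKilling.
Variable K : numClosedFieldType.

Lemma numK_neq0 (k : nat) : (k.+1%:R : K) != 0.
Proof. by rewrite pnatr_eq0. Qed.

Lemma mulrSn_eq0 (x : K) k : x *+ k.+1 = 0 -> x = 0.
Proof. by move/eqP; rewrite -mulr_natr mulf_eq0 (negPf (numK_neq0 k)) orbF => /eqP. Qed.

Variables (f : {mpoly K[3]}) (N : 'M[K]_3).
Hypothesis hf : f \is 4.-homog.
Hypothesis Nf : vfield N f = 0.
Hypothesis smooth : forall v : 'rV[K]_3, v != 0 -> exists w, at_pt v (dderiv w f) != 0.
Let A := N^T.

Lemma eigenvalue_step a : eigenvalue A a -> eigenvalue A (- (a *+ 3)).
Proof.
case/eigenvalueP => v vA v0; have [w0 hw0] := smooth v0.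
pose g : 'cV[K]_3 := \col_i at_pt v f^`M(i).
have gE w : at_pt v (dderiv w f) = (w *m g) 0 0.
  rewrite /dderiv raddf_sum /= !mxE; apply: eq_bigr => i _.
  by rewrite /at_pt mevalZ mxE.
have g0 : g != 0 by apply: contraNneq hw0 => g0; rewrite gE g0 mulmx0 mxE.
have Ag (w : 'rV[K]_3) : w *m (A + (a *+ 3)%:M) *m g = 0.
  apply/matrixP => i j; rewrite !ord1 [RHS]mxE mulmxDr -gE mul_mx_scalar.
  have := congr1 (at_pt v) (congr1 (dderiv w) Nf).
  rewrite raddf0 raddf0 dderiv_vfield raddfD /= at_pt_vfield vA dderivZv.
  rewrite [at_pt v (_ *: _)]mevalZ -/(at_pt v _) (at_pt_euler v (dderiv_homog w hf)).
  rewrite dderivDv dderivZv raddfD /= [at_pt v (_ *: _)]mevalZ -/(at_pt v _) => <-.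
  by rewrite [RHS]addrC mulrnAl mulrnAr.
have : (A + (a *+ 3)%:M) \notin unitmx.
  apply: contraNN g0 => Bu; apply/eqP/matrixP => i j.
  have := Ag (delta_mx 0 i *m invmx (A + (a *+ 3)%:M)).
  rewrite mulmxKV // => /matrixP/(_ 0 j); rewrite !mxE => <-.
  rewrite (bigD1 i) //= big1 => [|k ki]; rewrite !mxE ?eqxx /= ?mul1r ?addr0 //.
  by rewrite (negPf ki) mul0r.
by rewrite unitmxE unitfE negbK /eigenvalue /eigenspace kermx_eq0 row_free_unit
   unitmxE unitfE negbK raddfN opprK.
Qed.

(** A nonzero a would produce the four distinct eigenvalues (-3)^k a, k < 4, of a 3 by 3 matrix. *)
Lemma eigenvalue_eq0 a : eigenvalue A a -> a = 0.
Proof.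
move=> ha; apply/eqP; apply/contraT => a0.
pose rs := [seq (- 3%:R) ^+ k * a | k <- iota 0 4].
have hrs k : eigenvalue A ((- 3%:R) ^+ k * a).
  elim: k => [|k IH]; first by rewrite expr0 mul1r.
  by rewrite exprS -mulrA mulNr mulr_natl; apply: eigenvalue_step.
have rs_root : all (root (char_poly A)) rs.
  by apply/allP => x /mapP[k _ ->]; rewrite -eigenvalue_root_char.
have rs_uniq : uniq rs.
  rewrite map_inj_uniq ?iota_uniq // => i j /(mulIf a0) /(congr1 Num.norm).
  rewrite !normrX normrN normr_nat -!natrX => /eqP; rewrite eqr_nat eqn_exp2l //.
  by move/eqP.
have := max_poly_roots (monic_neq0 (char_poly_monic A)) rs_root rs_uniq.
by rewrite size_char_poly size_map size_iota ltnn.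
Qed.

Lemma nilpotent3 : A ^+ 3 = 0.
Proof.
have [r rE] := closed_field_poly_normal (char_poly A).
have r0 : all (pred1 0) r.
  apply/allP => x xr; apply/eqP/eigenvalue_eq0.
  by rewrite eigenvalue_root_char rE rootZ ?root_prod_XsubC // (monicP (char_poly_monic A)) oner_neq0.
have sr : size r = 3%N.
  have := size_char_poly A; rewrite rE (monicP (char_poly_monic A)) scale1r.
  by rewrite size_prod_XsubC => -[].
have E : char_poly A = 'X^3.
  rewrite rE (monicP (char_poly_monic A)) scale1r -{1}sr.
  elim: r r0 {rE sr} => [|x r IH] /=; first by rewrite big_nil.
  by case/andP => /eqP -> /IH; rewrite big_cons exprS subr0 => ->.
by have := Cayley_Hamilton A; rewrite E rmorphXn /= horner_mx_X.
Qed.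

Lemma first_order v w : v *m A = 0 -> at_pt v (dderiv (w *m A) f) = 0.
Proof.
move=> vA; have := congr1 (at_pt v) (congr1 (dderiv w) Nf).
rewrite !raddf0 dderiv_vfield raddfD /= at_pt_vfield vA => <-.
by rewrite -[X in dderiv X (dderiv w f)](scale0r 0) dderivZv scale0r raddf0 add0r.
Qed.

Lemma vfield_at0 v p : v *m A = 0 -> at_pt v (vfield N p) = 0.
Proof.
by move=> vA; rewrite at_pt_vfield vA -(scale0r 0) dderivZv scale0r raddf0.
Qed.

Lemma second_order v w z : v *m A = 0 ->
  at_pt v (dderiv (z *m A) (dderiv w f)) + at_pt v (dderiv z (dderiv (w *m A) f)) = 0.
Proof.
move=> vA; have := congr1 (at_pt v) (congr1 (dderiv z) (congr1 (dderiv w) Nf)).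
rewrite !raddf0 dderiv_vfield raddfD /= dderiv_vfield !raddfD /= vfield_at0 // add0r.
by move=> ->.
Qed.

Lemma third_order v w : v *m A = 0 ->
  at_pt v (dderiv (w *m A) (dderiv w (dderiv w f))) = 0.
Proof.
move=> vA; have := congr1 (fun p => at_pt v (dderiv w (dderiv w (dderiv w p)))) Nf.
rewrite /= !raddf0 dderiv_vfield !raddfD /= dderiv_vfield !raddfD /= dderiv_vfield !raddfD /=.
rewrite vfield_at0 // add0r !(dderivC _ (w *m A)) => e; apply: (@mulrSn_eq0 _ 2).
by rewrite -e; ring.
Qed.

Lemma singular_at v : v != 0 -> (forall w, at_pt v (dderiv w f) = 0) -> False.
Proof. by move=> v0 h; have [w] := smooth v0; rewrite h eqxx. Qed.

Lemma nonzero_row_image (B : 'M[K]_3) : B != 0 -> exists w : 'rV_3, w *m B != 0.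
Proof. by case/rowV0Pn => v /submxP[w ->] h; exists w. Qed.

(* If v is an eigenvector of A for a, then differentiating Nf = 0 along w and
   evaluating at v shows that the differential of f at v kills the image of
   A + 3a; hence -3a is an eigenvalue too, and A is nilpotent.  A vector in the
   last nonzero image of A is then a singular point. *)
Theorem smooth_vfield_eq0 : N = 0.
Proof.
suff A0 : A = 0 by rewrite -[N]trmxK -/A A0 trmx0.
have A3 : A *m A *m A = 0 by rewrite -mulmxA; have := nilpotent3; rewrite !exprS expr0 mulr1.
have hom w := dderiv_homog w hf.
have [A2|A2] := eqVneq (A *m A) 0; last first.
  have [e2 e0_neq0] := nonzero_row_image A2; rewrite mulmxA in e0_neq0.
  pose e1 := e2 *m A; pose e0 := e1 *m A; rewrite -/e1 -/e0 in e0_neq0.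
  have e0A : e0 *m A = 0 by have := congr1 (mulmx e2) A3; rewrite /= mulmx0 !mulmxA.
  have d0 : at_pt e0 (dderiv e0 f) = 0 := first_order e1 e0A.
  have d1 : at_pt e0 (dderiv e1 f) = 0 := first_order e2 e0A.
  (* e2 is not in the image of A, so first order does not reach it. By Euler its derivative at e0
     is, up to the factor 3, the second derivative along e0 and e2; the second-order relation trades
     this for the one along e1 twice, which the third-order relation kills. *)
  have d2 : at_pt e0 (dderiv e2 f) = 0.
    have t : at_pt e0 (dderiv e1 (dderiv e1 f)) = 0.
      have := third_order e1 e0A; rewrite -/e0 (at_pt_euler _ (dderiv_homog e1 (hom e1))).
      exact: mulrSn_eq0.
    have := second_order e1 e2 e0A; rewrite -/e1 -/e0 t add0r dderivC.
    by rewrite (at_pt_euler _ (hom e2)); apply: mulrSn_eq0.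
  case: (singular_at e0_neq0) => w.
  pose P := col_mx e0 (col_mx e1 e2).
  have Pfree : row_free P.
    rewrite -kermx_eq0; apply/contraT => /rowV0Pn[u /sub_kermxP uP]; case/eqP.
    move: uP; rewrite -[u]hsubmxK -[rsubmx u]hsubmxK !mul_row_col.
    set a := lsubmx u; set b := lsubmx _; set c := rsubmx _; move=> uP.
    have scal (x : 'M[K]_1) (e : 'rV[K]_3) : x *m e = x 0 0 *: e.
      by rewrite {1}[x]mx11_scalar mul_scalar_mx.
    rewrite !scal in uP.
    have c0 : c 0 0 = 0.
      have := congr1 (mulmx^~ (A *m A)) uP.
      rewrite /= !mulmxDl -!scalemxAl !mulmxA e0A mul0mx -/e1 -/e0 mul0mx.
      by rewrite !scaler0 !add0r => /eqP; rewrite scaler_eq0 (negPf e0_neq0) orbF => /eqP.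
    rewrite c0 scale0r addr0 in uP.
    have b0 : b 0 0 = 0.
      have := congr1 (mulmx^~ A) uP.
      rewrite /= !mulmxDl -!scalemxAl e0A -/e0 mul0mx scaler0 add0r => /eqP.
      by rewrite scaler_eq0 (negPf e0_neq0) orbF => /eqP.
    rewrite b0 scale0r addr0 in uP.
    have a0 : a 0 0 = 0.
      by move/eqP: uP; rewrite scaler_eq0 (negPf e0_neq0) orbF => /eqP.
    have z (x : 'M[K]_1) : x 0 0 = 0 -> x = 0.
      by move=> h; rewrite [x]mx11_scalar h raddf0.
    by rewrite (z _ a0) (z _ b0) (z _ c0) !row_mx0.
  have /submxP[u ->] : (w <= P)%MS by rewrite submx_full // row_full_unit -row_free_unit.
  rewrite -[u]hsubmxK -[rsubmx u]hsubmxK !mul_row_col.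
  have scal (x : 'M[K]_1) (e : 'rV[K]_3) : x *m e = x 0 0 *: e.
    by rewrite {1}[x]mx11_scalar mul_scalar_mx.
  rewrite !scal !dderivDv !dderivZv !raddfD /= /at_pt !mevalZ -!/(at_pt _ _).
  by rewrite d0 d1 d2 !mulr0 !addr0.
apply/eqP/contraT => A0; have [e2 e0_neq0] := nonzero_row_image A0.
pose e0 := e2 *m A; rewrite -/e0 in e0_neq0.
have e0A : e0 *m A = 0 by rewrite /e0 -mulmxA A2 mulmx0.
have rA : (\rank A <= 1)%N.
  by rewrite leqNgt; apply/negP => h; have := leq_trans (leq_add h h) (mulmx0_rank_max A2).
have colin w : exists c, w *m A = c *: e0.
  have /sub_rVP[c ->] : (w *m A <= e0)%MS; last by exists c.
  have e0A' : (e0 <= A)%MS by apply: submxMl.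
  apply: submx_trans (submxMl w A) _.
  by rewrite -(geq_leqif (mxrank_leqif_sup e0A')) rank_rV e0_neq0.
case: (singular_at e0_neq0) => w.
(* Euler turns the derivative along e0 = e2 A into the factor 3. For z = e2 both terms are equal up
   to this factor; for other z the second is a multiple of the derivative along e2, because A has
   rank one. *)
have main z : at_pt e0 (dderiv z f) *+ 3 + at_pt e0 (dderiv e2 (dderiv (z *m A) f)) = 0.
  by have := second_order z e2 e0A; rewrite -/e0 (at_pt_euler _ (hom z)).
have d2 : at_pt e0 (dderiv e2 f) = 0.
  have := main e2; rewrite -/e0 dderivC (at_pt_euler _ (hom e2)) -mulrnDr.
  exact: mulrSn_eq0.
have [c wA] := colin w; have := main w.
rewrite wA dderivC dderivZv /at_pt mevalZ -!/(at_pt _ _) (at_pt_euler _ (hom e2)) d2.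
by rewrite mul0rn mulr0 addr0; apply: mulrSn_eq0.
Qed.

End SmoothKilling.

Lemma complete_basis (K : fieldType) m n (V : 'M[K]_(m, n)) : row_free V ->
  exists2 Y : 'M_n, Y \in unitmx &
    forall (i : 'I_m) (j : 'I_n), i = j :> nat -> row j Y = row i V.
Proof.
move=> Vfree; have le_mn : (m <= n)%N.
  by rewrite -(eqP Vfree : \rank V = m)%N rank_leq_col.
pose U : 'M[K]_(m, n) := pid_mx m; pose f : 'M[K]_n := pid_mx m *m V.
have Uf : U *m f = V.
  by rewrite /U /f mulmxA mul_pid_mx !minnn (minn_idPr le_mn) pid_mx_1 mul1mx.
have [|Y Yu YU] := @complete_unitmx _ _ _ U f.
  by rewrite Uf (eqP Vfree) rank_pid_mx.
exists Y => // i j ij; rewrite -Uf YU row_mul; apply/rowP => t.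
rewrite !mxE (bigD1 j) //= big1 => [|k kj]; rewrite !mxE.
  by rewrite ij eqxx -ij ltn_ord mul1r addr0.
by rewrite ij eq_sym (inj_eq val_inj) (negPf kj) mul0r.
Qed.

Lemma comp_mpoly_homog (R : comNzRingType) n k (t : n.-tuple {mpoly R[k]}) p d :
  (forall i, tnth t i \is 1.-homog) -> p \is d.-homog -> p \mPo t \is d.-homog.
Proof.
move=> ht hp; rewrite (mpolyE p) (raddf_sum (comp_mpoly t)) big_seq.
apply: rpred_sum => m mp; rewrite /= comp_mpolyZ; apply: rpredZ.
have -> : d = (\sum_i m i)%N by rewrite -mdegE; exact/esym/(dhomog_mf hp mp).
rewrite comp_mpolyX.
apply: (big_ind2 (fun q e => q \is e.-homog)) => [|q e q' e' hq hq'|i _].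
- exact: dhomog1.
- exact: dhomogM.
- by have := dhomogMn (m i) (ht i); rewrite mul1n.
Qed.

(** * Linear changes of coordinates and restriction to a hyperplane *)

Section LinearSubstitution.
Variables (R : comNzRingType) (n : nat).
Implicit Types (W Z M : 'M[R]_n) (p q : {mpoly R[n]}).

Definition subst W p : {mpoly R[n]} :=
  p \mPo [tuple linear_form (row i W) | i < n].

HB.instance Definition _ W :=
  GRing.RMorphism.copy (subst W) (comp_mpoly [tuple linear_form (row i W) | i < n]).

Lemma substX W i : subst W 'X_i = linear_form (row i W).
Proof. by rewrite /subst comp_mpolyXU -tnth_nth tnth_mktuple. Qed.

Lemma substC W c : subst W c%:MP = c%:MP.
Proof. exact: comp_mpolyC. Qed.

Lemma substZ W c p : subst W (c *: p) = c *: subst W p.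
Proof. exact: comp_mpolyZ. Qed.

Lemma subst_linear_form W w : subst W (linear_form w) = linear_form (w *m W).
Proof.
rewrite {1}/linear_form (raddf_sum (subst W)) /=.
under eq_bigr => i _ do rewrite substZ substX /linear_form scaler_sumr.
rewrite exchange_big /=; apply: eq_bigr => j _.
rewrite mxE scaler_suml; apply: eq_bigr => i _.
by rewrite scalerA mxE.
Qed.

Lemma subst_subst W Z p : subst W (subst Z p) = subst (Z *m W) p.
Proof.
elim/mpoly_ring_ind: p => [c|i|p q hp hq|p q hp hq].
- by rewrite !substC.
- by rewrite !substX subst_linear_form row_mul.
- by rewrite !rmorphD /= hp hq.
- by rewrite !rmorphM /= hp hq.
Qed.

Lemma subst1 p : subst 1%:M p = p.
Proof.
elim/mpoly_ring_ind: p => [c|i|p q hp hq|p q hp hq].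
- by rewrite substC.
- rewrite substX /linear_form (bigD1 i) //= big1 => [|j ji].
    by rewrite !mxE eqxx scale1r addr0.
  by rewrite !mxE eq_sym (negPf ji) scale0r.
- by rewrite rmorphD /= hp hq.
- by rewrite rmorphM /= hp hq.
Qed.

Lemma subst_vfield W M M' p : M *m W = W *m M' ->
  subst W (vfield M p) = vfield M' (subst W p).
Proof.
move=> e; elim/mpoly_ring_ind: p => [c|i|p q hp hq|p q hp hq].
- by rewrite substC !vfieldC rmorph0.
- rewrite vfieldX substX subst_linear_form {2}/linear_form (raddf_sum (vfield M')) /=.
  under [RHS]eq_bigr => j _ do rewrite vfieldZ vfieldX.
  have -> : \sum_j row i W 0 j *: linear_form (row j M') = linear_form (row i W *m M').
    rewrite -subst_linear_form {2}/linear_form (raddf_sum (subst M')) /=.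
    by apply: eq_bigr => j _; rewrite substZ substX.
  by rewrite -!row_mul e.
- by rewrite !raddfD /= hp hq.
- by rewrite !(vfieldM, rmorphM, rmorphD) /= hp hq.
Qed.

Lemma linear_form_homog (w : 'rV[R]_n) : linear_form w \is 1.-homog.
Proof. by apply: rpred_sum => j _; apply: rpredZ; rewrite dhomogX /= mdeg1. Qed.

Lemma subst_homog W p d : p \is d.-homog -> subst W p \is d.-homog.
Proof.
by apply: comp_mpoly_homog => i; rewrite tnth_mktuple linear_form_homog.
Qed.

Lemma at_pt_subst W p v : at_pt v (subst W p) = at_pt (v *m W^T) p.
Proof.
rewrite /at_pt /subst comp_mpoly_meval; apply: meval_eq => i.
rewrite tnth_mktuple -/(at_pt v _) at_pt_linear_form !mxE.
by apply: eq_bigr => j _; rewrite !mxE.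
Qed.

Lemma mderiv_subst W p i :
  (subst W p)^`M(i) = \sum_a W a i *: subst W p^`M(a).
Proof.
elim/mpoly_ring_ind: p => [c|b|p q hp hq|p q hp hq].
- by rewrite substC mderivC big1 // => a _; rewrite mderivC rmorph0 scaler0.
- rewrite substX mderiv_linear_form (bigD1 b) //= big1 => [|a ab].
    by rewrite mderivXU eqxx rmorph1 alg_mpolyC mxE addr0.
  by rewrite mderivXU (negPf ab) rmorph0 scaler0.
- rewrite rmorphD mderivD hp hq -big_split; apply: eq_bigr => a _ /=.
  by rewrite mderivD rmorphD scalerDr.
- rewrite rmorphM mderivM hp hq mulr_suml mulr_sumr -big_split; apply: eq_bigr => a _ /=.
  by rewrite mderivM rmorphD !rmorphM scalerDr -!scalerAl -!scalerAr.
Qed.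

End LinearSubstitution.

Section HyperplaneRestriction.
Variable R : comNzRingType.

Variable n : nat.

Definition coord_of_hyperplane (i : 'I_n.+1) : {mpoly R[n]} :=
  if unlift 0 i is Some j then 'X_j else 0.

Definition restr (p : {mpoly R[n.+1]}) : {mpoly R[n]} :=
  p \mPo [tuple coord_of_hyperplane i | i < n.+1].

HB.instance Definition _ := GRing.RMorphism.copy restr
  (comp_mpoly [tuple coord_of_hyperplane i | i < n.+1]).

Implicit Types p : {mpoly R[n.+1]}.

Lemma restrC c : restr (c%:MP : {mpoly R[n.+1]}) = c%:MP.
Proof. exact: comp_mpolyC. Qed.

Lemma restrZ c p : restr (c *: p) = c *: restr p.
Proof. exact: comp_mpolyZ. Qed.

Lemma restr_X0 : restr ('X_0 : {mpoly R[n.+1]}) = 0.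
Proof. by rewrite /restr comp_mpolyXU -tnth_nth tnth_mktuple /coord_of_hyperplane unlift_none. Qed.

Lemma restr_Xlift i : restr ('X_(lift 0 i) : {mpoly R[n.+1]}) = 'X_i.
Proof. by rewrite /restr comp_mpolyXU -tnth_nth tnth_mktuple /coord_of_hyperplane liftK. Qed.

Lemma restr_homog p d : p \is d.-homog -> restr p \is d.-homog.
Proof.
apply: comp_mpoly_homog => i; rewrite tnth_mktuple /coord_of_hyperplane.
by case: (unlift 0 i) => [j|]; rewrite ?rpred0 // dhomogX /= mdeg1.
Qed.

Lemma restr_linear_form (w : 'rV[R]_n.+1) :
  restr (linear_form w) = linear_form (\row_j w 0 (lift 0 j)).
Proof.
rewrite {1}/linear_form (raddf_sum (restr)) big_ord_recl /= restrZ restr_X0 scaler0 add0r.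
by apply: eq_bigr => i _; rewrite restrZ restr_Xlift mxE.
Qed.

Lemma mderiv_restr p i : (restr p)^`M(i) = restr p^`M(lift 0 i).
Proof.
elim/mpoly_ring_ind: p => [c|a|p q hp hq|p q hp hq].
- by rewrite restrC !mderivC rmorph0.
- rewrite mderivXU; case: (unliftP 0 a) => [j ->|->].
    by rewrite restr_Xlift mderivXU (inj_eq (@lift_inj _ 0)) rmorph_nat.
  by rewrite restr_X0 mderiv0 rmorph0.
- by rewrite rmorphD !mderivD rmorphD hp hq.
- by rewrite rmorphM !mderivM rmorphD !rmorphM hp hq.
Qed.

Lemma restr_vfield (M : 'M[R]_n.+1) p : (forall j, M 0 (lift 0 j) = 0) ->
  restr (vfield M p) = vfield (\matrix_(i, j) M (lift 0 i) (lift 0 j)) (restr p).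
Proof.
move=> M0; rewrite /vfield (raddf_sum (restr)) big_ord_recl /= rmorphM /= restr_linear_form.
have -> : \row_j row 0 M 0 (lift 0 j) = 0 by apply/rowP => j; rewrite !mxE M0.
rewrite {1}/linear_form big1 ?mul0r ?add0r => [|j _]; last by rewrite mxE scale0r.
apply: eq_bigr => i _; rewrite rmorphM /= restr_linear_form mderiv_restr.
by congr (linear_form _ * _); apply/rowP => j; rewrite !mxE.
Qed.

Lemma at_pt_restr p (v : 'rV[R]_n) :
  at_pt v (restr p) = at_pt (\row_i if unlift 0 i is Some j then v 0 j else 0) p.
Proof.
rewrite /at_pt /restr comp_mpoly_meval; apply: meval_eq => i.
rewrite tnth_mktuple mxE /coord_of_hyperplane; case: (unlift 0 i) => [j|]; first by rewrite mevalXU.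
by rewrite meval0.
Qed.

End HyperplaneRestriction.

Lemma dderiv_subst (R : comNzRingType) n (W : 'M[R]_n) z p :
  dderiv z (subst W p) = \sum_a (z *m W^T) 0 a *: subst W p^`M(a).
Proof.
rewrite /dderiv; under eq_bigr => i _ do rewrite mderiv_subst scaler_sumr.
rewrite exchange_big /=; apply: eq_bigr => a _.
rewrite mxE scaler_suml; apply: eq_bigr => i _.
by rewrite scalerA !mxE.
Qed.

Lemma col0_matrixE (R : comNzRingType) n (M : 'M[R]_n.+1) :
  (forall i j, M i (lift 0 j) = 0) -> M = col 0 M *m delta_mx 0 0.
Proof.
move=> M0; apply/matrixP => i j; rewrite !mxE big_ord1 !mxE.
by case: (unliftP 0 j) => [j' ->|->]; rewrite ?M0 ?mulr0 ?mulr1.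
Qed.

(** * Linear fields preserving the plane of a smooth section *)

Section SmoothSections.
Variable K : numClosedFieldType.
Local Notation S := {mpoly K[4]}.
Variables (F : S) (c : 'rV[K]_4).
Hypothesis hF : F \is 4.-homog.
Hypothesis c0 : c != 0.
Local Notation l := (linear_form c).
Hypothesis smoothZ : smooth_complete_intersection [:: F; l].

(** Euler's formula gives F(v) = 0, so v lies on Z, while the Jacobian matrix is a column times the
    row c and has rank at most 1. *)
Lemma smooth_not_proportional (v : 'rV[K]_4) kappa : v != 0 -> (v *m c^T) 0 0 = 0 ->
  (forall z, at_pt v (dderiv z F) = kappa * (z *m c^T) 0 0) -> False.
Proof.
move=> v0 lv h.
have Fv : at_pt v F = 0.
  by apply: (@mulrSn_eq0 _ _ 3); rewrite -(at_pt_euler v hF) h lv mulr0.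
have nz : exists i, v 0 i != 0 by have /rV0Pn[j vj] := v0; exists j.
have vanZ (i : 'I_(size [:: F; l])) : ([:: F; l]`_i).@[fun i => v 0 i] = 0.
  case: i => [[|[|i]] hi] //.
  by rewrite -[LHS]/(at_pt v l) at_pt_linear_form.
have := smoothZ nz vanZ.
set J := \matrix_(_, _) _.
have -> : J = (\col_i (if i == 0 :> 'I_2 then kappa else 1)) *m c.
  apply/matrixP => i j; rewrite !mxE big_ord1 !mxE.
  case: i => [[|[|]]] //= _; last by rewrite mderiv_linear_form mevalC mul1r.
  have := h (delta_mx 0 j); rewrite /dderiv (bigD1 j) //= big1 => [|a aj].
    rewrite mxE !eqxx scale1r addr0 => e; rewrite -[LHS]/(at_pt v F^`M(j)) e.
    rewrite mxE (bigD1 j) //= big1 => [|a aj].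
      by rewrite !mxE !eqxx mul1r addr0.
    by rewrite !mxE (negPf aj) andbF mul0r.
  by rewrite mxE (negPf aj) andbF scale0r.
move=> rk; have := mxrankM_maxl (\col_i (if i == 0 :> 'I_2 then kappa else 1)) c.
by rewrite rk => /leq_trans /(_ (rank_leq_col _)).
Qed.

Lemma smooth_notin w : F != w * l.
Proof.
apply/eqP => Fl.
have [v v0 /matrixP/(_ 0 0)] := @nonzero_kernel K 4 1 c^T isT; rewrite [RHS]mxE => lv.
apply: (@smooth_not_proportional v (at_pt v w) v0 lv) => z.
have dM (p q : S) : dderiv z (p * q) = dderiv z p * q + p * dderiv z q.
  rewrite /dderiv mulr_suml mulr_sumr -big_split; apply: eq_bigr => i _ /=.
  by rewrite mderivM scalerDr scalerAl scalerAr.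
rewrite Fl dM rmorphD !rmorphM /= at_pt_linear_form lv mulr0 add0r; congr (_ * _).
rewrite /dderiv (raddf_sum (at_pt v)) mxE; apply: eq_bigr => i _ /=.
by rewrite mderiv_linear_form /at_pt mevalZ mevalC mxE.
Qed.

(** [M = u *m c] says that the field is l times a constant field, that is, zero on the plane. In
    coordinates with l = x_0 it means that only the column of index 0 survives, the rest being the
    restricted field. *)
Lemma smooth_tangent_vfield (M : 'M[K]_4) a w :
  c *m M = a *: c -> vfield M F = w * l -> exists u : 'cV_4, M = u *m c.
Proof.
move=> cM MF.
have [|Y Yu Yc] := @complete_basis _ _ _ c.
  by rewrite -row_leq_rank rank_rV c0.
have {}Yc : row 0 Y = c by rewrite (Yc 0 0) //; apply/rowP => j; rewrite mxE.
pose W := invmx Y; pose M' := Y *m M *m W; pose F' := subst W F.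
have cW : c *m W = delta_mx 0 0 by rewrite -Yc -row_mul mulmxV // row1.
have M'0 : row 0 M' = a *: delta_mx 0 0.
  by rewrite /M' !row_mul Yc cM -scalemxAl cW.
have M'F' : vfield M' F' = subst W w * 'X_0.
  rewrite /F' -(@subst_vfield _ _ W M) ?MF ?rmorphM /= ?subst_linear_form ?cW.
    congr (_ * _); rewrite /linear_form (bigD1 0) //= big1 => [|j j0].
      by rewrite mxE !eqxx scale1r addr0.
    by rewrite mxE (negPf j0) andbF scale0r.
  by rewrite /M' !mulmxA mulVmx // mul1mx.
pose f := restr F'; pose N := \matrix_(i, j) M' (lift 0 i) (lift 0 j).
have hf : f \is 4.-homog by apply/restr_homog/subst_homog.
have M'0j j : M' 0 (lift 0 j) = 0.
  by have /rowP/(_ (lift 0 j)) := M'0; rewrite !mxE /= mulr0.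
have Nf : vfield N f = 0.
  by rewrite /f /N -restr_vfield // M'F' rmorphM /= restr_X0 mulr0.
have smooth_f (v : 'rV[K]_3) : v != 0 -> exists z, at_pt v (dderiv z f) != 0.
  move=> v0; have [/existsP[i hi]|/existsPn h] := boolP [exists i, at_pt v f^`M(i) != 0].
    exists (delta_mx 0 i); rewrite /dderiv (bigD1 i) //= big1 => [|j ji].
      by rewrite mxE !eqxx scale1r addr0.
    by rewrite mxE (negPf ji) andbF scale0r.
  pose v4 : 'rV[K]_4 := \row_i if unlift 0 i is Some j then v 0 j else 0.
  pose x := v4 *m W^T.
  have xY : x *m Y^T = v4 by rewrite /x -mulmxA -trmx_mul mulmxV // trmx1 mulmx1.
  have x0 : x != 0.
    apply: contraNneq v0 => x0; apply/eqP/rowP => j.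
    have := xY; rewrite x0 mul0mx => /rowP/(_ (lift 0 j)).
    by rewrite !mxE liftK => <-.
  (* At a singular point of the restricted quartic only the derivative of [F'] along the direction
     of index 0 may survive, so dF is proportional to l there. *)
  exfalso; apply: (@smooth_not_proportional x (at_pt v4 F'^`M(0)) x0).
    rewrite /x -mulmxA -trmx_mul cW mxE big1 // => i _; rewrite !mxE.
    by case: (unliftP 0 i) => [j ->|->]; rewrite ?mulr0 ?mul0r.
  move=> z; have FE : F = subst Y F' by rewrite /F' subst_subst mulVmx // subst1.
  rewrite {1}FE dderiv_subst (raddf_sum (at_pt x)) big_ord_recl big1 /= => [|i _].
    rewrite /at_pt mevalZ -/(at_pt x _) at_pt_subst xY addr0 mulrC; congr (_ * _).
    by rewrite -Yc !mxE; apply: eq_bigr => j _; rewrite !mxE.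
  rewrite /at_pt mevalZ -/(at_pt x _) at_pt_subst xY -at_pt_restr -mderiv_restr.
  by have := h i; rewrite negbK => /eqP ->; rewrite mulr0.
have N0 := smooth_vfield_eq0 hf Nf smooth_f.
have M'E : M' = col 0 M' *m delta_mx 0 0.
  apply: col0_matrixE => i j; case: (unliftP 0 i) => [i' ->|->]; last exact: M'0j.
  by have /matrixP/(_ i' j) := N0; rewrite mxE [RHS]mxE.
exists (W *m col 0 M'); rewrite -Yc rowE mulmxA -[W *m _ *m _]mulmxA -M'E.
by rewrite /M' !mulmxA mulVmx // mul1mx -mulmxA mulVmx // mulmx1.
Qed.

(** For degree reasons F enters with a constant coefficient k. The Euler field multiplies F by 4, so
    subtracting k / 4 times it leaves a field sending F into (l). *)
Lemma no_linear_syzygy :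
  (forall M : 'M[K]_4, (exists w, vfield M F = w * l) -> exists a, c *m M = a *: c) ->
  forall L : 'I_4 -> S, (forall a, L a \is 1.-homog) ->
     in_ideal [:: F; l] (\sum_a L a * F^`M(a)) ->
     exists k : K, forall a, in_ideal [:: l] (L a - k *: 'X_a).
Proof.
move=> nb L L1 /in_ideal2P[p [w e]].
have F1 a : F^`M(a) \is 3.-homog := mderiv_homog a hF.
have hE : \sum_a L a * F^`M(a) \is 4.-homog.
  by apply: rpred_sum => a _; exact: dhomogM (L1 a) (F1 a).
have [k pk] : exists k : K, pihomog mdeg 0 p = k%:MP.
  exists (pihomog mdeg 0 p)@_0%MM; apply: msize1_polyC.
  rewrite msizeE; apply/bigmax_leqP_seq => m mp _.
  by rewrite (dhomog_mf (pihomogP mdeg 0 p) mp).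
pose w' := pihomog mdeg 3 w.
have eE : \sum_a L a * F^`M(a) = k *: F + w' * l.
  rewrite -(pihomog_dE hE) e pihomogD (pihomogM p 0 hF) pk mul_mpolyC.
  by rewrite (pihomogM w 3 (linear_form_homog c)).
pose M := \matrix_(a, b) ((L a)@_U_(b) - (k / 4%:R) *+ (a == b)).
have ME a : linear_form (row a M) = L a - (k / 4%:R) *: 'X_a.
  rewrite [X in X - _](linear_formE (L1 a)) /linear_form.
  under eq_bigr => b _ do rewrite !mxE scalerBl.
  rewrite sumrB; congr (_ - _); rewrite (bigD1 a) //= eqxx mulr1n big1 ?addr0 // => b ba.
  by rewrite eq_sym (negPf ba) mulr0n scale0r.
have MF : vfield M F = w' * l.
  rewrite /vfield; under eq_bigr => a _ do rewrite ME mulrBl -scalerAl.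
  rewrite sumrB eE -scaler_sumr (euler hF) -scaler_nat scalerA divfK ?pnatr_eq0 //.
  by rewrite addrAC subrr add0r.
have [a cM] := nb M (ex_intro _ w' MF).
have [u Mu] := smooth_tangent_vfield cM MF.
exists (k / 4%:R) => b; rewrite -ME; apply/in_ideal1P; exists (u b 0)%:MP.
rewrite mul_mpolyC /linear_form scaler_sumr; apply: eq_bigr => j _.
by rewrite scalerA Mu !mxE big_ord1.
Qed.

End SmoothSections.

(** * A family of dimension 34 *)

Section Family.
Variable R : comNzRingType.
Implicit Types (k d e y : nat -> R) (u v t s : R).

Definition quartic2 k s t :=
  k 0 * s ^+ 4 + k 1 * s ^+ 3 * t + k 2 * s ^+ 2 * t ^+ 2 + k 3 * s * t ^+ 3 + k 4 * t ^+ 4.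
Definition quartic2_s k s t :=
  4%:R * k 0 * s ^+ 3 + 3%:R * k 1 * s ^+ 2 * t + 2%:R * k 2 * s * t ^+ 2 + k 3 * t ^+ 3.
Definition quartic2_t k s t :=
  k 1 * s ^+ 3 + 2%:R * k 2 * s ^+ 2 * t + 3%:R * k 3 * s * t ^+ 2 + 4%:R * k 4 * t ^+ 3.

Definition cubic2 k s t :=
  k 0 * s ^+ 3 + k 1 * s ^+ 2 * t + k 2 * s * t ^+ 2 + k 3 * t ^+ 3.
Definition cubic2_s k s t :=
  3%:R * k 0 * s ^+ 2 + 2%:R * k 1 * s * t + k 2 * t ^+ 2.
Definition cubic2_t k s t :=
  k 1 * s ^+ 2 + 2%:R * k 2 * s * t + 3%:R * k 3 * t ^+ 2.

Definition quadric3 k s t v :=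
  k 0 * s ^+ 2 + k 1 * s * t + k 2 * t ^+ 2 + k 3 * s * v + k 4 * t * v + k 5 * v ^+ 2.
Definition quadric3_s k s t v := 2%:R * k 0 * s + k 1 * t + k 3 * v.
Definition quadric3_t k s t v := k 1 * s + 2%:R * k 2 * t + k 4 * v.
Definition quadric3_v k s t v := k 3 * s + k 4 * t + 2%:R * k 5 * v.

Definition quadric4 k s t v u :=
  quadric3 k s t v + k 6 * s * u + k 7 * t * u + k 8 * v * u + k 9 * u ^+ 2.

(* The coefficient g of u in a quartic a + v (b + v c) + u g + u^2 h, with
   a(s,t), b(s,t) and c(s,t,v), for which the vector field
     Ds = n00 s + n01 t + n02 v,  Dt = n10 s + n11 t + n12 v,
     Dv = mu t + c2 v,            Du = v / la
   sends the quartic into the ideal (u). *)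
Definition tangent_cubic (a b c : nat -> R) (n00 n01 n02 n10 n11 n12 mu c2 la : R) s t v :=
  let Ds := n00 * s + n01 * t + n02 * v in
  let Dt := n10 * s + n11 * t + n12 * v in
  let Dv := mu * t + c2 * v in
  let q := cubic2 b s t + v * quadric3 c s t v in
  - la * (n02 * quartic2_s a s t + n12 * quartic2_t a s t + c2 * q + mu * t * quadric3 c s t v
    + Ds * (cubic2_s b s t + v * quadric3_s c s t v)
    + Dt * (cubic2_t b s t + v * quadric3_t c s t v)
    + Dv * (quadric3 c s t v + v * quadric3_v c s t v)).

(* [d] lists a (5), b (4), n00, n01, n10, n11, mu, la; [e] lists c (6), h (10),
   n02, n12, c2. *)
Definition tangent_quartic d e u v t s :=
  let a := d in let b := fun i => d (5 + i) in
  quartic2 a s t + v * (cubic2 b s t + v * quadric3 e s t v)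
  + u * tangent_cubic a b e (d 9) (d 10) (e 16) (d 11) (d 12) (e 17) (d 13) (e 18) (d 14) s t v
  + u ^+ 2 * quadric4 (fun i => e (6 + i)) s t v u.

(* Coefficients of tau t^m (s - gam t)^(4 - m). *)
Definition binomial_chart (m : nat) (tau gam : R) : seq R :=
  match m with
  | 0 => [:: tau; - (4%:R * tau * gam); 6%:R * tau * gam ^+ 2; - (4%:R * tau * gam ^+ 3);
             tau * gam ^+ 4]
  | 1 => [:: 0; tau; - (3%:R * tau * gam); 3%:R * tau * gam ^+ 2; - (tau * gam ^+ 3)]
  | 2 => [:: 0; 0; tau; - (2%:R * tau * gam); tau * gam ^+ 2]
  | 3 => [:: 0; 0; 0; tau; - (tau * gam)]
  | _ => [:: 0; 0; 0; 0; tau]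
  end.

(* Solutions of D0 a + mu t b = 0, for D0 = (n00 s + n01 t) d/ds +
   (n10 s + n11 t) d/dt, with mu = 1 (charts 0 and 1) or with mu = n10 = 0,
   la = 1, in terms of nine parameters.  In the second case either D0 = 0
   (chart 2) or a = tau t^m (s - gam t)^(4 - m) (chart 3 + m). *)
Definition chart (ch : nat) y : seq R :=
  let solve_b a0 a1 a2 a3 a4 n00 n01 n10 n11 :=
    [:: - (3%:R * n00 * a1 + 4%:R * n01 * a0 + 2%:R * n10 * a2 + n11 * a1);
        - (2%:R * n00 * a2 + 3%:R * n01 * a1 + 3%:R * n10 * a3 + 2%:R * n11 * a2);
        - (n00 * a3 + 2%:R * n01 * a2 + 4%:R * n10 * a4 + 3%:R * n11 * a3);
        - (n01 * a3 + 4%:R * n11 * a4)] in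
  match ch with
  | 0 =>
    let a0 := - (y 2 * y 1) in let a1 := 4%:R * y 2 in
    [:: a0; a1; y 5; y 6; y 7] ++ solve_b a0 a1 (y 5) (y 6) (y 7) (y 0) (y 3) (y 0 * y 1) (y 4)
    ++ [:: y 0; y 3; y 0 * y 1; y 4; 1; y 8]
  | 1 =>
    let a0 := y 2 in let a1 := - (4%:R * y 2 * y 1) in
    [:: a0; a1; y 5; y 6; y 7] ++ solve_b a0 a1 (y 5) (y 6) (y 7) (y 0 * y 1) (y 3) (y 0) (y 4)
    ++ [:: y 0 * y 1; y 3; y 0; y 4; 1; y 8]
  | 2 => [:: y 0; y 1; y 2; y 3; y 4; y 5; y 6; y 7; y 8; 0; 0; 0; 0; 0; 1]
  | m.+3 => binomial_chart m (y 3) (y 4) ++ [:: y 5; y 6; y 7; y 8; y 0; y 1; 0; y 2; 0; 1]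
  end.

Lemma tangent_quartic_ext d d' e e' u v t s :
  (forall i, (i < 15)%N -> d i = d' i) -> (forall i, (i < 19)%N -> e i = e' i) ->
  tangent_quartic d e u v t s = tangent_quartic d' e' u v t s.
Proof.
move=> hd he.
by rewrite /tangent_quartic /tangent_cubic /quartic2 /quartic2_s /quartic2_t /cubic2 /cubic2_s
   /cubic2_t /quadric4 /quadric3 /quadric3_s /quadric3_t /quadric3_v /= !hd ?he.
Qed.

Lemma chart_ext ch y y' : (forall i, (i < 9)%N -> y i = y' i) -> chart ch y = chart ch y'.
Proof. by move=> h; case: ch => [|[|[|ch]]] /=; rewrite !h. Qed.

End Family.

(** The family is written once over any commutative ring. Over polynomials in the parameters it
    gives polynomial coefficient functions, over K actual quartics; evaluation and coordinate
    changes are both ring morphisms. *)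
Lemma tangent_quartic_morph (R R' : comNzRingType) (phi : {rmorphism R -> R'})
  (d e : nat -> R) u v t s :
  phi (tangent_quartic d e u v t s) =
  tangent_quartic (phi \o d) (phi \o e) (phi u) (phi v) (phi t) (phi s).
Proof.
rewrite /tangent_quartic /tangent_cubic /quartic2 /quartic2_s /quartic2_t /cubic2 /cubic2_s
   /cubic2_t /quadric4 /quadric3 /quadric3_s /quadric3_t /quadric3_v /=.
by rewrite !(rmorph_nat, rmorphXn, rmorphN, rmorphM, rmorphD) /=.
Qed.

Lemma binomial_chart_morph (R R' : comNzRingType) (phi : {rmorphism R -> R'}) m tau gam :
  map phi (binomial_chart m tau gam) = binomial_chart m (phi tau) (phi gam).
Proof.
case: m => [|[|[|[|m]]]];
  by rewrite /= ?(rmorph_nat, rmorph0, rmorphXn, rmorphN, rmorphM).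
Qed.

Lemma chart_morph (R R' : comNzRingType) (phi : {rmorphism R -> R'}) ch (y : nat -> R) i :
  phi (nth 0 (chart ch y) i) = nth 0 (chart ch (phi \o y)) i.
Proof.
have h : map phi (chart ch y) = chart ch (phi \o y).
  case: ch => [|[|[|m]]]; last first.
    rewrite [LHS]map_cat [map phi (binomial_chart _ _ _)]binomial_chart_morph.
    by congr (_ ++ _); rewrite /= !(rmorph1, rmorph0).
  1-3: by rewrite /= ?(rmorph_nat, rmorph1, rmorph0, rmorphXn, rmorphN, rmorphM, rmorphD).
rewrite -h; case: (ltnP i (size (chart ch y))) => hi; first by rewrite (nth_map 0).
by rewrite !nth_default ?size_map // rmorph0.
Qed.

Section Derivations.
Variables (R : comNzRingType) (D : R -> R).
Hypothesis DD : forall x y, D (x + y) = D x + D y.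
Hypothesis DM : forall x y, D (x * y) = D x * y + x * D y.

Lemma der_quartic2 (k : nat -> R) s t : (forall i, D (k i) = 0) ->
  D (quartic2 k s t) = quartic2_s k s t * D s + quartic2_t k s t * D t.
Proof.
by move=> Dk; rewrite /quartic2 /quartic2_s /quartic2_t !exprS !expr0 !mulr1 !DD !DM !Dk; ring.
Qed.

Lemma der_cubic2 (k : nat -> R) s t : (forall i, D (k i) = 0) ->
  D (cubic2 k s t) = cubic2_s k s t * D s + cubic2_t k s t * D t.
Proof.
by move=> Dk; rewrite /cubic2 /cubic2_s /cubic2_t !exprS !expr0 !mulr1 !DD !DM !Dk; ring.
Qed.

Lemma der_quadric3 (k : nat -> R) s t v : (forall i, D (k i) = 0) ->
  D (quadric3 k s t v) =
  quadric3_s k s t v * D s + quadric3_t k s t v * D t + quadric3_v k s t v * D v.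
Proof.
move=> Dk; rewrite /quadric3 /quadric3_s /quadric3_t /quadric3_v !expr2.
by rewrite !DD !DM !Dk; ring.
Qed.

End Derivations.

(** * Writing forms by successive division *)

Section Forms.
Variables (K : fieldType) (n : nat).
Local Notation S := {mpoly K[n]}.

(* [is_form xs d p]: p is a form of degree d in the variables xs, presented by
   successive division by the variables. *)
Fixpoint is_form (xs : seq S) : nat -> S -> Prop :=
  if xs is x :: xs' then
    fix is_form_x d p :=
      if d is d'.+1 then
        exists q r, [/\ is_form xs' d q, is_form_x d' r & p = q + x * r]
      else exists c, p = c%:MP
  else fun d p => if d is 0 then exists c, p = c%:MP else p = 0.

Lemma homog0_const (p : S) : p \is 0.-homog -> exists c, p = c%:MP.
Proof.
move=> hp; exists p@_0%MM; apply: msize1_polyC; rewrite msizeE.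
by apply/bigmax_leqP_seq => m mp _; rewrite (dhomog_mf hp mp).
Qed.

Lemma is_form_homog (js : seq 'I_n) d p : uniq js -> p \is d.-homog ->
  (forall (m : 'X_{1..n}) i, m \in msupp p -> m i != 0%N -> i \in js) ->
  is_form [seq 'X_j | j <- js] d p.
Proof.
elim: js d p => [|j js IHjs].
  case=> [|d] p _ hp hs /=; first exact: homog0_const.
  apply/mpolyP => m; rewrite mcoeff0; apply/eqP; rewrite mcoeff_eq0; apply/negP => mp.
  have m0 : m = 0%MM by apply/mnmP => i; rewrite mnm0E; apply/eqP/contraT => /(hs _ _ mp).
  by have := dhomog_mf hp mp; rewrite /= m0 mdeg0.
elim=> [|d IHd] p ujs hp hs; first exact: homog0_const.
have [r hr] := mpolyXn_split p j 1; set q := p - _ in hr.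
have rE : p = q + r * 'X_j by rewrite /q expr1 subrK.
have qs m : m \in msupp q -> m \in msupp p /\ m j = 0%N.
  rewrite !mcoeff_msupp hr; case: ifP => [mj pm|_]; last by rewrite eqxx.
  split=> //.
  by apply/eqP; rewrite -leqn0 -ltnS.
have hq : q \is d.+1.-homog.
  by apply/dhomogP => m /qs[mp _]; exact: (dhomog_mf hp mp).
have hrX : r * 'X_j \is d.+1.-homog.
  by have -> : r * 'X_j = p - q by [rewrite {1}rE addrAC subrr add0r]; apply: rpredB.
have X0 : 'X_j != 0 :> S by rewrite -msize_poly_eq0 msizeX.
exists q, r; split; last by rewrite rE mulrC.
- apply: IHjs => //; first by case/andP: ujs.
  move=> m i /qs[mp mj] mi; have := hs m i mp mi; rewrite inE => /orP[/eqP e|//].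
  by rewrite e mj in mi.
- apply: IHd => //.
    have := @dhomog_factor _ _ 'X_j r 1 d X0; rewrite add1n mulrC; apply=> //.
    by rewrite dhomogX /= mdeg1.
  move=> m i mr mi; apply: (hs (U_(j) + m)%MM); last by rewrite mnmDE addn_eq0 (negPf mi) andbF.
  have : (r * 'X_j)@_(U_(j) + m) != 0 by rewrite mcoeffMX -mcoeff_msupp.
  have -> : r * 'X_j = p - q by rewrite {1}rE addrAC subrr add0r.
  by rewrite mcoeffB hr mnmDE mnm1E eqxx add1n ltnS ltn0 subr0 -mcoeff_msupp.
Qed.

Lemma is_form_fixed (phi : {rmorphism S -> S}) xs d p : (forall c, phi c%:MP = c%:MP) ->
  (forall x, x \in xs -> phi x = x) -> is_form xs d p -> phi p = p.
Proof.
move=> phiC; elim: xs d p => [|x xs IHxs] d p hx.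
  by case: d => [[c ->]|d ->]; rewrite ?phiC ?rmorph0.
elim: d p => [|d IHd] p /=; first by case=> c ->.
case=> q [r [hq hr ->]]; rewrite rmorphD rmorphM (hx x) ?mem_head //.
by rewrite (IHxs _ _ _ hq) ?(IHd _ hr) // => y yx; apply: hx; rewrite inE yx orbT.
Qed.

Definition cf (l : seq K) (i : nat) : S := (nth 0 l i)%:MP.

Lemma form1P x d p : is_form [:: x] d p -> exists c, p = c%:MP * x ^+ d.
Proof.
elim: d p => [|d IHd] p /=; first by case=> c ->; exists c; rewrite mulr1.
by case=> q [r [-> /IHd[c ->] ->]]; exists c; rewrite exprS; ring.
Qed.

Lemma form2S x y d p : is_form [:: x; y] d.+1 p ->
  exists c r, is_form [:: x; y] d r /\ p = c%:MP * y ^+ d.+1 + x * r.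
Proof. by case=> q [r [hq hr ->]]; have [c ->] := @form1P y d.+1 q hq; exists c, r. Qed.

Lemma quartic2P t s p : is_form [:: t; s] 4 p -> exists2 k, size k = 5%N & p = quartic2 (cf k) s t.
Proof.
move=> /form2S[k0 [_ [/form2S[k1 [_ [/form2S[k2 [_ [/form2S[k3 [_ [[k4 ->] ->]]] ->]]] ->]]] ->]]].
by exists [:: k0; k1; k2; k3; k4] => //; rewrite /quartic2 /cf /=; ring.
Qed.

Lemma cubic2P t s p : is_form [:: t; s] 3 p -> exists2 k, size k = 4%N & p = cubic2 (cf k) s t.
Proof.
move=> /form2S[k0 [_ [/form2S[k1 [_ [/form2S[k2 [_ [[k3 ->] ->]]] ->]]] ->]]].
by exists [:: k0; k1; k2; k3] => //; rewrite /cubic2 /cf /=; ring.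
Qed.

Lemma form2_2P t s p : is_form [:: t; s] 2 p ->
  exists k0 k1 k2, p = k0%:MP * s ^+ 2 + k1%:MP * s * t + k2%:MP * t ^+ 2.
Proof.
move=> /form2S[k0 [_ [/form2S[k1 [_ [[k2 ->] ->]]] ->]]].
by exists k0, k1, k2; ring.
Qed.

Lemma form2_1P t s p : is_form [:: t; s] 1 p -> exists k0 k1, p = k0%:MP * s + k1%:MP * t.
Proof. by move=> /form2S[k0 [_ [[k1 ->] ->]]]; exists k0, k1; ring. Qed.

Lemma form3_2P v t s p : is_form [:: v; t; s] 2 p -> exists k0 k1 k2 k3 k4 k5,
  p = k0%:MP * s ^+ 2 + k1%:MP * s * t + k2%:MP * t ^+ 2 + k3%:MP * s * v + k4%:MP * t * v
    + k5%:MP * v ^+ 2.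
Proof.
case=> q [r [/form2_2P[k0 [k1 [k2 ->]]] [q' [r' [/form2_1P[k3 [k4 ->]] [k5 ->] ->]]] ->]].
by exists k0, k1, k2, k3, k4, k5; ring.
Qed.

Lemma quadric3P v t s p : is_form [:: v; t; s] 2 p ->
  exists2 k, size k = 6%N & p = quadric3 (cf k) s t v.
Proof.
case/form3_2P => k0 [k1 [k2 [k3 [k4 [k5 ->]]]]].
by exists [:: k0; k1; k2; k3; k4; k5].
Qed.

Lemma quadric4P u v t s p : is_form [:: u; v; t; s] 2 p ->
  exists2 k, size k = 10%N & p = quadric4 (cf k) s t v u.
Proof.
case=> q [r [/form3_2P[k0 [k1 [k2 [k3 [k4 [k5 ->]]]]]] [q' [r' [[q1 [r1 [/form2_1P[k6 [k7 ->]] [k8 ->] ->]]] [k9 ->] ->]]] ->]].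
exists [:: k0; k1; k2; k3; k4; k5; k6; k7; k8; k9] => //.
by rewrite /quadric4 /quadric3 /cf /=; ring.
Qed.

End Forms.

(** * Normal form of quartics with a tangent vector field *)

Section AbstractTangency.
Variables (R : idomainType) (D : R -> R) (phi psi : {rmorphism R -> R}).
Variables (u v t s : R) (a b c : nat -> R) (G h : R).
Variables (n00 n01 n02 n10 n11 n12 mu c2 la : R).
Hypothesis DD : forall x y, D (x + y) = D x + D y.
Hypothesis DM : forall x y, D (x * y) = D x * y + x * D y.
Hypotheses (Da : forall i, D (a i) = 0) (Db : forall i, D (b i) = 0) (Dc : forall i, D (c i) = 0).
Hypotheses (phi_a : forall i, phi (a i) = a i) (phi_b : forall i, phi (b i) = b i)
  (phi_c : forall i, phi (c i) = c i).
Hypotheses (phi_u : phi u = 0) (phi_v : phi v = v) (phi_t : phi t = t) (phi_s : phi s = s).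
Hypothesis phi_G : phi G = G.
Hypotheses (phi_Du : phi (D u) = la * v) (phi_Dv : phi (D v) = mu * t + c2 * v)
  (phi_Dt : phi (D t) = n10 * s + n11 * t + n12 * v)
  (phi_Ds : phi (D s) = n00 * s + n01 * t + n02 * v).

Definition tangency_quartic :=
  (n00 * s + n01 * t) * quartic2_s a s t + (n10 * s + n11 * t) * quartic2_t a s t
  + mu * t * cubic2 b s t.

(** Modulo u the term u^2 h disappears and G enters only through its product with D u = la v. The
    rest splits into a binary part free of v and a multiple of v that determines G. The abstract
    setting keeps the coefficients atomic for [ring]. *)
Lemma tangency_equation :
  phi (D (quartic2 a s t + v * (cubic2 b s t + v * quadric3 c s t v) + u * G + u ^+ 2 * h)) = 0 ->
  tangency_quartic + v * (la * G
    - tangent_cubic a b c n00 n01 n02 n10 n11 n12 mu c2 1 s t v) = 0.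
Proof.
rewrite 3!DD (DM v) (DD (cubic2 b s t)) (DM v) (DM u) (DM (u ^+ 2)) expr2 (DM u).
rewrite (der_quartic2 DD DM) // (der_cubic2 DD DM) // (der_quadric3 DD DM) //.
have F1 : phi (quartic2_s a s t) = quartic2_s a s t.
  by rewrite /quartic2_s !(rmorph_nat, rmorphXn, rmorphM, rmorphD) !phi_a phi_t phi_s.
have F2 : phi (quartic2_t a s t) = quartic2_t a s t.
  by rewrite /quartic2_t !(rmorph_nat, rmorphXn, rmorphM, rmorphD) !phi_a phi_t phi_s.
have F3 : phi (cubic2 b s t) = cubic2 b s t.
  by rewrite /cubic2 !(rmorph_nat, rmorphXn, rmorphM, rmorphD) !phi_b phi_t phi_s.
have F4 : phi (cubic2_s b s t) = cubic2_s b s t.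
  by rewrite /cubic2_s !(rmorph_nat, rmorphXn, rmorphM, rmorphD) !phi_b phi_t phi_s.
have F5 : phi (cubic2_t b s t) = cubic2_t b s t.
  by rewrite /cubic2_t !(rmorph_nat, rmorphXn, rmorphM, rmorphD) !phi_b phi_t phi_s.
have F6 : phi (quadric3 c s t v) = quadric3 c s t v.
  by rewrite /quadric3 !(rmorphXn, rmorphM, rmorphD) !phi_c phi_v phi_t phi_s.
have F7 : phi (quadric3_s c s t v) = quadric3_s c s t v.
  by rewrite /quadric3_s !(rmorph_nat, rmorphM, rmorphD) !phi_c phi_v phi_t phi_s.
have F8 : phi (quadric3_t c s t v) = quadric3_t c s t v.
  by rewrite /quadric3_t !(rmorph_nat, rmorphM, rmorphD) !phi_c phi_v phi_t phi_s.
have F9 : phi (quadric3_v c s t v) = quadric3_v c s t v.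
  by rewrite /quadric3_v !(rmorph_nat, rmorphM, rmorphD) !phi_c phi_v phi_t phi_s.
rewrite !(F1, F2, F3, F4, F5, F6, F7, F8, F9, rmorphM, rmorphD).
rewrite phi_u phi_v phi_G phi_Du phi_Dv phi_Dt phi_Ds /tangency_quartic /tangent_cubic /=.
by move=> <-; ring.
Qed.

End AbstractTangency.

Section ChartCover.
Variable K : numFieldType.
Variables (a0 a1 a2 a3 a4 b0 b1 b2 b3 n00 n01 n10 n11 mu la : K).

(** The coefficients of s^4, s^3 t, ..., t^4 in D0 a + mu t b. *)
Definition tangency_coefs := [:: 4%:R * n00 * a0 + n10 * a1;
  3%:R * n00 * a1 + 4%:R * n01 * a0 + 2%:R * n10 * a2 + n11 * a1 + mu * b0;
  2%:R * n00 * a2 + 3%:R * n01 * a1 + 3%:R * n10 * a3 + 2%:R * n11 * a2 + mu * b1;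
  n00 * a3 + 2%:R * n01 * a2 + 4%:R * n10 * a4 + 3%:R * n11 * a3 + mu * b2;
  n01 * a3 + 4%:R * n11 * a4 + mu * b3].

Local Notation data := [:: a0; a1; a2; a3; a4; b0; b1; b2; b3; n00; n01; n10; n11; mu; la].

Hypothesis eqs : tangency_coefs = [:: 0; 0; 0; 0; 0].

(** With mu = 1 all equations but that of s^4 are solved for b. The remaining one, 4 n00 a0 + n10 a1
    = 0, says that the matrix with rows (n00, n10) and (a1 / 4, - a0) has proportional columns; nu
    is the ratio, in one of two directions. *)
Lemma chart_cover_transverse : mu = 1 -> exists ch y, (ch < 8)%N /\ chart ch (nth 0 y) = data.
Proof.
case: eqs => e0 e1 e2 e3 e4 mu1; rewrite mu1 !mul1r in e1 e2 e3 e4.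
have four : (4%:R : K) != 0 by rewrite pnatr_eq0.
have [u0 [u1 [u2 u3]]] : b0 = - (3%:R * n00 * a1 + 4%:R * n01 * a0 + 2%:R * n10 * a2 + n11 * a1) /\
   b1 = - (2%:R * n00 * a2 + 3%:R * n01 * a1 + 3%:R * n10 * a3 + 2%:R * n11 * a2) /\
   b2 = - (n00 * a3 + 2%:R * n01 * a2 + 4%:R * n10 * a4 + 3%:R * n11 * a3) /\
   b3 = - (n01 * a3 + 4%:R * n11 * a4).
  by do ![split]; apply/eqP; rewrite -addr_eq0 addrC; apply/eqP.
have chart0 nu : n10 = n00 * nu -> a0 = - (a1 / 4%:R * nu) ->
    exists ch y, (ch < 8)%N /\ chart ch (nth 0 y) = data.
  move=> en ea; exists 0%N, [:: n00; nu; a1 / 4%:R; n01; n11; a2; a3; a4; la]; split=> //=.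
  by rewrite mu1 u0 u1 u2 u3 ea en [4%:R * (a1 / _)]mulrC divfK.
have chart1 nu : n00 = n10 * nu -> a1 = - (4%:R * a0 * nu) ->
    exists ch y, (ch < 8)%N /\ chart ch (nth 0 y) = data.
  move=> en ea; exists 1%N, [:: n10; nu; a0; n01; n11; a2; a3; a4; la]; split=> //=.
  by rewrite mu1 u0 u1 u2 u3 ea en.
have [n00_0|n00_0] := eqVneq n00 0; last first.
  apply: (chart0 (n10 / n00)); first by rewrite mulrC divfK.
  apply/eqP; rewrite -addr_eq0; apply/eqP.
  have -> : a0 + a1 / 4%:R * (n10 / n00) = (4%:R * n00 * a0 + n10 * a1) / (4%:R * n00).
    by field; rewrite ?n00_0 ?four.
  by rewrite e0 mul0r.
have [n10_0|n10_0] := eqVneq n10 0; last first.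
  apply: (chart1 0); first by rewrite n00_0 mulr0.
  rewrite mulr0 oppr0; move/eqP: e0; rewrite n00_0 mulr0 mul0r add0r mulf_eq0 (negPf n10_0).
  by move/eqP.
have [a1_0|a1_0] := eqVneq a1 0.
  by apply: (chart1 0); rewrite ?n00_0 ?n10_0 ?a1_0 !mulr0 ?oppr0.
apply: (chart0 (- (4%:R * a0) / a1)); first by rewrite n00_0 n10_0 mul0r.
by field; rewrite ?a1_0 ?four.
Qed.

(** Now D0 a = 0 with D0 triangular. If n11 differs from n00, then t and s - g t, for g = n01 / (n11
    - n00), are eigenforms of D0 with eigenvalues n11 and n00. The first nonzero coefficient of a
    fixes the weight, and the equations after it force a to be a monomial in these eigenforms. *)
Lemma chart_cover_tangent : mu = 0 -> n10 = 0 -> la = 1 ->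
  exists ch y, (ch < 8)%N /\ chart ch (nth 0 y) = data.
Proof.
case: eqs => e0 e1 e2 e3 e4 mu0 n10_0 la1.
rewrite mu0 n10_0 !(mulr0, mul0r, addr0) in e0 e1 e2 e3 e4; rewrite mu0 n10_0 la1.
have [/and3P[/eqP z0 /eqP z1 /eqP z2]|nz] := boolP [&& n00 == 0, n01 == 0 & n11 == 0].
  exists 2%N, [:: a0; a1; a2; a3; a4; b0; b1; b2; b3]; split=> //=.
  by rewrite z0 z1 z2.
have nat0 m : (m.+1%:R : K) != 0 by rewrite pnatr_eq0.
have chartG m tau gam : (m < 5)%N -> binomial_chart m tau gam = [:: a0; a1; a2; a3; a4] ->
    exists ch y, (ch < 8)%N /\ chart ch (nth 0 y) =
    [:: a0; a1; a2; a3; a4; b0; b1; b2; b3; n00; n01; 0; n11; 0; 1].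
  move=> m5 E; exists m.+3, [:: n00; n01; n11; tau; gam; b0; b1; b2; b3]; split=> //.
  by rewrite [LHS]/(binomial_chart m tau gam ++ _) E.
pose de := n11 - n00.
have n11E : n11 = n00 + de by rewrite /de addrC subrK.
pose g := n01 / de.
have solve (x y z : K) k j : de != 0 -> k.+1%:R * de * x + j%:R * n01 * y = 0 ->
    k.+1%:R * z = - (j%:R * g * y) -> x = z.
  move=> de0; move: (nat0 k); move: (k.+1%:R : K) => c c0 h hz.
  apply: (mulfI (mulf_neq0 c0 de0)); apply/eqP; rewrite -subr_eq0; apply/eqP.
  have -> : c * de * x - c * de * z = (c * de * x + j%:R * n01 * y) - (c * z + j%:R * g * y) * de.
    have {1}-> : n01 = g * de by rewrite /g divfK.
    ring.
  by rewrite h hz addNr mul0r subr0.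
(* the equation of index m, for m the index of the first nonzero coefficient of
   the binary quartic *)
have weight m (a : K) : a != 0 -> (4%:R * n00 + m%:R * de) * a = 0 -> 4%:R * n00 + m%:R * de = 0.
  by move=> a_0 /eqP; rewrite mulf_eq0 (negPf a_0) orbF => /eqP.
have de_neq0 m j (a x : K) : a != 0 -> 4%:R * n00 + m%:R * de = 0 ->
    (4%:R * n00 + m.+1%:R * de) * x + j.+1%:R * n01 * a = 0 -> de != 0.
  move=> a_0 w h; apply: contra nz => /eqP de0; rewrite de0 !mulr0 !addr0 in w h.
  have n00_0 : n00 = 0 by move/eqP: w; rewrite mulf_eq0 (negPf (nat0 3)) => /eqP.
  move/eqP: h; rewrite w mul0r add0r !mulf_eq0 (negPf a_0) (negPf (nat0 j)) orbF /= => /eqP n01_0.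
  by rewrite n11E n00_0 n01_0 de0 addr0 !eqxx.
have [a0_0|a0_0] := eqVneq a0 0; last first.
  have w : 4%:R * n00 + 0%:R * de = 0.
    by apply: (weight _ a0) => //; rewrite -e0; ring.
  have de0 : de != 0.
    by apply: (de_neq0 0%N 3%N a0 a1) => //; rewrite -e1 n11E; ring.
  have q1 : a1 = (- (4%:R * a0 * g)).
    apply: (@solve _ a0 _ 0%N 4%N de0); last by ring.
    rewrite -e1 -[RHS]subr0 -[X in _ - X](mul0r a1) -w n11E; ring.
  have q2 : a2 = (6%:R * a0 * g ^+ 2).
    apply: (@solve _ a1 _ 1%N 3%N de0); last by rewrite q1; ring.
    rewrite -e2 -[RHS]subr0 -[X in _ - X](mul0r a2) -w n11E; ring.
  have q3 : a3 = (- (4%:R * a0 * g ^+ 3)).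
    apply: (@solve _ a2 _ 2%N 2%N de0); last by rewrite q2; ring.
    rewrite -e3 -[RHS]subr0 -[X in _ - X](mul0r a3) -w n11E; ring.
  have q4 : a4 = (a0 * g ^+ 4).
    apply: (@solve _ a3 _ 3%N 1%N de0); last by rewrite q3; ring.
    rewrite -e4 -[RHS]subr0 -[X in _ - X](mul0r a4) -w n11E; ring.
  apply: (chartG 0%N a0 g) => //; rewrite /binomial_chart.
  by rewrite q4 q3 q2 q1 //.
have [a1_0|a1_0] := eqVneq a1 0; last first.
  have w : 4%:R * n00 + 1%:R * de = 0.
    by apply: (weight _ a1) => //; rewrite -e1 n11E a0_0; ring.
  have de0 : de != 0.
    by apply: (de_neq0 1%N 2%N a1 a2) => //; rewrite -e2 n11E; ring.
  have q2 : a2 = (- (3%:R * a1 * g)).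
    apply: (@solve _ a1 _ 0%N 3%N de0); last by ring.
    rewrite -e2 -[RHS]subr0 -[X in _ - X](mul0r a2) -w n11E; ring.
  have q3 : a3 = (3%:R * a1 * g ^+ 2).
    apply: (@solve _ a2 _ 1%N 2%N de0); last by rewrite q2; ring.
    rewrite -e3 -[RHS]subr0 -[X in _ - X](mul0r a3) -w n11E; ring.
  have q4 : a4 = (- (a1 * g ^+ 3)).
    apply: (@solve _ a3 _ 2%N 1%N de0); last by rewrite q3; ring.
    rewrite -e4 -[RHS]subr0 -[X in _ - X](mul0r a4) -w n11E; ring.
  apply: (chartG 1%N a1 g) => //; rewrite /binomial_chart.
  by rewrite a0_0 q4 q3 q2 //.
have [a2_0|a2_0] := eqVneq a2 0; last first.
  have w : 4%:R * n00 + 2%:R * de = 0.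
    by apply: (weight _ a2) => //; rewrite -e2 n11E a1_0; ring.
  have de0 : de != 0.
    by apply: (de_neq0 2%N 1%N a2 a3) => //; rewrite -e3 n11E; ring.
  have q3 : a3 = (- (2%:R * a2 * g)).
    apply: (@solve _ a2 _ 0%N 2%N de0); last by ring.
    rewrite -e3 -[RHS]subr0 -[X in _ - X](mul0r a3) -w n11E; ring.
  have q4 : a4 = (a2 * g ^+ 2).
    apply: (@solve _ a3 _ 1%N 1%N de0); last by rewrite q3; ring.
    rewrite -e4 -[RHS]subr0 -[X in _ - X](mul0r a4) -w n11E; ring.
  apply: (chartG 2%N a2 g) => //; rewrite /binomial_chart.
  by rewrite a0_0 a1_0 q4 q3 //.
have [a3_0|a3_0] := eqVneq a3 0; last first.
  have w : 4%:R * n00 + 3%:R * de = 0.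
    by apply: (weight _ a3) => //; rewrite -e3 n11E a2_0; ring.
  have de0 : de != 0.
    by apply: (de_neq0 3%N 0%N a3 a4) => //; rewrite -e4 n11E; ring.
  have q4 : a4 = (- (a3 * g)).
    apply: (@solve _ a3 _ 0%N 1%N de0); last by ring.
    rewrite -e4 -[RHS]subr0 -[X in _ - X](mul0r a4) -w n11E; ring.
  apply: (chartG 3%N a3 g) => //; rewrite /binomial_chart.
  by rewrite a0_0 a1_0 a2_0 q4 //.
(* This last chart also takes care of a = 0. *)
apply: (chartG 4%N a4 0) => //; by rewrite /binomial_chart a0_0 a1_0 a2_0 a3_0.
Qed.

End ChartCover.

Section NormalForm.
Variable K : numFieldType.
Local Notation S := {mpoly K[4]}.

Lemma sum_ord4 (V : nmodType) (G : 'I_4 -> V) : \sum_j G j = G 0 + G 1 + G 2%R + G 3%R.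
Proof.
rewrite !big_ord_recl big_ord0 addr0 !addrA.
by congr (_ + _ + _ + _); congr (G _); apply: val_inj.
Qed.

Definition kill (i : 'I_4) (p : S) : S :=
  p \mPo [tuple if a == i then 0 else 'X_a | a < 4].

HB.instance Definition _ i := GRing.RMorphism.copy (kill i)
  (comp_mpoly [tuple if a == i then (0 : S) else 'X_a | a < 4]).

Lemma killC i c : kill i c%:MP = c%:MP.
Proof. exact: comp_mpolyC. Qed.

Lemma killX i a : kill i 'X_a = if a == i then 0 else 'X_a.
Proof. by rewrite /kill comp_mpolyXU -tnth_nth tnth_mktuple. Qed.

Lemma linear_form4 (w : 'rV[K]_4) : linear_form w =
  (w 0 0)%:MP * 'X_0 + (w 0 1)%:MP * 'X_1 + (w 0 2%R)%:MP * 'X_2%R + (w 0 3%R)%:MP * 'X_3%R.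
Proof. by rewrite /linear_form sum_ord4 -!mul_mpolyC. Qed.

Lemma quartic2_eq0 (k : seq K) : quartic2 (cf 4 k) 'X_3%R ('X_2%R : S) = 0 ->
  forall i, (i < 5)%N -> nth 0 k i = 0.
Proof.
move=> e; pose chi : S -> {poly K} := mmap (@polyC K) (fun a : 'I_4 => if a == 2%R then 'X else 1).
pose c i := nth 0 k i.
have : chi (quartic2 (cf 4 k) 'X_3%R 'X_2%R) =
    (c 0)%:P + (c 1)%:P * 'X + (c 2)%:P * 'X^2 + (c 3)%:P * 'X^3 + (c 4)%:P * 'X^4.
  rewrite /quartic2 /cf /chi !(rmorphXn, rmorphM, rmorphD) /= !mmapC !mmapX !mmap1U /=.
  by rewrite !expr1n !mulr1.
rewrite e /chi mmap0 => /esym p0 i i5.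
have := congr1 (fun p : {poly K} => p`_i) p0; rewrite coef0 !coefD !coefMX !coefMXn !coefC.
by case: i i5 => [|[|[|[|[|]]]]] //= _; rewrite /c ?(addr0, add0r).
Qed.

Variables (F : S) (M : 'M[K]_4) (w : S).
Hypothesis hF : F \is 4.-homog.
Hypothesis MF : vfield M F = w * 'X_0.
Hypotheses (M02 : M 0 2%R = 0) (M03 : M 0 3%R = 0) (M01 : M 0 1 != 0) (M13 : M 1 3%R = 0).

Lemma tangent_form : exists a b c h : seq K,
  let d := [:: nth 0 a 0; nth 0 a 1; nth 0 a 2; nth 0 a 3; nth 0 a 4;
    nth 0 b 0; nth 0 b 1; nth 0 b 2; nth 0 b 3;
    M 3%R 3%R; M 3%R 2%R; M 2%R 3%R; M 2%R 2%R; M 1 2%R; (M 0 1)^-1] in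
  let e := [:: nth 0 c 0; nth 0 c 1; nth 0 c 2; nth 0 c 3; nth 0 c 4; nth 0 c 5;
    nth 0 h 0; nth 0 h 1; nth 0 h 2; nth 0 h 3; nth 0 h 4; nth 0 h 5; nth 0 h 6;
    nth 0 h 7; nth 0 h 8; nth 0 h 9; M 3%R 1; M 2%R 1; M 1 1] in
  F = tangent_quartic (cf 4 d) (cf 4 e) 'X_0 'X_1 'X_2%R 'X_3%R /\
  tangency_coefs (nth 0 a 0) (nth 0 a 1) (nth 0 a 2) (nth 0 a 3) (nth 0 a 4)
    (nth 0 b 0) (nth 0 b 1) (nth 0 b 2) (nth 0 b 3)
    (M 3%R 3%R) (M 3%R 2%R) (M 2%R 3%R) (M 2%R 2%R) (M 1 2%R) = [:: 0; 0; 0; 0; 0].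
Proof.
have : is_form [seq 'X_j | j <- [:: 0; 1; 2%R; 3%R : 'I_4]] 4 F.
  apply: is_form_homog => // m i _ _.
  by case: i => [[|[|[|[|]]]]] //= ?; rewrite !inE; do ?[apply/orP; by left | apply/orP; right].
rewrite /map => -[f [F1 [hf [G [h' [hG hh ->]]] FE]]]; move: hf FE.
case=> [a' [q [ha [b' [c' [hb hc ->]]] ->]]].
have [a _ ->] := quartic2P ha; have [b _ ->] := cubic2P hb.
have [c _ ->] := quadric3P hc; have [h _ ->] := quadric4P hh => FE {ha hb hc hh a' b' c' h'}.
have {}FE : F = quartic2 (cf 4 a) 'X_3%R 'X_2%R + 'X_1 * (cubic2 (cf 4 b) 'X_3%R 'X_2%R
      + 'X_1 * quadric3 (cf 4 c) 'X_3%R 'X_2%R 'X_1) + 'X_0 * G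
      + 'X_0 ^+ 2 * quadric4 (cf 4 h) 'X_3%R 'X_2%R 'X_1 'X_0 by rewrite FE; ring.
have kG : kill 0 G = G.
  apply: (@is_form_fixed K 4 (kill 0) [:: 'X_1; 'X_2%R; 'X_3%R] 3 G (killC 0) _ hG) => x.
  by rewrite !inE => /or3P[] /eqP ->; rewrite /= killX.
have Dc (l : seq K) i : vfield M (cf 4 l i) = 0 by rewrite /cf vfieldC.
have kc (l : seq K) i : kill 0 (cf 4 l i) = cf 4 l i by rewrite /cf killC.
have kill0D i : kill 0 (vfield M 'X_i) =
    (M i 1)%:MP * 'X_1 + (M i 2%R)%:MP * 'X_2%R + (M i 3%R)%:MP * 'X_3%R.
  rewrite vfieldX linear_form4 !mxE !rmorphD !rmorphM /= !killX !killC /=.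
  by rewrite mulr0 add0r.
pose n00 := M 3%R 3%R; pose n01 := M 3%R 2%R; pose n02 := M 3%R 1.
pose n10 := M 2%R 3%R; pose n11 := M 2%R 2%R; pose n12 := M 2%R 1.
pose mu := M 1 2%R; pose c2 := M 1 1; pose la := M 0 1.
pose C x : S := x%:MP.
have E : tangency_quartic 'X_2%R 'X_3%R (cf 4 a) (cf 4 b) (C n00) (C n01) (C n10) (C n11) (C mu)
  + 'X_1 * (C la * G - tangent_cubic (cf 4 a) (cf 4 b) (cf 4 c) (C n00) (C n01) (C n02)
     (C n10) (C n11) (C n12) (C mu) (C c2) 1 'X_3%R 'X_2%R 'X_1) = 0.
  apply: (@tangency_equation S (vfield M) (kill 0) 'X_0 'X_1 'X_2%R 'X_3%R (cf 4 a) (cf 4 b)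
    (cf 4 c) G (quadric4 (cf 4 h) 'X_3%R 'X_2%R 'X_1 'X_0) (C n00) (C n01) (C n02) (C n10) (C n11)
    (C n12) (C mu) (C c2) (C la)).
  - exact: raddfD.
  - exact: vfieldM.
  - exact: Dc.
  - exact: Dc.
  - exact: Dc.
  - exact: kc.
  - exact: kc.
  - exact: kc.
  - exact: killX.
  - exact: killX.
  - exact: killX.
  - exact: killX.
  - exact: kG.
  - by apply: etrans (kill0D _) _; rewrite M02 M03 mpolyC0 !mul0r !addr0.
  - by apply: etrans (kill0D _) _; rewrite M13 mpolyC0 !mul0r !addr0 addrC.
  - by apply: etrans (kill0D _) _; rewrite /C; ring.
  - by apply: etrans (kill0D _) _; rewrite /C; ring.
  - by rewrite -FE MF rmorphM /= killX mulr0.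
(* Setting v = 0 isolates the binary part; cancelling v afterwards gives G. *)
have T0 : tangency_quartic 'X_2%R 'X_3%R (cf 4 a) (cf 4 b) (C n00) (C n01) (C n10) (C n11) (C mu) = 0.
  have kC x : kill 1 (C x) = C x := killC 1 x.
  have kc1 (l : seq K) i : kill 1 (cf 4 l i) = cf 4 l i by rewrite /cf killC.
  have := congr1 (kill 1) E; rewrite rmorph0 rmorphD rmorphM /= killX /= mul0r addr0 => <-.
  rewrite /tangency_quartic /quartic2_s /quartic2_t /cubic2.
  by rewrite !(rmorph_nat, rmorphXn, rmorphM, rmorphD) /= !kc1 !kC !killX.
exists a, b, c, h; split.
  have X1 : 'X_1 != 0 :> S by rewrite -msize_poly_eq0 msizeX.
  move/eqP: E; rewrite T0 add0r mulf_eq0 (negPf X1) /= subr_eq0 => /eqP Geq.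
  (* The parameter [la] of the family is the inverse of the entry [M 0 1], which keeps the family
     polynomial. *)
  have GE : G = tangent_cubic (cf 4 a) (cf 4 b) (cf 4 c) (C n00) (C n01) (C n02)
     (C n10) (C n11) (C n12) (C mu) (C c2) (C la^-1) 'X_3%R 'X_2%R 'X_1.
    have -> : G = C la^-1 * (C la * G) by rewrite mulrA -mpolyCM mulVf // mpolyC1 mul1r.
    by rewrite Geq /tangent_cubic /=; ring.
  by rewrite FE GE.
pose coefs := tangency_coefs (nth 0 a 0) (nth 0 a 1) (nth 0 a 2) (nth 0 a 3) (nth 0 a 4)
    (nth 0 b 0) (nth 0 b 1) (nth 0 b 2) (nth 0 b 3) n00 n01 n10 n11 mu.
have Q0 : quartic2 (cf 4 coefs) 'X_3%R ('X_2%R : S) = 0.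
  rewrite -T0 /quartic2 /tangency_quartic /quartic2_s /quartic2_t /cubic2 /cf /coefs /C /=.
  rewrite !(mpolyCD, mpolyCM, mpolyC_nat); ring.
have coefs0 := quartic2_eq0 Q0.
apply: (@eq_from_nth _ 0) => // i i5; rewrite -/coefs coefs0 //.
by case: i i5 => [|[|[|[|[|]]]]].
Qed.

Lemma normal_form :
  (M 1 2%R = 1) \/ [/\ M 1 2%R = 0, M 2%R 3%R = 0 & M 0 1 = 1] ->
  exists ch y e, [/\ (ch < 8)%N, size e = 19 &
    F = tangent_quartic (cf 4 (chart ch (nth 0 y))) (cf 4 e) 'X_0 'X_1 'X_2%R 'X_3%R].
Proof.
move=> cases; have [a [b [c [h [FE eqs]]]]] := tangent_form.
have [ch [y [ch8 yd]]] : exists ch y, (ch < 8)%N /\ chart ch (nth 0 y) =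
    [:: nth 0 a 0; nth 0 a 1; nth 0 a 2; nth 0 a 3; nth 0 a 4;
      nth 0 b 0; nth 0 b 1; nth 0 b 2; nth 0 b 3;
      M 3%R 3%R; M 3%R 2%R; M 2%R 3%R; M 2%R 2%R; M 1 2%R; (M 0 1)^-1].
  case: cases => [mu1|[mu0 n10 la1]]; first exact: (chart_cover_transverse _ eqs mu1).
  by apply: (chart_cover_tangent eqs mu0 n10); rewrite la1 invr1.
eexists ch, y, _; split; [exact: ch8 | | by rewrite yd; exact: FE].
by [].
Qed.

End NormalForm.

(** * Adapted coordinates *)

Section Flags.
Variable K : numClosedFieldType.
Implicit Types (M Y : 'M[K]_4) (c : 'rV[K]_4).

(* M is lower Hessenberg in its first rows, and either its second
   superdiagonal entry is nonzero or the third one vanishes as well. *)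
Definition adapted M := [/\ M 0 2%R = 0, M 0 3%R = 0, M 0 1 != 0, M 1 3%R = 0 &
  M 1 2%R = 0 -> M 2%R 3%R = 0].

Lemma row_free_adjoin m n (A : 'M[K]_(m, n)) (v : 'rV_n) :
  row_free A -> ~~ (v <= A)%MS -> row_free (col_mx A v).
Proof.
move=> Afree vA; rewrite -kermx_eq0; apply/contraT => /rowV0Pn[u /sub_kermxP].
rewrite -[u]hsubmxK mul_row_col; set a := lsubmx u; rewrite [rsubmx u]mx11_scalar.
set b := rsubmx u 0 0; rewrite mul_scalar_mx => e.
have [b0|b0] := eqVneq b 0.
  move: e; rewrite b0 scale0r addr0 => aA; have a0 : a = 0.
    by apply: (row_free_inj Afree); rewrite aA mul0mx.
  by rewrite a0 raddf0 row_mx0 eqxx.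
case/negP: vA; apply/submxP; exists (- b^-1 *: a).
move/eqP: e; rewrite addr_eq0 => /eqP aA.
by rewrite -scalemxAl aA scalerN scaleNr opprK scalerA mulVf // scale1r.
Qed.

Definition first_rows m (V : 'M[K]_(m, 4)) Y :=
  forall (i : 'I_m) (j : 'I_4), i = j :> nat -> row j Y = row i V.

Lemma coords_first_rows m (V : 'M[K]_(m, 4)) Y v (j : 'I_4) : Y \in unitmx -> first_rows V Y ->
  (v <= V)%MS -> (m <= j)%N -> (v *m invmx Y : 'rV_4) 0 j = 0.
Proof.
move=> Yu VY /submxP[u ->] mj.
have VE i : (m <= 4)%N -> row i V = row (inord i) Y.
  by move=> m4; rewrite (VY i (inord i)) // inordK // (leq_trans (ltn_ord i)).
have m4 : (m <= 4)%N by rewrite (leq_trans mj) // ltnW.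
rewrite -mulmxA mxE big1 // => i _.
have -> : (V *m invmx Y) i j = (row i V *m invmx Y) 0 j by rewrite -row_mul [RHS]mxE.
rewrite VE // -row_mul mulmxV // row1 mxE eqxx /=.
case: eqP => [/(congr1 val)/= e|_]; last by rewrite mulr0.
rewrite inordK ?(leq_trans (ltn_ord i)) // in e.
by move: (ltn_ord i) mj; rewrite e ltnNge => /negPf ->.
Qed.

Lemma coords_first_row m (V : 'M[K]_(m, 4)) Y (i : 'I_m) (j : 'I_4) : Y \in unitmx ->
  first_rows V Y -> i = j :> nat -> row i V *m invmx Y = delta_mx 0 j.
Proof. by move=> Yu VY ij; rewrite -(VY i j ij) -row_mul mulmxV // row1. Qed.

(** The flag is generated by c, c M, c M^2 when these are independent. Otherwise the span W of c and
    c M is invariant, and the third vector lifts an eigenvector of M on the quotient by W, so that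
    the third step is invariant as well. *)
Lemma adapted_basis M c : c != 0 -> (forall a, c *m M != a *: c) ->
  exists2 Y : 'M[K]_4, Y \in unitmx & row 0 Y = c /\ adapted (Y *m M *m invmx Y).
Proof.
move=> c0 cM; pose c1 := c *m M; pose c2 := c1 *m M.
have cfree : row_free c by rewrite -row_leq_rank rank_rV c0.
have Wfree : row_free (col_mx c c1).
  by apply: row_free_adjoin => //; apply/sub_rVP => -[a e]; case/eqP: (cM a).
set W := col_mx c c1 in Wfree *.
have flag (v : 'rV_4) : ~~ (v <= W)%MS -> exists2 Y : 'M[K]_4, Y \in unitmx &
    first_rows (col_mx W v) Y.
  by move=> vW; apply: complete_basis; apply: row_free_adjoin.
have W0 : row 0 W = c.
  apply/rowP => j; rewrite mxE -(col_mxEu c c1 0 j).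
  by congr (col_mx c c1 _ _); apply: val_inj.
have W1 : row 1 W = c1.
  apply/rowP => j; rewrite mxE -(col_mxEd c c1 0 j).
  by congr (col_mx c c1 _ _); apply: val_inj.
have rows (v : 'rV_4) Y : first_rows (col_mx W v) Y ->
    [/\ row 0 Y = c, row 1 Y = c1, row 2%R Y = v & first_rows W Y].
  move=> vY; have WY : first_rows W Y.
    by move=> i j ij; rewrite (vY (lshift 1 i) j) // rowKu.
  split=> //; first by rewrite (WY 0 0).
    by rewrite (WY 1 1).
  rewrite (vY (rshift 2 0) 2%R) // rowKd; apply/rowP => j; by rewrite mxE.
have entry Y (i j : 'I_4) : (Y *m M *m invmx Y) i j = (row i Y *m M *m invmx Y) 0 j.
  by rewrite -!row_mul [RHS]mxE.
have c1W : (c1 <= W)%MS by rewrite -W1 row_sub.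
have first Y : Y \in unitmx -> first_rows W Y ->
   [/\ (c1 *m invmx Y) 0 1 = 1, (c1 *m invmx Y) 0 2%R = 0 & (c1 *m invmx Y) 0 3%R = 0].
  move=> Yu WY; split; try exact: (coords_first_rows Yu WY c1W).
  by rewrite -W1 (@coords_first_row _ _ _ _ 1 Yu WY) // mxE.
have [c2W|c2W] := boolP (c2 <= W)%MS; last first.
  have [Y Yu vY] := flag _ c2W; have [Y0 Y1 Y2 WY] := rows _ _ vY.
  exists Y => //; split=> //; have [f1 f2 f3] := first Y Yu WY.
  have c2V : (c2 <= col_mx W c2)%MS by rewrite -addsmxE addsmxSr.
  split; rewrite ?entry ?Y0 ?Y1 -?/c1 -?/c2 //; first by rewrite f1 oner_neq0.
    exact: (coords_first_rows Yu vY c2V).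
  have -> : c2 = row (rshift 2 (0 : 'I_1)) (col_mx W c2).
    by apply/rowP => j; rewrite [RHS]mxE (col_mxEd W c2 0 j).
  by rewrite (@coords_first_row _ _ _ _ 2%R Yu vY) // mxE => /eqP; rewrite oner_eq0.
have [Z Zu WZ] := complete_basis Wfree.
pose M0 : 'M_(2 + 2) := Z *m M *m invmx Z.
(* In a basis starting with W, the lower right block of M is its action on the quotient by W. *)
have /closed_rootP[rho] : size (char_poly (drsubmx M0)) != 1%N by rewrite size_char_poly.
rewrite -eigenvalue_root_char => /eigenvalueP[b bB b0].
pose y : 'rV_4 := (row_mx 0 b : 'rV_(2 + 2)) *m Z.
have uZ : usubmx (Z : 'M_(2 + 2, 4)) = W.
  apply/row_matrixP => i; rewrite -(WZ i (lshift 2 i)) //.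
  by apply/rowP => j; rewrite !mxE.
have Wrow (x : 'rV_2) : x *m W = (row_mx x 0 : 'rV_(2 + 2)) *m Z.
  rewrite -uZ -[RHS]/(row_mx x 0 *m (Z : 'M_(2 + 2, 4))).
  by rewrite -[X in _ = _ *m X](vsubmxK (Z : 'M_(2 + 2, 4))) mul_row_col mul0mx addr0.
have yW : ~~ (y <= W)%MS.
  apply/negP => /submxP[x]; rewrite Wrow => /(congr1 (mulmx^~ (invmx Z))).
  rewrite /= !mulmxK // => e; have [_ b_0] := @eq_row_mx _ 1 2 2 0 b x 0 e; by rewrite b_0 eqxx in b0.
have yM : y *m M = (b *m dlsubmx M0) *m W + rho *: y.
  have -> : y *m M = (row_mx 0 b : 'rV_(2 + 2)) *m M0 *m Z.
    by rewrite /M0 /y !mulmxA mulmxKV.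
  rewrite -[M0 in LHS]submxK mul_row_block !mul0mx !add0r bB.
  rewrite -[row_mx _ _](_ : row_mx (b *m dlsubmx M0) 0 + rho *: row_mx 0 b = _).
    by rewrite mulmxDl -Wrow -scalemxAl.
  by rewrite scale_row_mx scaler0 add_row_mx addr0 add0r.
have [Y Yu vY] := flag _ yW; have [Y0 Y1 Y2 WY] := rows _ _ vY.
exists Y => //; split=> //; have [f1 f2 f3] := first Y Yu WY.
split; rewrite ?entry ?Y0 ?Y1 ?Y2 -?/c1 -?/c2 //; first by rewrite f1 oner_neq0.
  exact: (coords_first_rows Yu WY c2W).
move=> _; apply: (coords_first_rows Yu vY) => //; rewrite yM -addsmxE.
apply: addmx_sub_adds; first exact: submxMl.
exact: scalemx_sub.
Qed.

(** Adaptedness depends only on the flag spanned by the leading rows, not on the basis. This makes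
    it possible to pass to flag representatives with six parameters. *)
Lemma lower_conj (T G H : 'M[K]_4) : (forall i j : 'I_4, (i < j)%N -> T i j = 0) ->
  (forall i, T i i != 0) -> T *m H = G *m T -> adapted G -> adapted H.
Proof.
move=> T0 Td e [G02 G03 G01 G13 G23].
have E i j : T i 0 * H 0 j + T i 1 * H 1 j + T i 2%R * H 2%R j + T i 3%R * H 3%R j =
    G i 0 * T 0 j + G i 1 * T 1 j + G i 2%R * T 2%R j + G i 3%R * T 3%R j.
  by have /matrixP/(_ i j) := e; rewrite !mxE !sum_ord4.
have cancel i x : T i i * x = 0 -> x = 0.
  by move/eqP; rewrite mulf_eq0 (negPf (Td i)) => /eqP.
have T01 : T 0 1 = 0 by apply: T0.
have T02 : T 0 2%R = 0 by apply: T0.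
have T03 : T 0 3%R = 0 by apply: T0.
have T12 : T 1 2%R = 0 by apply: T0.
have T13 : T 1 3%R = 0 by apply: T0.
have T23 : T 2%R 3%R = 0 by apply: T0.
have H02 : H 0 2%R = 0.
  by apply: (cancel 0); have := E 0 2%R; rewrite T01 T02 T03 T12 G02 G03 !(mul0r, mulr0, addr0).
have H03 : H 0 3%R = 0.
  by apply: (cancel 0); have := E 0 3%R; rewrite T01 T02 T03 T13 G02 G03 !(mul0r, mulr0, addr0).
have H13 : H 1 3%R = 0.
  apply: (cancel 1); have := E 1 3%R.
  by rewrite T12 T13 T03 T23 G13 H03 !(mul0r, mulr0, addr0, add0r).
have e01 : T 0 0 * H 0 1 = G 0 1 * T 1 1.
  by have := E 0 1; rewrite T01 T02 T03 G02 G03 !(mul0r, mulr0, addr0, add0r).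
have e12 : T 1 1 * H 1 2%R = G 1 2%R * T 2%R 2%R.
  by have := E 1 2%R; rewrite T12 T13 T02 G13 H02 !(mul0r, mulr0, addr0, add0r).
split=> //.
  apply: contraNneq (mulf_neq0 G01 (Td 1)) => H01.
  by rewrite -e01 H01 mulr0.
move=> H12; have G12 : G 1 2%R = 0.
  move/eqP: e12; rewrite H12 mulr0 eq_sym mulf_eq0 (negPf (Td 2%R)) orbF.
  by move/eqP.
apply: (cancel 2%R); have := E 2%R 3%R.
by rewrite T03 T13 T23 H03 H13 (G23 G12) !(mul0r, mulr0, addr0, add0r).
Qed.

(** Decomposing the transpose puts the triangular factor with arbitrary diagonal on the left, where
    it does not change the flag. What remains is unipotent up to a permutation: six free entries
    when Y is 4 by 4. *)
Lemma lup_decomposition n (Y : 'M[K]_n.+1) : Y \in unitmx -> exists (T Z : 'M[K]_n.+1) (L : 'M[K]_n.+1) (s : 'S_n.+1),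
  [/\ Y = T *m Z, Z = L^T *m perm_mx s,
      (forall i j : 'I_n.+1, (i < j)%N -> T i j = 0), (forall i, T i i != 0)
    & forall i j : 'I_n.+1, (i <= j)%N -> L i j = (i == j)%:R].
Proof.
move=> Yu; have := cormen_lup_correct Y^T; have := cormen_lup_perm Y^T.
have := @cormen_lup_lower _ _ Y^T; have := @cormen_lup_upper _ _ Y^T.
case: (cormen_lup Y^T) => [[P L] U] /= hU hL /is_perm_mxP[s Ps] e; rewrite {}Ps in e.
have YE : Y = U^T *m (L^T *m perm_mx s).
  rewrite mulmxA -trmx_mul; apply: trmx_inj; rewrite [RHS]trmx_mul trmxK tr_perm_mx.
  by rewrite -[L *m U]e mulmxA -perm_mxM mulVg perm_mx1 mul1mx.
have T0 (i j : 'I_n.+1) : (i < j)%N -> U^T i j = 0 by move=> ij; rewrite mxE hU.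
exists U^T, (L^T *m perm_mx s), L, s; split=> // i.
have : U^T \in unitmx by move: Yu; rewrite YE unitmx_mul => /andP[].
rewrite unitmxE unitfE det_trig ?prodf_seq_neq0; last by apply/is_trig_mxP.
by move/allP/(_ i); rewrite mem_index_enum => /(_ isT).
Qed.

End Flags.

Section BadFamily.
Variable R : comNzRingType.
Implicit Types (x : 'I_4 -> R) (p : nat -> R).

(* The coordinates z = N x, for N a unipotent upper triangular matrix
   multiplied by a permutation: representatives of the flags of P^3. *)
Definition bad_quartic x (s : 'S_4) (ch : nat) p : R :=
  tangent_quartic (fun i => nth 0 (chart ch (fun j => p (6 + j)%N)) i) (fun i => p (15 + i)%N)
    (x (s 0) + p 0 * x (s 1) + p 1 * x (s 2%R) + p 2 * x (s 3%R))
    (x (s 1) + p 3 * x (s 2%R) + p 4 * x (s 3%R))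
    (x (s 2%R) + p 5 * x (s 3%R))
    (x (s 3%R)).

Lemma bad_quartic_ext x x' s ch p p' : x =1 x' -> (forall i, (i < 34)%N -> p i = p' i) ->
  bad_quartic x s ch p = bad_quartic x' s ch p'.
Proof.
move=> hx h; rewrite /bad_quartic !hx !h //; apply: tangent_quartic_ext => i hi.
  by rewrite (@chart_ext _ ch _ (fun j => p' (6 + j)%N)) // => j hj; apply: h; apply: (@leq_trans (6 + 9)).
by apply: h; apply: (@leq_trans (15 + 19)); rewrite // ltn_add2l.
Qed.

End BadFamily.

Lemma bad_quartic_morph (R R' : comNzRingType) (phi : {rmorphism R -> R'}) x s ch p :
  phi (bad_quartic x s ch p) = bad_quartic (phi \o x) s ch (phi \o p).
Proof.
rewrite /bad_quartic tangent_quartic_morph !(rmorphM, rmorphD) /=.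
by apply: tangent_quartic_ext => i _ //=; rewrite chart_morph.
Qed.

Section Bad.
Variable K : numClosedFieldType.
Local Notation S := {mpoly K[4]}.

Lemma vfield_scale (M : 'M[K]_4) k p : vfield (k *: M) p = k *: vfield M p.
Proof.
rewrite /vfield scaler_sumr; apply: eq_bigr => i _; rewrite scalerAl; congr (_ * _).
by rewrite /linear_form scaler_sumr; apply: eq_bigr => j _; rewrite scalerA !mxE.
Qed.

Lemma bad_param (F : S) (c : 'rV[K]_4) (M : 'M[K]_4) w : F \is 4.-homog ->
  c != 0 -> (forall a, c *m M != a *: c) -> vfield M F = w * linear_form c ->
  exists (s : 'S_4) ch (p : nat -> K), (ch < 8)%N /\
    F = bad_quartic (fun i => 'X_i) s ch (fun i => (p i)%:MP).
Proof.
move=> hF c0 cM MF.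
have [Y Yu [Yc adY]] := adapted_basis c0 cM.
have [T [Z [L [s [YE ZE T0 Td L0]]]]] := lup_decomposition Yu.
have Zu : Z \in unitmx by move: Yu; rewrite YE unitmx_mul => /andP[].
have Tu : T \in unitmx by move: Yu; rewrite YE unitmx_mul => /andP[].
pose H := Z *m M *m invmx Z.
have adH : adapted H.
  apply: (lower_conj T0 Td _ adY).
  have -> : T = Y *m invmx Z by rewrite YE mulmxK.
  by rewrite /H !mulmxA !mulmxKV.
case: adH => H02 H03 H01 H13 H23.
pose F' := subst (invmx Z) F.
have FE : F = subst Z F' by rewrite /F' subst_subst mulVmx // subst1.
have hF' : F' \is 4.-homog by apply: subst_homog.
have cZ : c *m invmx Z = T 0 0 *: delta_mx 0 0.
  rewrite -Yc YE row_mul mulmxK //; apply/rowP => j; rewrite !mxE eqxx /=.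
  have [->|j0] := eqVneq j 0; first by rewrite mulr1.
  by rewrite mulr0 T0 // lt0n.
have HF : vfield H F' = subst (invmx Z) w * (T 0 0)%:MP * 'X_0.
  rewrite /F' -(@subst_vfield _ _ _ M) ?MF; last first.
    by rewrite /H !mulmxA mulVmx // mul1mx.
  rewrite rmorphM /= subst_linear_form cZ -mulrA; congr (_ * _).
  rewrite /linear_form (bigD1 0) //= big1 ?addr0 => [|j j0].
    by rewrite !mxE eqxx mulr1 mul_mpolyC.
  by rewrite !mxE (negPf j0) andbF mulr0 scale0r.
(* Rescaling the field normalizes mu to 1, or [H 0 1] to 1 when mu = 0; this saves one parameter. *)
have [k k0 kH] : exists2 k, k != 0 & (k *: H) 1 2%R = 1 \/
    [/\ (k *: H) 1 2%R = 0, (k *: H) 2%R 3%R = 0 & (k *: H) 0 1 = 1].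
  have [H12|H12] := eqVneq (H 1 2%R) 0.
    exists (H 0 1)^-1; first by rewrite invr_eq0.
    by right; split; rewrite mxE ?H12 ?H23 // ?mulr0 // mulVf.
  by exists (H 1 2%R)^-1; [rewrite invr_eq0 | left; rewrite mxE mulVf].
have kHF : vfield (k *: H) F' = k *: (subst (invmx Z) w * (T 0 0)%:MP) * 'X_0.
  by rewrite vfield_scale HF scalerAl.
have [ch [y [e [ch8 _ F'E]]]] : exists ch y e, [/\ (ch < 8)%N, size e = 19%N &
    F' = tangent_quartic (cf 4 (chart ch (nth 0 y))) (cf 4 e) 'X_0 'X_1 'X_2%R 'X_3%R].
  apply: (normal_form hF' kHF) kH; rewrite mxE ?H02 ?H03 ?H13 ?mulr0 //.
  exact: mulf_neq0.
(* Six entries of the flag, nine chart parameters and nineteen free coefficients: 34 in all. *)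
pose p i := if (i < 6)%N then nth 0 [:: L 1 0; L 2%R 0; L 3%R 0; L 2%R 1; L 3%R 1; L 3%R 2%R] i
  else if (i < 15)%N then nth 0 y (i - 6) else nth 0 e (i - 15).
exists s, ch, p; split=> //.
have z_form i : subst Z 'X_i = (L 0 i)%:MP * 'X_(s 0) + (L 1 i)%:MP * 'X_(s 1)
    + (L 2%R i)%:MP * 'X_(s 2%R) + (L 3%R i)%:MP * 'X_(s 3%R).
  rewrite substX ZE /linear_form; under eq_bigr => j _.
    rewrite !mxE sum_ord4 !mxE !scalerDl -!scalerA; over.
  rewrite !big_split /= -!scaler_sumr -!mul_mpolyC.
  have pick a : \sum_(j < 4) (s a == j)%:R *: 'X_j = 'X_(s a) :> S.
    rewrite (bigD1 (s a)) //= eqxx scale1r big1 ?addr0 // => j ne.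
    by rewrite eq_sym (negPf ne) scale0r.
  by rewrite !pick.
have L01 : L 0 1 = 0 by rewrite L0. have L02 : L 0 2%R = 0 by rewrite L0.
have L03 : L 0 3%R = 0 by rewrite L0. have L12 : L 1 2%R = 0 by rewrite L0.
have L13 : L 1 3%R = 0 by rewrite L0. have L23 : L 2%R 3%R = 0 by rewrite L0.
have Ld i : L i i = 1 by rewrite L0 // eqxx.
rewrite FE F'E tangent_quartic_morph /= !z_form !Ld L01 L02 L03 L12 L13 L23.
rewrite mpolyC0 mpolyC1 !mul0r !add0r !mul1r /bad_quartic /p /=.
apply: tangent_quartic_ext => i hi /=.
  rewrite /cf substC; exact: (@chart_morph _ _ (@mpolyC 4 K) ch (nth 0 y) i).
by rewrite /cf substC addKn.
Qed.

End Bad.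

(** * General quartics *)

Lemma dhomog_monomials n (R : nzRingType) d (v : dhomog n R d) :
  v = \sum_(m : 'X_{1..n < d.+1}) (mpoly_of_dhomog v)@_m *: ['dhomog_d 'X_[m]].
Proof.
apply: val_inj; rewrite /= raddf_sum /= [LHS](@mpolywE _ _ d.+1); last first.
  rewrite msizeE; apply/bigmax_leqP_seq => m hm _.
  by rewrite (dhomog_mf (dhomog_is_dhomog v) hm).
apply: eq_bigr => m _; have [md|md] := eqVneq (mdeg m) d.
  by rewrite insubdK // dhomogX /= md.
by rewrite (dhomog_nemf_coeff (dhomog_is_dhomog v)) // !scale0r.
Qed.

Section General.
Variable K : numClosedFieldType.

Definition no_tangent_field (F : dhomog 4 K 4) := forall c : 'rV[K]_4, c != 0 ->
  forall M : 'M[K]_4, (exists w, vfield M (mpoly_of_dhomog F) = w * linear_form c) ->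
  exists a, c *m M = a *: c.

Lemma general_no_tangent_field : general no_tangent_field.
Proof.
pose A := {mpoly K[34]}.
(* The universal quartic of each permutation and chart, with coefficients polynomial in the 34
   parameters; evaluating these gives the members of the family. *)
pose G (t : 'S_4 * 'I_8) : {mpoly A[4]} :=
  bad_quartic (fun i => 'X_i) t.1 t.2 (fun i => ('X_(inord i))%:MP).
have GE t (W : 'I_34 -> K) : map_mpoly (meval W) (G t) =
    bad_quartic (fun i => 'X_i) t.1 t.2 (fun i => (W (inord i))%:MP).
  rewrite bad_quartic_morph; apply: bad_quartic_ext => i /=; first by rewrite map_mpolyX.
  by rewrite map_mpolyC /= mevalXU.
apply: (@general_of_parametrized _ (dhomog 4 K 4) _ _ 34 (fun t i =>
  \sum_(m : 'X_{1..4 < 5}) coord (vbasis {:dhomog 4 K 4}) i ['dhomog_4 'X_[m]] *: (G t)@_m)).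
- by rewrite dimvf.
- move=> k v v0 k0 h c c0 M [w Mw]; apply: (h c c0 M); exists (k *: w).
  by rewrite /= -scalerAl -Mw /vfield scaler_sumr; apply: eq_bigr => i _; rewrite mderivZ scalerAr.
move=> v v0 nG c c0 M [w Mw].
have [/sub_rVP[a ->]|cM] := boolP (c *m M <= c)%MS; first by exists a.
case: nG; have [a|s [ch [p [ch8 vE]]]] := bad_param (dhomog_is_dhomog v) c0 _ Mw.
  by apply: contra cM => /eqP ->; apply: scalemx_sub.
exists (s, Ordinal ch8), (fun i => p i) => i.
rewrite {1}[v]dhomog_monomials linear_sum [RHS]raddf_sum /=; apply: eq_bigr => m _.
rewrite linearZ /= mevalZ mulrC; congr (_ * _).
rewrite -mcoeff_map_mpoly GE vE /=; congr (_ @_ _).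
by apply: bad_quartic_ext => // j hj; rewrite inordK.
Qed.

Lemma general_sub (V : vectType K) (P Q : V -> Prop) :
  (forall v, P v -> Q v) -> general P -> general Q.
Proof. by move=> PQ [U [oU neU UP]]; exists U; split=> // v v0 /(UP v v0)/PQ. Qed.

Lemma smooth_section_unramified (F : dhomog 4 K 4) (l : dhomog 4 K 1) :
  no_tangent_field F -> smooth_section F l ->
  H0_tangent_restr_eq0 (surface F) (plane_section F l) /\
  kodaira_spencer_injective (surface F) (plane_section F l).
Proof.
move=> nt [l0 sm]; pose c := \row_b (mpoly_of_dhomog l)@_U_(b).
have lE : mpoly_of_dhomog l = linear_form c.
  rewrite [LHS]linear_formE ?dhomog_is_dhomog // /linear_form.
  by apply: eq_bigr => b _; rewrite mxE.
have c0 : c != 0.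
  apply: contraNneq l0 => c0; apply/eqP/val_inj; rewrite /= lE c0 /linear_form.
  by rewrite big1 // => b _; rewrite mxE scale0r.
have [k lk] : exists k, (mpoly_of_dhomog l)@_U_(k) != 0.
  by have /rV0Pn[k] := c0; rewrite mxE; exists k.
have hF : mpoly_of_dhomog F \is 4.-homog := dhomog_is_dhomog F.
have hl : mpoly_of_dhomog l \is 1.-homog := dhomog_is_dhomog l.
move: sm hl lk; rewrite /plane_section /surface lE => sm hl lk.
have NS := no_linear_syzygy hF c0 sm (nt c c0).
have nl := smooth_notin hF sm.
split; first exact: (H0_tangent_restr hF isT hl lk nl NS).
exact: (kodaira_spencer_inj hF isT hl lk nl NS).
Qed.

End General.

Theorem corollary4p12 (R : realType) :
  general (fun F : dhomog 4 R[i] 4 =>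
    (forall l : dhomog 4 R[i] 1, smooth_section F l ->
       H0_tangent_restr_eq0 (surface F) (plane_section F l)) /\
    moduli_map_unramified F).
Proof.
apply: general_sub (general_no_tangent_field _) => F nt.
by split=> l /(smooth_section_unramified nt)[].
Qed.
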